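(* Let $b>1$ be an integer and let $G$ be isomorphic to one of $\mathrm{PSL}_2(2^b)$, $\mathrm{PSL}_2(3^b)$ or ${}^2B_2(2^b)$. Let $x\in \mathrm{Aut}(G)$ have order $b$, where $b$ is coprime to $|G|$. Let $L=G\langle x\rangle$. Then $(x^L)^2=x^2G$.
   Context: $G$ is identified with $\mathrm{Inn}(G)\le \mathrm{Aut}(G)$, so $L=G\langle x\rangle$ is a subgroup of $\mathrm{Aut}(G)$. ${}^2B_2(2^b)$ denotes the Suzuki group over the field of $2^b$ elements, which is defined for $b$ odd. $x^L$ is the $L$-conjugacy class of $x$, $(x^L)^2=\{uv\mid u,v\in x^L\}$, and $x^2G$ is the coset of $G$ in $L$ containing $x^2$. *)

(* Defs.v *)
From HB Require Import structures.
From mathcomp Require Import all_boot all_order all_algebra all_fingroup.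
From mathcomp Require Import all_solvable all_field.

Set Implicit Arguments.
Unset Strict Implicit.
Unset Printing Implicit Defensive.

Import GRing.Theory.
Local Open Scope ring_scope.
Local Open Scope group_scope.

Definition Inn (gT : finGroupType) (G : {group gT}) : {set {perm gT}} :=
  conj_aut G @* G.

Canonical Inn_group (gT : finGroupType) (G : {group gT}) :=
  [group of Inn G].

Definition SL (n : nat) (F : finFieldType) : {set {'GL_n[F]}} :=
  [set u | \det (GLval u) == 1%R].

Lemma SL_group_set (n : nat) (F : finFieldType) : group_set (SL n F).
Proof.
apply/group_setP; split=> [|u v]; rewrite !inE ?GL_1E ?det1 //.
by move=> /eqP du /eqP dv; rewrite GL_ME det_mulmx du dv mulr1.
Qed.

Canonical SL_group (n : nat) (F : finFieldType) := Group (SL_group_set n F).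

Definition PSL (n : nat) (F : finFieldType) := SL n F / 'Z(SL n F).

Canonical PSL_group (n : nat) (F : finFieldType) := [group of PSL n F].

(* For #|F| = 2 ^ b with b odd, this is the automorphism of F whose square is *)
(* the Frobenius automorphism (see sz_thetaK below).                          *)
Definition sz_theta (F : finFieldType) (a : F) : F :=
  (a ^+ (2 ^ (logn 2 #|F|).+1./2))%R.

Definition mx4 (F : finFieldType) (rows : seq (seq F)) : 'M[F]_4 :=
  \matrix_(i < 4, j < 4) nth 0%R (nth [::] rows i) j.

Definition szS (F : finFieldType) (a b : F) : 'M[F]_4 :=
  let t := @sz_theta F in
  mx4 [:: [:: 1; 0; 0; 0];
          [:: a; 1; 0; 0];
          [:: b; t a; 1; 0];
          [:: a ^+ 2 * t a + a * b + t b; a * t a + b; a; 1]]%R.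

Definition szM (F : finFieldType) (k : F) : 'M[F]_4 :=
  let t := @sz_theta F in
  mx4 [:: [:: k * t k; 0; 0; 0];
          [:: 0; k; 0; 0];
          [:: 0; 0; k^-1; 0];
          [:: 0; 0; 0; (k * t k)^-1]]%R.

Definition szT (F : finFieldType) : 'M[F]_4 :=
  mx4 [:: [:: 0; 0; 0; 1];
          [:: 0; 0; 1; 0];
          [:: 0; 1; 0; 0];
          [:: 1; 0; 0; 0]]%R.

(* Suzuki's matrix group in GL_4(F), with the generators of Huppert and       *)
(* Blackburn, Finite Groups III, XI.3; their parameter lambda is sz_theta k.  *)
(* Meaningful only for #|F| = 2 ^ b with b odd.                               *)
Definition Sz (F : finFieldType) : {set {'GL_4[F]}} :=
  << [set u : {'GL_4[F]} | [|| [exists a, exists b, GLval u == szS a b],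
                  [exists k, (k != 0%R) && (GLval u == szM k)]
                | GLval u == szT F]] >>.

Canonical Sz_group (F : finFieldType) := [group of Sz F].

Lemma sz_thetaK (F : finFieldType) (b : nat) (a : F) :
  #|F| = (2 ^ b)%N -> odd b -> sz_theta (sz_theta a) = (a ^+ 2)%R.
Proof.
move=> cF ob; rewrite /sz_theta -exprM -expnD addnn cF pfactorK //.
have -> : b.+1./2.*2 = b.+1 by have := odd_double_half b.+1; rewrite /= ob.
by rewrite expnSr exprM -cF expf_card.
Qed.

(* All the generating matrices are invertible, hence occur in GL_4(F).        *)
Lemma szS_unit (F : finFieldType) (a b : F) : szS a b \in unitmx.
Proof.
rewrite unitmxE det_trig ?big_ord_recl ?big_ord0 ?mxE /= ?mulr1 ?unitr1 //.
by apply/is_trig_mxP=> -[[|[|[|[|//]]]] ?] [[|[|[|[|//]]]] ?]; rewrite ?mxE.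
Qed.

Lemma szM_unit (F : finFieldType) (k : F) : k != 0%R -> szM k \in unitmx.
Proof.
move=> k0; have t0 : sz_theta k != 0%R by rewrite expf_neq0.
rewrite unitmxE det_trig.
  rewrite !big_ord_recl big_ord0 !mxE /= unitfE.
  by rewrite !mulf_neq0 ?invr_eq0 ?mulf_neq0 ?oner_eq0.
by apply/is_trig_mxP=> -[[|[|[|[|//]]]] ?] [[|[|[|[|//]]]] ?]; rewrite ?mxE.
Qed.

Lemma szT_unit (F : finFieldType) : szT F \in unitmx.
Proof.
suff /mulmx1_unit[] : (szT F *m szT F = 1%:M)%R by [].
apply/matrixP=> -[[|[|[|[|//]]]] ?] [[|[|[|[|//]]]] ?];
  by rewrite !mxE !big_ord_recl big_ord0 !mxE /= ?mulr0 ?mul0r ?mulr1 ?addr0 ?add0r.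
Qed.

(* Main.v *)
(* Each of the groups is a split doubly transitive group with Borel subgroup
   U T, where U is unipotent over F and T is a torus. By coprime action x may be
   taken to normalise U and T. It then induces an automorphism of F of order b,
   which therefore generates the Galois group; so x centralises no nontrivial
   element of T, every element of x^i T is conjugate to x^i for i = 1, 2, and
   H = C_G(x) is sharply 2-transitive on the m = 1 + |C_U(x)| fixed points of x.

   Let y be in x^2 G. If y fixes a point, it is conjugate into x (x r) U for any
   r != 1 in T; there the products x (x r)^u, u in U, meet every U-class, by
   linear algebra on the abelian sections of U. The fixed-point-free y form a
   single class (y is conjugate to x^2 c with c in H fixed-point-free), so it
   is enough that some x x' with x' conjugate to x has no fixed point. Otherwise
   each x x' has 1 or m fixed points, and double counting gives
   m |E| = (|U| + 1) |T| for the set E of those x' for which x x' is conjugate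
   to x^2. But p divides |E|, by counting fixed points of C_Z(x) on E. *)

Require Import Defs.
From mathcomp Require Import all_boot all_order all_algebra all_fingroup.
From mathcomp Require Import all_solvable all_field.
From mathcomp Require Import zify ring.

Set Implicit Arguments.
Unset Strict Implicit.
Unset Printing Implicit Defensive.

Import GRing.Theory.
Local Open Scope group_scope.

(** * Coprime action *)

(** [b] is odd because [#|G|] is even, so [x] and [x ^+ 2] generate the same group and share
    centraliser and fixed points. The torus acts on each section of [U] by all nonzero squares of
    [F]. Every element of [F] is a difference of squares, so an element normalising the torus and
    the section acts there as a scalar times the field automorphism that it induces on the torus.
    The centraliser of [x] in [T] then embeds in the nonzero elements of a field with at most [p]
    elements; for [p <= 3] and odd [#|T|] it is trivial. The twist by [r] is forced: on a section
    [V] the commutator images of [x] and [x ^+ 2] coincide and are proper, so products of two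
    conjugates of [x] lying over [x] itself miss part of the coset, whereas [x^-1 * (x * r)] acts
    freely. A fixed-point-free [y] lies in no conjugate of [x ^+ 2 *: (U * T)], so this method does
    not reach it, and existence is obtained only by counting. *)

Lemma coprime_coset_conj (gT : finGroupType) (M : {group gT}) (x y : gT) :
    x \in 'N(M) -> coprime #|M| #[x] -> y \in x *: M -> #[y] = #[x] ->
  exists2 u, u \in M & y = x ^ u.
Proof.
move=> nMx coMx /lcosetP[k Mk ->{y}] oy.
have nMk : k \in 'N(M) by rewrite (subsetP (normG M)).
(* Both cycles are complements of [M] in the same product, hence conjugate under [M]. That [x ^ u]
   is the generator [x * k] itself is then read off modulo [M]. *)
have [||||| u Mu /= def] := @SchurZassenhaus_trans_actsol _ M <[x]>%G <[x *
  k]>%G.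
- by rewrite abelian_sol ?cycle_abelian.
- by rewrite cycle_subG.
- by rewrite cycle_subG groupM ?mem_gen ?inE ?cycle_id ?Mk ?orbT.
- exact: coMx.
- by rewrite -[#|_|]/(#[_]) -oy.
exists u => //.
have: x ^ u \in <[x * k]> by rewrite /= def memJ_conjg cycle_id.
case/cycleP=> i defi.
have nMu : u \in 'N(M) by rewrite (subsetP (normG M)).
have : coset M (x ^ u) = coset M ((x * k) ^+ i) by rewrite defi.
rewrite morphJ //= (coset_id Mu) conjg1 morphX ?groupM //= morphM //= (coset_id
  Mk) mulg1.
rewrite -morphX // => /eqP; rewrite -(inj_eq (mulgI (coset M x)^-1)) mulVg
  -morphV // -morphM ?groupX ?groupV //.
move=> /eqP/esym; move/coset_idr; rewrite groupM ?groupX ?groupV // => /(_ isT)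
  Mi.
have : x^-1 * x ^+ i \in M :&: <[x]> by rewrite inE Mi groupM ?groupV
  ?mem_cycle ?cycle_id.
rewrite coprime_TIg // => /set1gP /eqP; rewrite -eq_mulVg1 => /eqP xi.
rewrite defi; have : x ^+ 1 == x ^+ i by rewrite expg1 -xi.
by rewrite eq_expg_mod_order -oy -eq_expg_mod_order expg1 => /eqP.
Qed.

(** The class of [z] under [M] lies in the coset and has as many elements. *)
Lemma coset_conj_of_cent1 (gT : finGroupType) (M : {group gT}) (z y : gT) :
  z \in 'N(M) -> 'C_M[z] = 1 -> y \in z *: M -> exists2 t, t \in M & y = z ^ t.
Proof.
move=> nMz cMz yzM.
suff def : z ^: M = z *: M by apply/imsetP; rewrite -[imset _ _]/(z ^: M) def.
apply/eqP; rewrite eqEcard card_lcoset -index_cent1 cMz indexg1 leqnn andbT.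
apply/subsetP=> _ /imsetP[t Mt ->].
by rewrite mem_lcoset -[_ * _]/[~ z, t] commgEr groupM // memJ_norm ?groupV.
Qed.

Lemma cent1_sqr (gT : finGroupType) (x : gT) : odd #[x] -> 'C[x ^+ 2] = 'C[x].
Proof.
move=> ox; rewrite -!cent_cycle.
suff /eqP<- : generator <[x]> (x ^+ 2) by [].
by rewrite generator_coprime coprimen2.
Qed.

Lemma cent1_conjE (gT : finGroupType) (g z : gT) : (z \in 'C[g]) = (z ^ g == z).
Proof.
by apply/cent1P/eqP=> h; [rewrite conjgE h mulKg | rewrite /commute conjgC h].
Qed.

Lemma cent_conj (gT : finGroupType) (A : {set gT}) (g a : gT) :
  g \in 'C(A) -> a \in A -> a ^ g = a.
Proof. by move=> cg Aa; rewrite conjgE -(centP cg _ Aa) mulKg. Qed.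

Section AbelianStep.

Variables (gT : finGroupType) (p : nat) (V : {group gT}).
Hypotheses (p_pr : prime p) (cVV : abelian V).

Lemma commgr_morphM (g : gT) : g \in 'N(V) ->
  {in V &, {morph (fun v => [~ g, v]) : u v / u * v}}.
Proof.
move=> nVg u v Vu Vv /=; rewrite commgMJ.
have Vc : [~ g, u] \in V by rewrite -groupV invg_comm commgEl groupM ?groupV
  ?memJ_norm.
by rewrite (conjgE _ v) (centsP cVV _ Vc _ Vv) mulKg (centsP cVV _ _ _ Vc) //
  -groupV invg_comm commgEl groupM ?groupV ?memJ_norm.
Qed.

Lemma commgr_in (g v : gT) : g \in 'N(V) -> v \in V -> [~ g, v] \in V.
Proof. by move=> nVg Vv; rewrite -groupV invg_comm commgEl groupM ?groupV
  ?memJ_norm. Qed.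

Lemma commgr_image (g : gT) : g \in 'N(V) ->
  exists2 D : {group gT}, D :=: [set [~ g, v] | v in V] & (#|D| * #|'C_V[g]| =
    #|V|)%N.
Proof.
move=> nVg; pose f := Morphism (commgr_morphM nVg).
have fV : f @* V = [set [~ g, v] | v in V] by rewrite morphimEdom.
exists (f @* V)%G => //=; rewrite card_morphim setIid.
suff -> : 'C_V[g] = 'ker f.
  by rewrite mulnC Lagrange // subsetIl.
apply/setP=> v; rewrite in_setI; have -> : (v \in 'ker f) = (v \in V) && ([~ g,
  v] == 1) by rewrite !inE.
by congr (_ && _); apply/cent1P/commgP=> /esym.
Qed.

(* The subgroups [~ x * w, V] and [~ w, V] have index at most p in V; were they
   equal and proper, x and hence x^-1 * w would act trivially on the quotient,
   although x^-1 * w acts without fixed points. So their product is V. *)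
Lemma abelian_coset_step (x w : gT) :
    x \in 'N(V) -> w \in 'N(V) -> #|'C_V[w]| %| p -> #|'C_V[x * w]| %| p ->
    'C_V[x^-1 * w] = 1 ->
  forall y, y \in (x * w) *: V ->
    exists2 v, v \in V & exists2 u, u \in V & y ^ v = x * w ^ u.
Proof.
move=> nVx nVw cw cz cr y /lcosetP[a Va ->{y}].
have nVz : x * w \in 'N(V) by rewrite groupM.
have nVr : x^-1 * w \in 'N(V) by rewrite groupM ?groupV.
have [Dw defDw oDw] := commgr_image nVw.
have [Dz defDz oDz] := commgr_image nVz.
have [Dr defDr oDr] := commgr_image nVr.
have sDV g (D : {group gT}) : g \in 'N(V) -> D :=: [set [~ g, v] | v in V] -> D
  \subset V.
  by move=> nVg ->; apply/subsetP=> _ /imsetP[v Vv ->]; rewrite commgr_in.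
have sDwV := sDV _ _ nVw defDw; have sDzV := sDV _ _ nVz defDz.
have defV : Dz * Dw = V.
  have cardD D m : (#|gval D| * m = #|V|)%N -> m %| p -> D \subset V -> D :=: V
    \/ #|V : D| = p.
    move=> oD mp sDV'; have{mp} mp : (m == 1%N) || (m == p) by case/primeP:
      p_pr => _; apply.
    have iD : #|V : D| = m by apply/eqP; rewrite -(eqn_pmul2l (cardG_gt0 D))
      Lagrange // oD.
    case/orP: mp => /eqP m1; [left | by right; rewrite iD].
    by apply/eqP; rewrite eqEcard sDV' -oD m1 muln1 /=.
  have cDD (D D' : {group gT}) : D \subset V -> D' \subset V -> D * D' = D <*>
    D'.
    move=> sD sD'; rewrite norm_joinEr // cents_norm // (subset_trans sD') //.
    by rewrite (subset_trans cVV) ?centS.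
  rewrite cDD //; apply/eqP; rewrite eqEsubset join_subG sDzV sDwV /=.
  have [->|iw] := cardD _ _ oDw cw sDwV; first by rewrite joing_subr.
  have [->|iz] := cardD _ _ oDz cz sDzV; first by rewrite joing_subl.
  have /maxgroupP[_ maxDz] : maximal Dz V by apply: p_index_maximal;
    rewrite ?iz.
  apply: contraT => ltV.
  have eqD : Dz <*> Dw = Dz.
    apply: maxDz; rewrite ?joing_subl //.
    by rewrite properE join_subG sDzV sDwV /=.
  have sDw : Dw \subset Dz by rewrite -eqD joing_subr.
  have eqDw : Dw :=: Dz.
    apply/eqP; rewrite eqEcard sDw /=.
    by rewrite -(leq_pmul2r (prime_gt0 p_pr)) -{1}iz -{1}iw !Lagrange.
  have nDw g (D : {group gT}) : g \in 'N(V) -> D :=: [set [~ g, v] | v in V] ->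
    g \in 'N(D).
    move=> nVg defD; rewrite inE; apply/subsetP=> _ /imsetP[k Dk ->].
    move: Dk; rewrite defD => /imsetP[v Vv ->].
    by rewrite conjRg (conjgE g g) mulKg; apply/imsetP; exists (v ^ g);
      rewrite ?memJ_norm.
  have nDwz : w \in 'N(Dz) by rewrite -eqDw (nDw w).
  have nDzz : x * w \in 'N(Dz) by rewrite (nDw (x * w)).
  have nDx : x \in 'N(Dz) by rewrite -(mulgK w x) groupM ?groupV.
  have inw v : v \in V -> [~ w, v] \in Dz by move=> Vv;
    rewrite -eqDw defDw imset_f.
  have inx v : v \in V -> [~ x, v] \in Dz.
    move=> Vv; have: [~ x * w, v] \in Dz by rewrite defDz imset_f.
    by rewrite commMgJ groupMr ?inw // memJ_norm.
  have inr v : v \in V -> [~ x^-1 * w, v] \in Dz.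
    move=> Vv; rewrite commMgJ groupMr ?inw // memJ_norm //.
    have -> : [~ x^-1, v] = ([~ x, v]^-1) ^ x^-1.
      by rewrite invgR /commg /conjg !invgK !mulgA mulgK.
    by rewrite memJ_norm ?groupV // inx.
  move: oDr; rewrite cr cards1 muln1 => oDr.
  have : V \subset Dz.
    suff <- : Dr :=: V by rewrite defDr; apply/subsetP=> _ /imsetP[v Vv ->];
      exact: inr.
    by apply/eqP; rewrite eqEcard (sDV _ _ nVr defDr) oDr leqnn.
  by move=> sVD; rewrite (subset_trans sVD) ?joing_subl in ltV.
have : a \in Dz * Dw by rewrite defV.
case/mulsgP=> dz dw; rewrite defDw defDz => /imsetP[v Vv ->] /imsetP[u Vu ->]
  def_a.
(* Conjugation by [v^-1] multiplies by [[~ x * w, v^-1]], which cancels the first factor of [a]; the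
   second turns [w] into [w ^ u]. *)
exists v^-1; rewrite ?groupV //; exists u => //.
have e1 (g k : gT) : g ^ k = g * [~ g, k] by rewrite /commg mulKVg.
have cmC : {in V &, forall i j, i * j = j * i} by move=> i j Vi Vj;
  apply: (centsP cVV).
have -> : (x * w * a) ^ v^-1 = x * w * [~ x * w, v^-1] * a.
  by rewrite conjMg e1; congr (_ * _); rewrite conjgE invgK mulgA (cmC v a) //
    mulgK.
rewrite def_a.
have c1 : [~ x * w, v^-1] * [~ x * w, v] = 1.
  by rewrite -commgr_morphM ?groupV // mulVg commg1.
rewrite -(mulgA (x * w)) (mulgA [~ x * w, v^-1]) c1 mul1g -mulgA.
by rewrite e1.
Qed.

End AbelianStep.

(** * Split doubly transitive groups *)

Section Zassenhaus.

Variables (gT : finGroupType) (p : nat) (G U T Z : {group gT}) (w x : gT).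
Hypotheses (p_pr : prime p) (sUG : U \subset G) (sTG : T \subset G) (Gw : w \in
  G).
Hypotheses (pU : p.-group U) (p'T : coprime p #|T|) (nUT : T \subset 'N(U)).
Hypotheses (sZU : Z \subset U) (cZU : U \subset 'C(Z)) (nZT : T \subset 'N(Z)).
Hypotheses (nTw : w \in 'N(T)) (bruhat : G \subset (U * T) :|: (U * T) :* w *
  U).
Hypotheses (UBw1 : U :&: (U * T) :^ w = 1).
Hypotheses (semireg : {in T, forall t, t != 1 -> 'C_U[t] = 1}) (abUZ : abelian
  (U / Z)).
Hypotheses (ntU : U :!=: 1) (ntT : T :!=: 1).

Let sBG : U * T \subset G. Proof. by rewrite mul_subG. Qed.
Let sBN : U * T \subset 'N(U). Proof. by rewrite mul_subG ?normG. Qed.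
Let sUB : U \subset U * T. Proof. by rewrite mulG_subl. Qed.
Let sTB : T \subset U * T. Proof. by rewrite mulG_subr. Qed.
Let UT1 : U :&: T = 1.
Proof. by rewrite coprime_TIg // (pnat_coprime pU) // p'natE // -prime_coprime.
  Qed.

Lemma bruhatP g : g \in G ->
  g \in U * T \/ exists b u, [/\ b \in U * T, u \in U & g = b * w * u].
Proof.
move/(subsetP bruhat)/setUP=> [->|]; first by left.
case/mulsgP=> g1 u /rcosetP[b Bb ->] Uu ->; right; by exists b, u.
Qed.

Lemma not_norm_w : w \notin 'N(U).
Proof.
apply: contra ntU => nUw; rewrite -subG1 -UBw1 subsetI subxx /=.
by rewrite -{1}(normP nUw) conjSg.
Qed.

Lemma norm_U : 'N_G(U) = U * T.
Proof.
apply/eqP; rewrite eqEsubset subsetI sBG sBN !andbT.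
apply/subsetP=> g /setIP[Gg nUg]; case/bruhatP: (Gg) => // -[b [u [Bb Uu
  defg]]].
case/negP: not_norm_w; move: nUg; rewrite defg => nUg.
have nUb := subsetP sBN _ Bb; have nUu := subsetP (normG U) _ Uu.
by move: nUg; rewrite groupMr // groupMl.
Qed.

Lemma B_group_set : group_set (U * T).
Proof. by rewrite -norm_U groupP. Qed.
Let B := Group B_group_set.

(* The points are the conjugates of U, on which G acts 2-transitively. *)
Let o : {set gT} := U.
Let o' : {set gT} := U :^ w.
Let S : {set {set gT}} := U :^: G.

Lemma mem_o : o \in S. Proof. by apply/imsetP; exists 1; rewrite ?conjsg1. Qed.

Lemma points_cover a : a \in S -> a != o -> exists2 u, u \in U & a = o' :^ u.
Proof.
case/imsetP=> g Gg ->; case/bruhatP: Gg => [Bg | [b [u [Bb Uu ->]]]].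
  by rewrite (normP (subsetP sBN _ Bg)) eqxx.
by exists u; rewrite // !conjsgM (normP (subsetP sBN _ Bb)).
Qed.

(** The stabiliser of [o'] is [(U * T) :^ w], so [UBw1] says that [U] acts freely on the points
    other than [o]. *)
Lemma norm_o'_U u : u \in U -> o' :^ u = o' -> u = 1.
Proof.
move=> Uu eu; apply/set1gP; rewrite -UBw1 inE Uu /=.
have Gu := subsetP sUG u Uu.
rewrite mem_conjg -norm_U inE groupJ ?groupV //=.
apply/normP; rewrite conjgE invgK !conjsgM -[U :^ w]/o' eu.
by rewrite /o' conjsgK.
Qed.

Lemma o'_inj : {in U &, injective (fun u => o' :^ u)}.
Proof.
move=> u v Uu Uv /= e; apply/eqP; rewrite eq_mulgV1; apply/eqP.
by apply: norm_o'_U; rewrite ?groupM ?groupV // conjsgM e conjsgK.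
Qed.

Lemma o'u_neq u : u \in U -> o' :^ u != o.
Proof.
move=> Uu; apply: contra not_norm_w => /eqP e; apply/normP.
by apply: (can_inj (conjsgK u)); rewrite -[U :^ w]/o' e conjGid.
Qed.

Lemma o'_in u : u \in U -> o' :^ u \in S.
Proof.
move=> Uu; apply/imsetP; exists (w * u); rewrite ?conjsgM //.
by rewrite groupM // (subsetP sUG).
Qed.

Lemma pointsE : S = o |: [set o' :^ u | u in U].
Proof.
apply/setP=> a; apply/idP/setU1P=> [Sa | [->|/imsetP[u Uu ->]]].
- have [->|na] := eqVneq a o; first by left.
  by have [u Uu ->] := points_cover Sa na; right; apply: imset_f.
- exact: mem_o.
- exact: o'_in.
Qed.

Lemma card_points : #|S| = #|U|.+1.
Proof.
rewrite pointsE cardsU1 card_in_imset; last exact: o'_inj.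
case: imsetP => // -[u Uu e]; by have := o'u_neq Uu; rewrite e eqxx.
Qed.

Lemma nTo' t : t \in T -> o' :^ t = o'.
Proof.
move=> Tt; apply/normP; rewrite normJ mem_conjg (subsetP nUT) //.
by rewrite memJ_norm ?groupV.
Qed.

Lemma norm_oo' : 'N_G(o) :&: 'N(o') = T.
Proof.
rewrite norm_U; apply/eqP; rewrite eqEsubset subsetI sTB /=; apply/andP; split;
  last first.
  by apply/subsetP=> t /nTo' e; apply/normP.
apply/subsetP=> _ /setIP[/mulsgP[u t Uu Tt ->] /normP].
rewrite conjsgM => e; suff ->: u = 1 by rewrite mul1g.
apply: norm_o'_U => //; apply: (can_inj (conjsgK t)).
by rewrite e nTo'.
Qed.

Lemma two_trans a b : a \in S -> b \in S -> a != b ->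
  exists2 g, g \in G & a = o :^ g /\ b = o' :^ g.
Proof.
case/imsetP=> g Gg -> Sb nab.
have Sbg : b :^ g^-1 \in S.
  by case/imsetP: Sb => h Gh ->; rewrite -conjsgM imset_f ?groupM ?groupV.
have [|u Uu e] := points_cover Sbg.
  by apply: contra nab => /eqP e; rewrite -(conjsgKV g b) e.
exists (u * g); first by rewrite groupM // (subsetP sUG).
split; first by rewrite conjsgM [o :^ u]conjGid.
by rewrite conjsgM -e -conjsgM mulVg conjsg1.
Qed.

(** Geometric form of [semireg]: a nontrivial element of [T] fixes only [o] and [o'], since it acts
    on the points [o' :^ u] as it does on [U] by conjugation. *)
Lemma fix_T t u : t \in T -> u \in U -> t != 1 -> (o' :^ u) :^ t = o' :^ u -> u
  = 1.
Proof.
move=> Tt Uu nt e; apply/set1gP; rewrite -(semireg Tt nt) inE Uu /=.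
have nUt : t \in 'N(U) := subsetP nUT t Tt.
have: o' :^ (u ^ t) = o' :^ u.
  by rewrite -e conjgE !conjsgM nTo' // groupV.
move/o'_inj; rewrite memJ_norm // => /(_ Uu Uu) /= eu.
apply/cent1P; rewrite /commute; by rewrite conjgC eu.
Qed.

Lemma points_memJ a g : g \in G -> (a :^ g \in S) = (a \in S).
Proof.
move=> Gg; apply/idP/idP=> /imsetP[h Gh e].
  by apply/imsetP; exists (h * g^-1); rewrite ?groupM ?groupV // conjsgM -e
    conjsgK.
by rewrite e -conjsgM imset_f ?groupM.
Qed.

Section Normalise.

Variable y : gT.
Hypotheses (nGy : y \in 'N(G)) (nUy : y \in 'N(U)) (nTy : y \in 'N(T)).

Lemma points_norm a : a \in S -> a :^ y \in S.
Proof.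
case/imsetP=> g Gg ->; apply/imsetP; exists (g ^ y); first by rewrite memJ_norm.
by rewrite -[in RHS](normP nUy) -!conjsgM -conjgC.
Qed.

(** [y] fixes [o] and permutes the fixed points of [T], of which [o'] is the only other one. *)
Lemma norm_o' : o' :^ y = o'.
Proof.
have So : o' \in S by rewrite -[o']conjsg1 o'_in.
have [|u Uu e] := points_cover (points_norm So).
  apply: contra (o'u_neq (group1 U)) => /eqP e; rewrite conjsg1.
  by rewrite -(conjsgK y o') e (normP _) ?groupV.
have [t Tt nt] := trivgPn _ ntT.
rewrite e (fix_T Tt Uu nt) ?conjsg1 // -e.
have Tt' : t ^ y^-1 \in T by rewrite memJ_norm ?groupV.
by rewrite -{2}(nTo' Tt') -!conjsgM -conjgCV.
Qed.

End Normalise.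

Lemma faithful_points g : g \in G -> {in S, forall a, g \in 'N(a)} -> g = 1.
Proof.
move=> Gg ng; have Tg : g \in T.
  rewrite -norm_oo' !in_setI Gg (ng _ mem_o) ng //.
  by rewrite -[o']conjsg1 o'_in.
have [u Uu nu] := trivgPn _ ntU.
apply/eqP; apply: contraNT nu => nt; apply/eqP/(fix_T Tg Uu nt).
by apply/normP; rewrite ng ?o'_in.
Qed.

Lemma center_triv : 'Z(G) = 1.
Proof.
apply/trivgP/subsetP=> g /setIP[Gg cg]; rewrite (faithful_points Gg) ?group1 //.
move=> _ /imsetP[h Gh ->]; have <- : g ^ h = g by rewrite conjgE (centP cg _
  Gh) mulKg.
by rewrite /= normJ memJ_conjg (subsetP (cent_sub U)) // (subsetP (centS sUG)).
Qed.

(** Such a [y] fixes every point; so does [[~ y, g]] for [g] in [G], and this commutator lies in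
    [G], which acts faithfully. *)
Lemma cent_UT_G y : y \in 'N(G) -> y \in 'C(U) -> y \in 'C(T) -> y \in 'C(G).
Proof.
move=> nGy cUy cTy.
have nUy := subsetP (cent_sub U) _ cUy; have nTy := subsetP (cent_sub T) _ cTy.
have ny a : a \in S -> y \in 'N(a).
  rewrite pointsE => /setU1P[->//|/imsetP[u Uu ->]].
  have <- : y ^ u = y by rewrite conjgE (centP cUy _ Uu) mulKg.
  by rewrite normJ memJ_conjg; apply/normP/norm_o'.
apply/centP=> g Gg; apply/commgP/eqP/faithful_points.
  by rewrite commgEr groupM // memJ_norm ?groupV.
move=> a Sa; have ya : y ^ g \in 'N((a :^ g^-1) :^ g).
  by rewrite normJ memJ_conjg ny // points_memJ ?groupV.
by rewrite conjsgKV in ya; rewrite commgEl groupM ?groupV ?ny.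
Qed.

(** * Fixed points of [x] and the action of its centraliser on them *)

Hypotheses (nGx : x \in 'N(G)) (nUx : x \in 'N(U)) (nTx : x \in 'N(T)) (nZx : x
  \in 'N(Z)).
Hypotheses (ox : odd #[x]) (coGx : coprime #|G| #[x]) (cTx : 'C_T[x] = 1).
Hypotheses (cZx : #|'C_Z[x]| = p) (ltZ : p < #|Z|) (cUx : #|'C_U[x]| %| p * p).

Lemma points_normx a : a \in S -> a :^ x \in S. Proof. exact: points_norm. Qed.
Lemma nxo' : o' :^ x = o'. Proof. exact: norm_o'. Qed.

Lemma fix_x_o'u u : u \in U -> ((o' :^ u) :^ x == o' :^ u) = (u \in 'C[x]).
Proof.
move=> Uu; have -> : (o' :^ u) :^ x = o' :^ (u ^ x).
  by rewrite -{2}nxo' -!conjsgM -conjgC.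
have Uux : u ^ x \in U by rewrite memJ_norm.
rewrite (inj_in_eq o'_inj) ?memJ_norm //; apply/eqP/cent1P=> h.
  by rewrite /commute conjgC h.
by rewrite conjgE h mulKg.
Qed.

Let k := #|'C_U[x]|.
Let H := 'C_G[x]%G.
Definition fixed_pts y := [set a in S | y \in 'N(a)].

Lemma in_fixed_pts a y : (a \in fixed_pts y) = (a \in S) && (y \in 'N(a)).
Proof. by rewrite inE. Qed.

Lemma fixed_pts_x : fixed_pts x = o |: [set o' :^ u | u in 'C_U[x]].
Proof.
apply/setP=> a; rewrite in_fixed_pts pointsE; apply/andP/setU1P.
  case=> /setU1P[->|/imsetP[u Uu ->]]; first by left.
  move/normP/eqP; rewrite fix_x_o'u // => cu.
  by right; apply: imset_f; rewrite inE Uu.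
case=> [->|/imsetP[u /setIP[Uu cu] ->]]; first by rewrite setU11.
by split; [rewrite setU1r ?imset_f | apply/normP/eqP; rewrite fix_x_o'u].
Qed.

Lemma card_fixed_pts_x : #|fixed_pts x| = k.+1.
Proof.
rewrite fixed_pts_x cardsU1 card_in_imset;
  last by apply: sub_in2 o'_inj => u /setIP[].
case: imsetP => // -[u /setIP[Uu _] e]; by have := o'u_neq Uu; rewrite e eqxx.
Qed.

Lemma mem_fixed_ptsJ y g a : g \in G -> (a :^ g \in fixed_pts (y ^ g)) = (a \in
  fixed_pts y).
Proof. by move=> Gg; rewrite !in_fixed_pts points_memJ // normJ memJ_conjg. Qed.

Lemma card_fixed_ptsJ y g : g \in G -> #|fixed_pts (y ^ g)| = #|fixed_pts y|.
Proof.
move=> Gg; rewrite -(card_imset (mem (fixed_pts y)) (can_inj (conjsgK g))).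
apply: eq_card => a; apply/idP/imsetP.
  by exists (a :^ g^-1); rewrite ?conjsgKV // -(mem_fixed_ptsJ _ _ Gg) conjsgKV.
by case=> b Fb ->; rewrite mem_fixed_ptsJ.
Qed.

Lemma fixed_pts_sqr : fixed_pts (x ^+ 2) = fixed_pts x.
Proof.
apply/setP=> a; rewrite !in_fixed_pts; case: (a \in S) => //=.
rewrite -!cycle_subG.
suff /eqP-> : generator <[x]> (x ^+ 2) by [].
by rewrite generator_coprime coprimen2.
Qed.

Lemma coset_J z y g : z \in 'N(G) -> g \in G -> y \in z *: G -> y ^ g \in z *:
  G.
Proof.
move=> nGz Gg /lcosetP[h Gh ->]; rewrite mem_lcoset conjMg mulgA groupM ?groupJ
  //.
by rewrite -[_ * _]/[~ z, g] commgEr groupM // memJ_norm ?groupV.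
Qed.

(** Two-transitivity moves the fixed points to [o] and [o'], which puts the conjugate of [y] into
    [z *: T], a single class under [T]. *)
Lemma conj_of_two_fixed z y a b : z \in 'N(G) -> z \in 'N(T) -> z \in 'N(o) ->
  z \in 'N(o') ->
  'C_T[z] = 1 -> y \in z *: G -> a != b -> a \in fixed_pts y -> b \in fixed_pts
    y ->
  exists2 g, g \in G & [/\ y = z ^ g, a = o :^ g & b = o' :^ g].
Proof.
move=> nGz nTz nzo nzo' cz Gy nab.
rewrite !in_fixed_pts => /andP[Sa ea] /andP[Sb eb].
have [g Gg [defa defb]] := two_trans Sa Sb nab.
have Gg' : g^-1 \in G by rewrite groupV.
have Ty : y ^ g^-1 \in z *: T.
  rewrite mem_lcoset -norm_oo' 2!in_setI -mem_lcoset coset_J //=.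
  have ya : y ^ g^-1 \in 'N(o) by rewrite -mem_conjg -normJ -defa.
  have yb : y ^ g^-1 \in 'N(o') by rewrite -mem_conjg -normJ -defb.
  by apply/andP; split; apply: groupM => //; rewrite groupV.
have [t Tt e] := coset_conj_of_cent1 nTz cz Ty.
exists (t * g); first by rewrite groupM // (subsetP sTG).
split.
- by rewrite conjgM -e conjgKV.
- by rewrite conjsgM (normP (subsetP nUT t Tt)).
- by rewrite conjsgM nTo'.
Qed.

Lemma nxo'N : x \in 'N(o'). Proof. by apply/normP; apply: nxo'. Qed.

(** If [x] fixes [o :^ g], then [x ^ g^-1] lies in [x *: B], so it equals [x ^ c] with [c] in [B].
    Then [c * g] centralises [x] and still sends [o] to [o :^ g]. *)
Lemma trans_H a : a \in fixed_pts x -> exists2 h, h \in H & a = o :^ h.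
Proof.
rewrite in_fixed_pts => /andP[/imsetP[g Gg ->]] nx.
have Gg' : g^-1 \in G by rewrite groupV.
have [||||c Bc e] := @coprime_coset_conj _ B x (x ^ g^-1).
- by rewrite -cycle_subG /= normsM ?cycle_subG.
- by rewrite (coprime_dvdl _ coGx) // cardSg.
- rewrite mem_lcoset /= -norm_U in_setI -mem_lcoset coset_J ?lcoset_refl //=.
  by rewrite groupM ?groupV // -mem_conjg -normJ.
- by rewrite orderJ.
exists (c * g).
  rewrite inE groupM // ?(subsetP sBG) //=; apply/cent1P.
  by apply/commute_sym; rewrite /commute conjgC conjgM -e conjgKV.
by rewrite conjsgM (normP (subsetP sBN _ Bc)).
Qed.

(** By uniqueness of the factorisation [u * t], each factor of an element commuting with [x]
    commutes with [x], and ['C_T[x]] is trivial. *)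
Lemma norm_U_H : H :&: 'N(o) = 'C_U[x].
Proof.
rewrite setIAC norm_U; apply/setP=> g; apply/setIP/setIP; case; last first.
  by move=> Ug cg; rewrite (subsetP sUB).
case/mulsgP=> u t Uu Tt -> /cent1P c; split; last by apply/cent1P.
have e : u ^ x * t ^ x = u * t by rewrite -conjMg conjgE c mulKg.
have e2 : u^-1 * u ^ x = t * (t ^ x)^-1.
  by apply: (mulIg (t ^ x)); rewrite -mulgA e mulKg mulgKV.
have : u^-1 * u ^ x \in U :&: T.
  by rewrite inE groupM ?groupV ?memJ_norm //= e2 groupM ?groupV ?memJ_norm.
rewrite UT1 e2 => /set1gP/eqP; rewrite -eq_mulgV1 => /eqP/esym te.
suff -> : t = 1 by rewrite mulg1.
apply/set1gP; rewrite -cTx inE Tt; apply/cent1P.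
by rewrite /commute conjgC te.
Qed.

Lemma card_H : #|H| = (k.+1 * k)%N.
Proof.
have -> : #|H| = (#|H : H :&: 'N(o)| * #|H :&: 'N(o)|)%N.
  by rewrite mulnC Lagrange // subsetIl.
rewrite norm_U_H; congr (_ * _)%N.
rewrite -norm_U_H -card_conjugates -card_fixed_pts_x; apply: eq_card => a.
apply/imsetP/idP=> [[h Hh ->]|/trans_H]; last by [].
case/setIP: Hh => Gh /cent1P c; rewrite -(_ : x ^ h = x) ?mem_fixed_ptsJ //
  ?in_fixed_pts ?mem_o //.
by rewrite conjgE -c mulKg.
Qed.

Lemma card_G : #|G| = (#|U|.+1 * (#|U| * #|T|))%N.
Proof.
rewrite -card_points /S card_conjugates -TI_cardMg // -norm_U mulnC Lagrange //.
exact: subsetIl.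
Qed.

Let K := x ^: G.

Lemma card_K : (#|K| * (k.+1 * k))%N = #|G|.
Proof. by rewrite -index_cent1 -card_H mulnC Lagrange // subsetIl. Qed.

(** Moved to [o] and [o'], the element lies in ['C_T[x]]. With [card_H] this makes [H] sharply
    two-transitive on the fixed points of [x]. *)
Lemma frob_fix1 c a b : c \in H -> a \in fixed_pts x -> b \in fixed_pts x -> a
  != b ->
  c \in 'N(a) -> c \in 'N(b) -> c = 1.
Proof.
case/setIP=> Gc cc Fa Fb nab na nb.
have [g Gg [e ea eb]] := conj_of_two_fixed nGx nTx nUx nxo'N cTx (lcoset_refl _
  _) nab Fa Fb.
have Gg' : g^-1 \in G by rewrite groupV.
apply: (conjg_inj g^-1); rewrite conj1g; apply/set1gP;
  rewrite -cTx inE -norm_oo'.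
have na' : c ^ g^-1 \in 'N(o) by rewrite -mem_conjg -normJ -ea.
have nb' : c ^ g^-1 \in 'N(o') by rewrite -mem_conjg -normJ -eb.
rewrite !in_setI na' nb' groupJ //=.
by rewrite -mem_conjg -normJ conjg_set1 -e.
Qed.

Definition fixfree_cent := [set c in H | [forall a in fixed_pts x, c \notin
  'N(a)]].

Lemma notin_fixfree1 : 1 \notin fixfree_cent.
Proof.
rewrite inE group1 /=; apply/forall_inP=> /(_ o).
by rewrite fixed_pts_x setU11 group1 => /(_ isT).
Qed.

(* The orbit-counting formula for the action of H on the fixed points of x. *)
Lemma card_fixfree_cent : #|fixfree_cent| = k.
Proof.
have cardHa a : a \in fixed_pts x -> #|H :&: 'N(a)| = k.
  case/trans_H=> h Hh ->; rewrite normJ -{1}(conjGid Hh) -conjIg cardJg.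
  by rewrite norm_U_H.
have s1 : (\sum_(c in H) \sum_(a in fixed_pts x | c \in 'N(a)) 1 = k.+1 * k)%N.
  rewrite (exchange_big_dep (mem (fixed_pts x))) => [|c a _ /andP[]//];
    rewrite /=.
  rewrite -card_fixed_pts_x -sum_nat_const; apply: eq_bigr => a Fa.
  rewrite -(cardHa a Fa) -sum1_card; apply: eq_bigl => c.
  by rewrite in_setI Fa.
have v c : c \in H -> (\sum_(a in fixed_pts x | c \in 'N(a)) 1 = k.+1 * (c ==
  1%g) + (c \notin 1%g |: fixfree_cent))%N.
  move=> Hc; rewrite in_setU1; have [->|nc] /= := eqVneq c 1.
    by rewrite muln1 addn0 -card_fixed_pts_x -sum1_card; apply: eq_bigl => a;
      rewrite group1 andbT.
  rewrite muln0 add0n inE Hc /=; case: forall_inP => nF.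
    by rewrite big_pred0 // => a; apply/negP=> /andP[/nF/negP].
  have /existsP[a] : [exists a, (a \in fixed_pts x) && (c \in 'N(a))].
    apply: contraT => /existsPn h; case: nF => a Fa.
    by have := h a; rewrite Fa.
  case/andP=> Fa na; rewrite (bigD1 a) ?Fa //= big_pred0 // => b.
  apply/negP=> /andP[/andP[Fb nb] nab]; case/eqP: nc.
  exact: (frob_fix1 Hc Fb Fa).
move: s1; rewrite (eq_bigr _ v) big_split /= -big_distrr /= (bigD1 1%g) //=
  eqxx.
rewrite big1 ?addn0 ?muln1 => [|c /andP[_ /negbTE->]//].
have -> : (\sum_(c in H) (c \notin 1%g |: fixfree_cent) = #|H| - #|1%g |:
  fixfree_cent|)%N.
  have sQH : 1%g |: fixfree_cent \subset H.
    by apply/subsetP=> c /setU1P[->|/setIdP[]//]; rewrite group1.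
  have -> : (#|H| - #|1%g |: fixfree_cent| = #|H :\: (1%g |: fixfree_cent)|)%N
    by rewrite cardsD (setIidPr sQH).
  rewrite -sum1_card big_mkcond [RHS]big_mkcond /=.
  by apply: eq_bigr => c _; rewrite in_setD; case: (c \in H); case: (_ \in _).
have lQ : #|1%g |: fixfree_cent| <= #|H|.
  by apply/subset_leq_card/subsetP=> c /setU1P[->|/setIdP[]//]; rewrite group1.
move: lQ; rewrite card_H cardsU1 notin_fixfree1 add1n => lQ e.
by have := subnK lQ; rewrite -[in RHS]e addnC => /eqP;
  rewrite eqn_add2r => /eqP[].
Qed.

Lemma fixed_pts_x_cent a c : c \in H -> a \in fixed_pts x -> a :^ c \in
  fixed_pts x.
Proof.
case/setIP=> Gc /cent1P cc Fa; have <- : x ^ c = x by rewrite conjgE -cc mulKg.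
by rewrite mem_fixed_ptsJ.
Qed.

Lemma k_gt0 : 0 < k. Proof. exact: cardG_gt0. Qed.

(** An element of [H] that commutes with [c] and fixes [o] also fixes [o :^ c], a different point,
    so it is trivial. Hence ['C_H[c]] has at most [k.+1] elements and the class of [c] at least [k],
    the size of the whole set. *)
Lemma fixfree_cent_class c : c \in fixfree_cent -> c ^: H = fixfree_cent.
Proof.
move=> Qc; have /setIdP[Hc /forall_inP nc] := Qc.
apply/eqP; rewrite eqEcard; apply/andP; split.
  apply/subsetP=> _ /imsetP[h Hh ->]; rewrite inE groupJ //=.
  apply/forall_inP=> a Fa; rewrite -(conjsgKV h a) normJ memJ_conjg nc //.
  by rewrite fixed_pts_x_cent ?groupV.
rewrite card_fixfree_cent -index_cent1.
have le_c : #|'C_H[c]| <= k.+1.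
  rewrite -card_fixed_pts_x -(card_in_imset (f := fun d => o :^ d)) => [|d e];
    last first.
    move=> /setIP[Hd /cent1P cd] /setIP[He /cent1P ce] /= eo; apply/eqP;
      rewrite eq_mulgV1.
    have Hde : d * e^-1 \in H by rewrite groupM ?groupV.
    have no : d * e^-1 \in 'N(o) by apply/normP; rewrite conjsgM eo conjsgK.
    have Fo : o \in fixed_pts x by rewrite fixed_pts_x setU11.
    apply/eqP/(frob_fix1 Hde Fo (fixed_pts_x_cent Hc Fo)) => //.
      by apply: contraNneq (nc o Fo) => e2; apply/normP.
    have cde : commute (d * e^-1) c.
      by apply/commute_sym/commuteM/commuteV => //.
    have <- : (d * e^-1) ^ c = d * e^-1 by rewrite conjgE cde mulKg.
    by rewrite normJ memJ_conjg.
  by apply/subset_leq_card/subsetP=> _ /imsetP[d /setIP[Hd _] ->];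
    rewrite fixed_pts_x_cent // fixed_pts_x setU11.
rewrite -(leq_pmul2l (ltn0Sn k)) -card_H -(Lagrange (subsetIl H 'C[c]))
  leq_mul2r.
by rewrite le_c orbT.
Qed.

(** * Elements of the coset of [x ^+ 2] without fixed points *)

Lemma cent_sqr : 'C[x ^+ 2] = 'C[x]. Proof. exact: cent1_sqr. Qed.
Lemma order_sqr : #[x ^+ 2] = #[x].
Proof. by rewrite orderXgcd (eqP (_ : coprime _ 2)) ?divn1 // coprimen2. Qed.

Lemma nGx2 : x ^+ 2 \in 'N(G). Proof. exact: groupX. Qed.

(** [G] has no nontrivial element whose order involves only primes of [#[x]], so the order of such
    an element is visible modulo [G]. *)
Lemma order_coset_eq y : y \in 'N(G) -> coset G y = coset G (x ^+ 2) ->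
  \pi(#[x]).-elt y -> #[y] = #[x ^+ 2].
Proof.
move=> nGy ey piy.
have p'G : \pi(#[x])^'.-group G.
  by rewrite /pgroup -coprime_pi' ?order_gt0 // coprime_sym.
have kill z : z \in G -> \pi(#[x]).-elt z -> z = 1.
  move=> Gz piz; apply/eqP; rewrite -order_eq1; apply/eqP.
  by apply: (pnat_1 piz); apply: mem_p_elt p'G Gz.
have half z z' : z \in 'N(G) -> z' \in 'N(G) -> coset G z = coset G z' ->
  \pi(#[x]).-elt z ->
   #[z] %| #[z'].
  move=> nz nz' e piz; rewrite order_dvdn; apply/eqP/kill; last exact: p_eltX.
  by apply: coset_idr; rewrite ?groupX // morphX //= e -morphX //= expg_order
    morph1.
apply/eqP; rewrite eqn_dvd !half ?nGx2 //.
by apply: p_eltX; apply: pnat_pi; rewrite order_gt0.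
Qed.

(* The part of y at the primes dividing #[x] is conjugate to x ^+ 2. *)
Lemma coset_decomp y : y \in x ^+ 2 *: G ->
  exists2 g, g \in G & exists2 c, c \in H & y ^ g = x ^+ 2 * c.
Proof.
move=> Gy; have nGy : y \in 'N(G).
  by case/lcosetP: Gy => h Gh ->; rewrite groupM ?nGx2 // (subsetP (normG G)).
have ey : coset G y = coset G (x ^+ 2).
  case/lcosetP: Gy => h Gh ->; rewrite morphM ?nGx2 ?(subsetP (normG G)) //=.
  by rewrite (coset_id Gh) mulg1.
set pi := \pi(#[x]).
have Gy' : y.`_pi^' \in G.
  apply: coset_idr; rewrite ?groupX // morph_constt //= ey -morph_constt ?nGx2
    //=.
  rewrite (_ : (x ^+ 2).`_pi^' = 1) ?morph1 //.
  apply: constt1P; rewrite p_eltNK; apply: p_eltX; apply: pnat_pi;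
    exact: order_gt0.
have e1 : coset G y.`_pi = coset G (x ^+ 2).
  rewrite -ey -{2}(consttC pi y) morphM ?groupX //=.
  by rewrite (coset_id Gy') mulg1.
have [||||u Gu eu] := @coprime_coset_conj _ G (x ^+ 2) y.`_pi.
- exact: nGx2.
- by rewrite order_sqr.
- rewrite mem_lcoset; apply: coset_idr; rewrite ?groupM ?groupV ?groupX ?nGx2
  //.
  by rewrite morphM ?morphV ?groupV ?groupX ?nGx2 //= e1 mulVg.
- by apply: order_coset_eq; rewrite ?groupX ?p_elt_constt.
exists u^-1; first by rewrite groupV.
exists (y.`_pi^' ^ u^-1); last by rewrite -{1}(consttC pi y) conjMg eu conjgK.
rewrite inE groupJ ?groupV //= -cent_sqr -(conjgK u (x ^+ 2)) -eu.
apply/cent1P; rewrite /commute -!conjMg; congr (_ ^ _).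
exact: commuteX2.
Qed.

Lemma fixfree_conj y z : y \in x ^+ 2 *: G -> z \in x ^+ 2 *: G ->
  fixed_pts y = set0 -> fixed_pts z = set0 -> exists2 g, g \in G & z = y ^ g.
Proof.
(* A point fixed by both [x] and [c] would be fixed by [x ^+ 2 * c], a conjugate of [y1]. *)
have inQ y1 : y1 \in x ^+ 2 *: G -> fixed_pts y1 = set0 -> exists2 g, g \in G &
  exists2 c, c \in fixfree_cent & y1 ^ g = x ^+ 2 * c.
  move=> Gy Fy; have [g Gg [c Hc e]] := coset_decomp Gy.
  exists g => //; exists c => //; rewrite inE Hc; apply/forall_inP=> a Fa.
  apply/negP=> nac; have : a \in fixed_pts (y1 ^ g).
    by move: Fa; rewrite !in_fixed_pts e => /andP[-> nxa];
      rewrite groupM ?groupX.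
  by rewrite -(conjsgKV g a) mem_fixed_ptsJ // Fy inE.
move=> Gy Gz /(inQ _ Gy)[g Gg [c Qc ey]] /(inQ _ Gz)[h Gh [d Qd ez]].
have : d \in c ^: H by rewrite fixfree_cent_class.
case/imsetP=> l /setIP[Gl /cent1P cl] ed.
exists (g * l * h^-1); first by rewrite !groupM ?groupV.
apply: (conjg_inj h); rewrite -!conjgM mulgKV conjgM ey ez ed conjMg.
congr (_ * _); rewrite conjXg; congr (_ ^+ _).
by rewrite conjgE -cl mulKg.
Qed.

(** * Counting the fixed points of the products of two conjugates of [x] *)

Lemma class_sub_coset y : y \in K -> y \in x *: G.
Proof. by case/imsetP=> g Gg ->; rewrite coset_J ?lcoset_refl. Qed.

Lemma mulK_in y : y \in K -> x * y \in x ^+ 2 *: G.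
Proof.
by move/class_sub_coset; rewrite !mem_lcoset expgS expg1 invMg -!mulgA mulKg.
Qed.

Lemma class_memJ y g : g \in G -> (y ^ g \in K) = (y \in K).
Proof. by move=> Gg; rewrite memJ_norm // (subsetP (class_norm _ _)). Qed.

Definition sqr_partners := [set y in K | x * y \in (x ^+ 2) ^: G].

(** With two fixed points, [x * y] is conjugate to [x ^+ 2] by [conj_of_two_fixed], and then it has
    as many fixed points as [x]. *)
Lemma card_fixed_pts_mul y : y \in K -> fixed_pts (x * y) != set0 ->
  #|fixed_pts (x * y)| = (1 + k * (y \in sqr_partners))%N.
Proof.
move=> Ky; case/set0Pn=> a Fa; rewrite inE Ky /=;
  case: imsetP => [[g Gg ->]|nE].
  by rewrite card_fixed_ptsJ // fixed_pts_sqr card_fixed_pts_x muln1.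
rewrite muln0 addn0; apply/eqP/cards1P; exists a; apply/eqP.
rewrite eqEsubset sub1set Fa andbT; apply/subsetP=> b Fb; rewrite inE.
apply: contraT => nab; case: nE.
have [|||||g Gg [-> _ _]] := conj_of_two_fixed _ _ _ _ _ (mulK_in Ky) nab Fb Fa.
- exact: nGx2.
- exact: groupX.
- exact: groupX.
- exact: (groupX 2 nxo'N).
- by rewrite cent_sqr.
by exists g.
Qed.

Let e a b := #|[set y in K | a :^ y == b]|.

Lemma e_J a b g : g \in G -> e (a :^ g) (b :^ g) = e a b.
Proof.
move=> Gg; rewrite /e -(card_imset (mem [set y in K | a :^ y == b]) (conjg_inj
  g)).
apply: eq_card => y; rewrite inE; apply/andP/imsetP.
  case=> Ky /eqP ey; exists (y ^ g^-1); last by rewrite conjgKV.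
  rewrite inE class_memJ ?groupV // Ky; apply/eqP; apply: (can_inj (conjsgK g)).
  by rewrite -ey -!conjsgM conjgE invgK !mulgA mulgKV.
case=> z; rewrite inE => /andP[Kz /eqP ez] ->; rewrite class_memJ //;
  split=> //.
by rewrite -ez -!conjsgM -conjgC.
Qed.

Lemma pointsJ_class a y : a \in S -> y \in K -> a :^ y \in S.
Proof.
move=> Sa /imsetP[g Gg ->]; rewrite conjgE !conjsgM points_memJ // points_normx
  // points_memJ ?groupV //.
Qed.

Lemma sum_e a : a \in S -> (\sum_(b in S) e a b = #|K|)%N.
Proof.
move=> Sa; rewrite -sum1_card (partition_big (fun y => a :^ y) (mem S)) /=;
  last first.
  by move=> y Ky; rewrite pointsJ_class.
by apply: eq_bigr => b _; rewrite /e -sum1_card; apply: eq_bigl => y;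
  rewrite inE.
Qed.

Lemma e_diag a : a \in S -> e a a = e o o.
Proof. by case/imsetP=> g Gg ->; rewrite -(e_J o o Gg). Qed.

Lemma e_offdiag a b : a \in S -> b \in S -> a != b -> e a b = e o o'.
Proof.
by move=> Sa Sb nab; have [g Gg [-> ->]] := two_trans Sa Sb nab; rewrite e_J.
Qed.

Lemma sum_e_mul : (\sum_(y in K) #|fixed_pts (x * y)%g| = \sum_(a in S) e (a :^
  x) a)%N.
Proof.
transitivity (\sum_(y in K) \sum_(a in S | (x * y)%g \in 'N(a)) 1)%N.
  by apply: eq_bigr => y _; rewrite -sum1_card; apply: eq_bigl => a;
    rewrite in_fixed_pts.
rewrite (exchange_big_dep (mem S)) => [|y a _ /andP[]//] /=.
apply: eq_bigr => a Sa; rewrite /e -sum1_card; apply: eq_bigl => y.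
by rewrite inE Sa /= (sameP normP eqP) conjsgM.
Qed.

(** [#|G|] is both [#|K| * (k.+1 * k)] and [#|U|.+1 * (#|U| * #|T|)]; comparison eliminates
    [#|K|]. *)
Lemma count_e : (#|U| * #|sqr_partners| = #|K| * k)%N ->
  (k.+1 * #|sqr_partners| = #|U|.+1 * #|T|)%N.
Proof.
move=> h; have U0 : 0 < #|U| by exact: cardG_gt0.
have := card_K; rewrite card_G => hK.
apply/eqP; rewrite -(eqn_pmul2l U0); apply/eqP.
by rewrite mulnCA h [in RHS]mulnCA -hK mulnCA.
Qed.

(* By 2-transitivity the number e a b of conjugates of x moving a to b only
   depends on whether a = b, which gives the total number of fixed points of
   the products x * y for y in x ^: G; each has either 1 or k.+1 of them. *)
Lemma card_sqr_partners : (forall y, y \in K -> fixed_pts (x * y) != set0) ->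
  (k.+1 * #|sqr_partners| = #|U|.+1 * #|T|)%N.
Proof.
move=> nF; apply: count_e.
have kU : k <= #|U| by rewrite subset_leq_card ?subsetIl.
have e1 : (e o o + #|U| * e o o' = #|K|)%N.
  rewrite -(sum_e mem_o) (bigD1 o mem_o) /=; congr (_ + _)%N.
  rewrite (eq_bigr (fun _ => e o o')) => [|b /andP[Sb nb]]; last first.
    by rewrite e_offdiag ?mem_o // eq_sym.
  rewrite sum_nat_const; congr (_ * _)%N.
  have [<-] : #|[predD1 S & o]|.+1 = #|U|.+1 by rewrite -card_points (cardD1 o
    S) mem_o.
  by apply: eq_card => b; rewrite !inE andbC.
have e2 : (#|U|.+1 * e o o = #|K| * k.+1)%N.
  rewrite -card_points -sum_nat_const -(eq_bigr _ e_diag).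
  transitivity (\sum_(y in K) #|fixed_pts y|)%N; last first.
    rewrite -sum_nat_const; apply: eq_bigr => _ /imsetP[g Gg ->].
    by rewrite card_fixed_ptsJ // card_fixed_pts_x.
  transitivity (\sum_(y in K) \sum_(a in S | y \in 'N(a)) 1)%N; last first.
    by apply: eq_bigr => y _; rewrite -sum1_card; apply: eq_bigl => a;
      rewrite in_fixed_pts.
  rewrite (exchange_big_dep (mem S)) => [|y a _ /andP[]//] /=.
  apply: eq_bigr => a Sa; rewrite /e -sum1_card; apply: eq_bigl => y.
  by rewrite inE Sa /= (sameP normP eqP).
(* [x * y] fixes [a] when [y] sends [a :^ x] back to [a]: fixed points of [x] contribute diagonal
   values of [e], the other points off-diagonal ones. *)
have e3 : (#|K| + k * #|sqr_partners| = k.+1 * e o o + (#|U| - k) * e o o')%N.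
  transitivity (\sum_(y in K) #|fixed_pts (x * y)%g|)%N.
    rewrite (eq_bigr _ (fun y Ky => card_fixed_pts_mul Ky (nF y Ky))) big_split
      /= sum1_card.
    rewrite -big_distrr /=; congr (_ + _ * _)%N.
    rewrite -sum1_card big_mkcond [RHS]big_mkcond /=; apply: eq_bigr => y _.
    by rewrite inE; case: (y \in K); case: (_ \in _).
  rewrite sum_e_mul (bigID (fun a => a \in fixed_pts x)) /=; congr (_ + _)%N.
    rewrite -card_fixed_pts_x -sum_nat_const.
    rewrite [LHS](eq_bigl (fun a => a \in fixed_pts x)) => [|a];
      last by rewrite !in_fixed_pts; case: (a \in S).
    by apply: eq_bigr => a; rewrite in_fixed_pts => /andP[Sa /normP->];
      rewrite e_diag.
  have -> : (#|U| - k = #|S :\: fixed_pts x|)%N.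
    rewrite cardsD (setIidPr _) ?card_points ?card_fixed_pts_x //.
    by apply/subsetP=> a; rewrite in_fixed_pts => /andP[].
  rewrite -sum_nat_const; apply: eq_big => [a|a];
    first by rewrite in_setD andbC.
  case/andP=> Sa; rewrite in_fixed_pts Sa /= => na; apply: e_offdiag => //;
    first exact: points_normx.
  by apply: contra na => /eqP ea; apply/normP.
have k0 := k_gt0.
move: e1 e2 e3 kU k0; rewrite /k.
move: #|'C_U[x]| (e o o) (e o o') #|K| #|sqr_partners| #|U| => k1 a b N E1 u e1
  e2 e3 kU k0.
(* Writing [#|U|] as [k1 + d] removes the truncated subtraction. Multiplying [e3], [e1] and [e2] by
   [k1 + d], [d] and [k1] eliminates both values of [e] and leaves the goal, already multiplied by
   [k1]. *)
have [d du] : exists d, u = k1 + d by exists (u - k1); rewrite subnKC.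
rewrite {}du in e1 e2 e3 kU *; rewrite addKn in e3.
apply/eqP; rewrite -(eqn_pmul2l k0); apply/eqP.
have := congr1 (muln (k1 + d)) e3; have := congr1 (muln d) e1;
  have := congr1 (muln k1) e2.
clear; nia.
Qed.

(** * Divisibility by [p], and a product without fixed points *)

Let cZZ : abelian Z.
Proof. by rewrite /abelian (subset_trans sZU). Qed.

Lemma conjZ (u z : gT) : u \in U -> z \in Z -> z ^ u = z.
Proof. by move=> Uu Zz; rewrite conjgE -(centP (subsetP cZU _ Uu) _ Zz) mulKg.
  Qed.

Lemma centZ_mulU g u : u \in U -> g \in 'N(Z) -> 'C_Z[g * u] = 'C_Z[g].
Proof.
move=> Uu nZg; apply/setP=> z; rewrite !in_setI; case Zz: (z \in Z) => //=.
have zg : z ^ (g * u) = z ^ g by rewrite conjgM (conjZ Uu) // memJ_norm.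
by rewrite !cent1_conjE zg.
Qed.

Lemma fix_U_eq_o s a : s \in U -> s != 1 -> a \in S -> s \in 'N(a) -> a = o.
Proof.
move=> Us ns Sa na; apply/eqP; apply: contraT => nao.
have [u Uu ea] := points_cover Sa nao; case/negP: ns; apply/eqP.
apply: (mulgI u); rewrite mulg1; apply: (o'_inj (groupM Uu Us) Uu).
by rewrite /= conjsgM -ea (normP na).
Qed.

(** A nontrivial [s] in ['C_Z[x]] fixes only [o] and commutes with [y], so [y] fixes [o], and by
    coprimality [y = x ^ (t * u)]. As [u] commutes with [s], so does [x ^ t], and therefore
    [[~ x, t]]. This is an element of [T], hence trivial. *)
Lemma commute_cZ_K y : y \in K -> y \in 'C('C_Z[x]) -> exists2 u, u \in U & y =
  x ^ u.
Proof.
move=> Ky cy.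
have /trivgPn[s Ps ns] : 'C_Z[x] != 1.
  by rewrite -cardG_gt1 cZx prime_gt1.
have cys : s ^ y = s by rewrite conjgE -(centP cy _ Ps) mulKg.
have [Zs cs] := setIP Ps; have Us := subsetP sZU _ Zs.
have nyo : y \in 'N(o).
  apply/normP/(fix_U_eq_o Us ns); first by rewrite pointsJ_class ?mem_o.
  by rewrite normJ -cys memJ_conjg (subsetP (normG U)).
have [||||c] := @coprime_coset_conj _ B x y.
- by rewrite -cycle_subG /= normsM ?cycle_subG.
- by rewrite (coprime_dvdl _ coGx) // cardSg.
- rewrite mem_lcoset /= -norm_U in_setI -mem_lcoset class_sub_coset //=.
  by rewrite groupM ?groupV.
- by case/imsetP: Ky => g _ ->; rewrite orderJ.
rewrite /= -(normC nUT) => /mulsgP[t u Tt Uu ->] ey.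
exists u => //; rewrite ey conjgM; congr (_ ^ _).
have cts : s ^ (x ^ t) = s.
  apply: (conjg_inj u); rewrite conjJg (conjZ Uu Zs).
  by rewrite -conjgM -ey cys.
have cxt : [~ x, t] \in T by rewrite commgEr groupM // memJ_norm ?groupV.
have csx : s ^ x^-1 = s.
  by apply: (conjg_inj x); rewrite conjgKV; apply/esym/eqP;
    rewrite -cent1_conjE.
apply/eqP; rewrite eq_sym eq_mulVg1; apply: contraT => nc.
case/eqP: ns; apply/set1gP; rewrite -(semireg cxt) // inE Us cent1_conjE.
by rewrite commgEl conjgM csx cts eqxx.
Qed.

(* Modulo p only the members commuting with 'C_Z[x] matter; these lie in
   x ^: U, and Z permutes them by conjugation without fixed points. *)
Lemma p_dvd_sqr_partners : p %| #|sqr_partners|.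
Proof.
pose P := 'C_Z[x].
have pP : p.-group P by rewrite (pgroupS _ pU) // (subset_trans (subsetIl _ _)).
have actP : [acts P, on sqr_partners | 'J].
  apply/subsetP=> s /setIP[Zs /cent1P cs]; rewrite !inE; apply/subsetP=> y.
  rewrite !inE => /andP[Ky /imsetP[g Gg e2]];
    have Gs := subsetP sUG _ (subsetP sZU _ Zs).
  rewrite class_memJ // Ky /=; apply/imsetP; exists (g * s);
    first by rewrite groupM.
  rewrite conjgM -e2 conjMg; congr (_ * _).
  by rewrite conjgE -cs mulKg.
have := pgroup_fix_mod pP actP; set E' := 'Fix_(_ | _)(_) => modE.
have E'P y : (y \in E') = (y \in sqr_partners) && (y \in 'C(P)).
  rewrite inE; congr (_ && _); apply/afixP/centP => h s Ps; have := h s Ps.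
    by rewrite /commute conjgC => /= ->.
  by rewrite /= /commute conjgE => ->; rewrite mulKg.
have E'U y : y \in E' -> exists2 u, u \in U & y = x ^ u.
  by rewrite E'P => /andP[/setIdP[Ky _] cPy]; apply: commute_cZ_K.
have cPZ : Z \subset 'C(P) by rewrite (subset_trans cZZ) // centS ?subsetIl.
have nZu u : u \in U -> u \in 'N(Z) by move=> Uu;
  rewrite (subsetP (cent_sub Z)) ?(subsetP cZU).
have xJ u : u \in U -> [~ x, u] \in U by move=> Uu;
  rewrite commgEr groupM // memJ_norm ?groupV.
have xuE u : x ^ u = x * [~ x, u] by rewrite commgEl mulKVg.
have cZy y : y \in E' -> #|'C_Z[y]| = p.
  by case/E'U=> u Uu ->; rewrite xuE centZ_mulU ?xJ.
have actZ : [acts Z, on E' | 'J].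
  apply/subsetP=> z Zz; rewrite !inE; apply/subsetP=> y E'y;
    rewrite inE /= E'P inE.
  have Gz := subsetP sUG _ (subsetP sZU _ Zz).
  have [u Uu ey] := E'U _ E'y; move: (E'y);
    rewrite E'P => /andP[/setIdP[Ky /imsetP[g Gg eg]] cPy].
  rewrite groupJ // ?(subsetP cPZ) // andbT class_memJ // Ky /=.
  have nZy : y \in 'N(Z) by rewrite ey xuE groupM // nZu ?xJ.
  (* If [[~ y, z] = [~ x * y, v]] with [v] in [Z], then [x * y ^ z = (x * y) ^ v] and [y ^ z] is
     again a partner. So it is enough that the commutator images of [x * y] and [y] on [Z] agree.
     There these elements act as [x ^+ 2] and [x], so both images have index [p], and the first lies
     in the second. *)
  have [D1 defD1 oD1] := commgr_image cZZ (groupM nZx nZy).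
  have [D2 defD2 oD2] := commgr_image cZZ nZy.
  have Jy v : v \in Z -> v ^ y = v ^ x.
    by move=> Zv; rewrite ey xuE conjgM (conjZ (xJ _ Uu)) // memJ_norm.
  have sD : D1 \subset D2.
    apply/subsetP=> c; rewrite defD1 => /imsetP[v Zv ->].
    have -> : [~ x * y, v] = [~ y, v ^ y * v].
      have Zvy : v ^ y \in Z by rewrite memJ_norm.
      rewrite commMgJ [RHS](commgr_morphM cZZ nZy Zvy Zv) /=; congr (_ * _).
      have -> : [~ x, v] = [~ y, v] by rewrite !commgEr -Jy ?groupV.
      by rewrite conjRg (conjgE y y) mulKg.
    by rewrite defD2; apply: imset_f; rewrite groupM ?memJ_norm.
  have eD : D1 :=: D2.
    apply/eqP; rewrite eqEcard sD /= -(leq_pmul2r (prime_gt0 p_pr)).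
    rewrite -{1}(cZy y E'y) oD2 -cZx -cent_sqr -oD1.
    rewrite (_ : 'C_Z[x * y] = 'C_Z[x ^+ 2]) //.
    by rewrite ey xuE mulgA centZ_mulU ?xJ // groupM.
  have : [~ y, z] \in D1 by rewrite eD defD2 imset_f.
  rewrite defD1 => /imsetP[v Zv ev].
  have Gv := subsetP sUG _ (subsetP sZU _ Zv).
  apply/imsetP; exists (g * v); first by rewrite groupM.
  by rewrite conjgM -eg -{1}(mulKVg y (y ^ z)) -commgEl ev mulgA commgEl mulKVg.
have pZ : p.-group Z by rewrite (pgroupS _ pU).
have := pgroup_fix_mod pZ actZ.
(* A fixed [y] would be centralised by [Z], but ['C_Z[y]] has order [p]. *)
have -> : 'Fix_(E' | 'J)(Z) = set0.
  apply/setP=> y; rewrite in_set0; apply/negP=> /setIP[E'y /afixP fy].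
  move: ltZ; rewrite -(cZy y E'y) (setIidPl _) ?ltnn //.
  apply/subsetP=> z Zz; apply/cent1P; rewrite /commute [RHS]conjgC.
  by rewrite [y ^ z](fy z Zz).
rewrite cards0 => e0; rewrite /dvdn modE e0 mod0n //.
Qed.

(** Otherwise [p] would divide [#|U|.+1 * #|T|], although it divides [#|U|] and is prime to
    [#|T|]. *)
Lemma exists_fixfree : exists2 y, y \in K & fixed_pts (x * y) = set0.
Proof.
have [/existsP[y /andP[Ky /eqP]]|/existsPn h] := boolP [exists y, (y \in K) &&
  (fixed_pts (x * y) == set0)].
  by exists y.
have : p %| #|U|.+1 * #|T|.
  rewrite -card_sqr_partners ?dvdn_mull ?p_dvd_sqr_partners // => y Ky.
  by have := h y; rewrite Ky.
rewrite Euclid_dvdM // => /orP[|]; last first.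
  by move: p'T; rewrite prime_coprime // => /negbTE->.
have [|_ pdU _] := pgroup_pdiv pU; first by rewrite ntU.
by rewrite -addn1 dvdn_addr // dvdn1 => /eqP p1; move: p_pr; rewrite p1.
Qed.

(** * Elements of the coset of [x ^+ 2] with a fixed point *)

Let pZn : Z <| U.
Proof. by rewrite /normal sZU (subset_trans cZU) ?cent_sub. Qed.

Lemma mul_sqr (g : gT) : x * (x * g) = x ^+ 2 * g.
Proof. by rewrite expgS expg1 mulgA. Qed.

Lemma centU_quo g : g \in 'N(U) -> g \in 'N(Z) -> coprime #|U| #[g] ->
  'C_(U / Z)[coset Z g] = 'C_U[g] / Z.
Proof.
move=> nUg nZg cog; rewrite -!cent_cycle -quotient_cycle //.
rewrite coprime_quotient_cent ?cycle_subG //.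
exact: pgroup_sol pU.
Qed.

(* abelian_coset_step is applied to U / Z and then to Z. *)
Lemma abelian_step_U y r : r \in T -> r != 1 -> y \in (x * (x * r)) *: U ->
  exists2 v, v \in U & exists2 u, u \in U & y ^ v = x * (x * r) ^ u.
Proof.
move=> Tr nr yU; set w1 := x * r; have oU := coprime_dvdl (cardSg sUG) coGx.
have [nUr nZr] := (subsetP nUT r Tr, subsetP nZT r Tr).
have r1 : x^-1 * w1 = r by rewrite mulKg.
have [s Ts es] : exists2 s, s \in T & w1 = x ^ s.
  by apply: coset_conj_of_cent1 => //; rewrite mem_lcoset r1.
have [s2 Ts2 es2] : exists2 s, s \in T & x * w1 = (x ^+ 2) ^ s.
  apply: coset_conj_of_cent1; rewrite ?groupX ?cent_sqr // mem_lcoset.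
  by rewrite /w1 mul_sqr mulKg.
have [nUw1 nZw1] : w1 \in 'N(U) /\ w1 \in 'N(Z) by rewrite !groupM.
have nUz : x * w1 \in 'N(U) by rewrite groupM.
have nZz : x * w1 \in 'N(Z) by rewrite groupM.
have cJ (A : {group gT}) g h : h \in 'N(A) -> 'C_A[g ^ h] = 'C_A[g] :^ h.
  by move=> nAh; rewrite conjIg (normP nAh) -normJ conjg_set1.
have cZw1 : #|'C_Z[w1]| = p by rewrite es cJ ?cardJg // (subsetP nZT).
have cZz : #|'C_Z[x * w1]| = p by rewrite es2 cJ ?cardJg ?cent_sqr // (subsetP
  nZT).
(* By coprimality the centraliser in [U / Z] is the image of ['C_U[g]], so its order is that of
   ['C_U[g]], a divisor of [p * p], divided by [p]. *)
have quo g : g \in 'N(U) -> g \in 'N(Z) -> coprime #|U| #[g] -> #|'C_Z[g]| = p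
  ->
    #|'C_U[g]| = k -> #|'C_(U / Z)[coset Z g]| %| p.
  move=> nUg nZg cog cZg cUg; rewrite centU_quo // -(dvdn_pmul2r (prime_gt0
    p_pr)).
  apply: dvdn_trans cUx; rewrite -/k -cUg card_quotient; last first.
    by rewrite (subset_trans (subsetIl _ _)) ?normal_norm.
  rewrite -(LagrangeI _ Z) mulnC dvdn_mul // -{1}cZg.
  by rewrite setIAC (setIidPr sZU).
have cow1 : coprime #|U| #[w1] by rewrite es orderJ.
have coz : coprime #|U| #[x * w1] by rewrite es2 orderJ order_sqr.
have cor : coprime #|U| #[r].
  by rewrite (pnat_coprime pU) // p'natE // -prime_coprime // (coprime_dvdr _
    p'T) // order_dvdG.
have defz : coset Z (x * w1) = coset Z x * coset Z w1 by rewrite morphM.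
have defr : coset Z r = (coset Z x)^-1 * coset Z w1 by rewrite -r1 morphM
  ?morphV ?groupV.
have nQ g : g \in 'N(U) -> g \in 'N(Z) -> coset Z g \in 'N(U / Z).
  by move=> nUg nZg; rewrite -cycle_subG -quotient_cycle // quotient_norms //
    cycle_subG.
have Uqy : coset Z y \in (coset Z x * coset Z w1) *: (U / Z).
  case/lcosetP: yU => u Uu ->; rewrite mem_lcoset -defz.
  have nZu : u \in 'N(Z) by rewrite (subsetP (normal_norm pZn)).
  have -> : coset Z (x * w1 * u) = coset Z (x * w1) * coset Z u by rewrite
    morphM.
  by rewrite mulKg mem_quotient.
have [||||||vb Vvb [ub Vub]] := @abelian_coset_step _ p (U / Z)%G p_pr abUZ
  (coset Z x) (coset Z w1) _ _ _ _ _ (coset Z y).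
- exact: nQ.
- exact: nQ.
- by apply: quo; rewrite // es cJ ?cardJg // (subsetP nUT).
- by rewrite -defz; apply: quo; rewrite // es2 cJ ?cardJg ?cent_sqr // (subsetP
  nUT).
- by rewrite -defr centU_quo // (semireg Tr nr) quotient1.
- exact: Uqy.
case/morphimP: Vvb => v nZv Uv ->; case/morphimP: Vub => u nZu Uu -> eq.
have nZy : y \in 'N(Z).
  by case/lcosetP: yU => c Uc ->; rewrite groupM // (subsetP (normal_norm pZn)).
have {}eq : coset Z (y ^ v) = coset Z (x * w1 ^ u).
  have -> : coset Z (x * w1 ^ u) = coset Z x * coset Z w1 ^ coset Z u.
    by rewrite -morphJ // -morphM ?groupJ.
  by rewrite morphJ.
have Zy : y ^ v \in (x * w1 ^ u) *: Z.
  have nZa : x * w1 ^ u \in 'N(Z) by rewrite groupM // groupJ.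
  rewrite -norm_rlcoset //; apply/rcoset_kercosetP => //.
  by rewrite groupJ.
have w1u : w1 ^ u = w1 * [~ w1, u] by rewrite commgEl mulKVg.
have Uc : [~ w1, u] \in U by rewrite commgEr groupM // memJ_norm ?groupV.
have [||||||v' Zv' [u' Zu' e']] := @abelian_coset_step _ p Z p_pr cZZ x (w1 ^
  u) _ _ _ _ _ (y ^ v).
- by [].
- by rewrite groupJ.
- by rewrite w1u centZ_mulU // cZw1.
- by rewrite w1u mulgA centZ_mulU // cZz.
(* [U] centralises [Z], so [x^-1 * w1 ^ u] acts on [Z] like [r]. *)
- rewrite w1u mulgA r1 centZ_mulU //; apply/trivgP.
  by rewrite -(semireg Tr nr) setSI.
- exact: Zy.
exists (v * v'); first by rewrite groupM // (subsetP sZU).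
exists (u * u'); first by rewrite groupM // (subsetP sZU).
by rewrite !conjgM.
Qed.

Lemma fixed_case y : y \in x ^+ 2 *: G -> fixed_pts y != set0 ->
  exists2 g, g \in G & exists2 h, h \in G & y = x ^ g * x ^ h.
Proof.
move=> Gy /set0Pn[a]; rewrite in_fixed_pts => /andP[/imsetP[g Gg ->] ny].
have Gg' : g^-1 \in G by rewrite groupV.
have By : y ^ g^-1 \in x ^+ 2 *: B.
  rewrite mem_lcoset /= -norm_U in_setI -mem_lcoset coset_J ?nGx2 //=.
  by rewrite groupM ?groupV ?groupX // -mem_conjg -normJ.
have [r Tr nr] := trivgPn _ ntT.
have [s Ts es] : exists2 s, s \in T & x * r = x ^ s.
  by apply: coset_conj_of_cent1 => //; rewrite mem_lcoset mulKg.
have [s2 Ts2 es2] : exists2 s, s \in T & x * (x * r) = (x ^+ 2) ^ s.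
  apply: coset_conj_of_cent1; rewrite ?groupX ?cent_sqr // mem_lcoset.
  by rewrite mul_sqr mulKg.
case/lcosetP: By => b; rewrite /= -(normC nUT) => /mulsgP[t u Tt Uu ->] ey.
have [s3 Ts3 es3] : exists2 s, s \in T & x ^+ 2 * t = (x ^+ 2) ^ s.
  by apply: coset_conj_of_cent1; rewrite ?groupX ?cent_sqr // mem_lcoset mulKg.
(* [t2] conjugates [x * (x * r)] to [x ^+ 2 * t], both being conjugate to [x ^+ 2] under [T]; its
   inverse brings [y] into the coset of [abelian_step_U]. *)
pose t2 := s2^-1 * s3; have Tt2 : t2 \in T by rewrite groupM ?groupV.
have [|v Uv [u' Uu' e']] := @abelian_step_U (y ^ (g^-1 * t2^-1)) r Tr nr.
  rewrite conjgM ey mulgA conjMg es3 /t2 invMg invgK -conjgM mulKVg -es2.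
  by rewrite mem_lcoset mulKg memJ_norm // (subsetP nUT) // groupM ?groupV.
have Gt2 := subsetP sTG _ Tt2; have Gs := subsetP sTG _ Ts.
have Gv := subsetP sUG _ Uv; have Gu' := subsetP sUG _ Uu'.
pose m := g^-1 * t2^-1 * v; have Gm : m \in G by rewrite !groupM ?groupV.
have {}e' : y ^ m = x * (x * r) ^ u' by rewrite conjgM.
exists m^-1; first by rewrite groupV.
exists (s * u' * m^-1); first by rewrite !groupM ?groupV.
by rewrite !conjgM -conjMg -es -e' conjgK.
Qed.

Theorem coset_sqr y : y \in x ^+ 2 *: G ->
  exists2 g, g \in G & exists2 h, h \in G & y = x ^ g * x ^ h.
Proof.
move=> Gy; have [F0|] := eqVneq (fixed_pts y) set0; last exact: fixed_case.
have [z Kz Fz] := exists_fixfree.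
have [g Gg ->] := fixfree_conj (mulK_in Kz) Gy Fz F0.
case/imsetP: Kz => h Gh ->; exists g => //; exists (h * g); first exact: groupM.
by rewrite conjMg conjgM.
Qed.

End Zassenhaus.

(** * Semilinear maps of finite fields *)

Section SemilinearMaps.

Local Open Scope ring_scope.

Variables (F : finFieldType).

(** The tori only provide multiplications by squares; this extends to all of [F] what additive maps
    do on squares. *)
Lemma diff_of_squares (a : F) : exists k l, a = k ^+ 2 - l ^+ 2.
Proof.
have [two0 | two_neq0] := eqVneq (2%:R : F) 0.
  have chF : 2 \in [pchar F] by rewrite inE /= two0 eqxx.
  have sqr_inj : injective (fun k : F => k ^+ 2).
    move=> k l /= e; apply/eqP; rewrite -subr_eq0.
    have : (k - l) ^+ 2 == 0.
      by rewrite -(pFrobenius_autE chF) rmorphB /= !pFrobenius_autE e subrr.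
    by rewrite expf_eq0.
  have [g _ gK] := injF_bij sqr_inj.
  by exists (g a), 0; rewrite expr0n subr0 [_ ^+ 2]gK.
exists ((a + 1) / 2%:R), ((a - 1) / 2%:R).
by field.
Qed.

Lemma finField_generator :
  exists g : F, g != 0 /\ forall a, a != 0 -> exists i, a = g ^+ i.
Proof.
have /cyclicP[g defU] := field_unit_group_cyclic [group of [set: {unit F}]].
exists (val g); split=> [|a a0].
  by rewrite -unitfE (valP g).
have ua : a \is a GRing.unit by rewrite unitfE.
have : FinRing.unit F ua \in [set: {unit F}] by rewrite inE.
rewrite /= in defU; rewrite defU => /cycleP[i e]; exists i.
by rewrite -FinRing.val_unitX -e.
Qed.

Section FixedField.

Variables (p b : nat) (psi : F -> F).
Hypotheses (p_gt0 : (0 < p)%N) (cardF : #|F| = (p ^ b)%N) (b_gt0 : (0 < b)%N).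
Hypotheses (psiD : {morph psi : a c / a + c}) (psiM : {morph psi : a c / a *
  c}).
Hypotheses (psi1 : psi 1 = 1).
Hypotheses (psi_order : forall j, (0 < j < b)%N -> exists a, iter j psi a != a).

Lemma endo0 : psi 0 = 0.
Proof. by apply: (addrI (psi 0)); rewrite -psiD !addr0. Qed.

Lemma endo_eq0 a : (psi a == 0) = (a == 0).
Proof.
apply/eqP/eqP=> [e|->]; last exact: endo0.
apply/eqP/contraT=> na; have := psi1; rewrite -{1}(mulfV na) psiM e mul0r =>
  /eqP.
by rewrite eq_sym oner_eq0.
Qed.

Lemma endo_inj : injective psi.
Proof.
move=> a c e; apply/eqP; rewrite -subr_eq0 -endo_eq0.
have psiN : psi (- c) = - psi c.
  by apply/eqP; rewrite -subr_eq0 opprK -psiD addNr endo0.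
by rewrite psiD psiN e subrr.
Qed.

Lemma endoX a i : psi (a ^+ i) = psi a ^+ i.
Proof. by elim: i => [|i IHi]; rewrite ?expr0 ?psi1 // !exprS psiM IHi. Qed.

(* If the fixed field K had more than p elements, there would be more than
   |F| polynomials over K of degree less than b, hence a nonzero one vanishing
   at a generator of F, and so at its b conjugates. *)
Lemma card_fixed_field : (#|[set a | psi a == a]| <= p)%N.
Proof.
set K := [set a | _]; rewrite leqNgt; apply/negP=> ltpK.
have [g [g0 gen]] := finField_generator.
have iterX j a i : iter j psi (a ^+ i) = (iter j psi a) ^+ i.
  by elim: j => //= j ->; rewrite endoX.
have iter0 j : iter j psi 0 = 0 by elim: j => //= j ->; rewrite endo0.
have g_fix j : (0 < j < b)%N -> iter j psi g != g.
  case/psi_order=> a na; apply: contra na => /eqP eg.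
  have [->|/gen[i ->]] := eqVneq a 0; first by rewrite iter0.
  by rewrite iterX eg.
have iter_inj j : injective (iter j psi).
  by elim: j => [|j IHj] a c //= /endo_inj/IHj.
have uniq_g : uniq [seq iter i psi g | i <- iota 0 b].
  rewrite map_inj_in_uniq ?iota_uniq // => i j;
    rewrite !mem_iota /= !add0n => ib jb.
  wlog leij : i j ib jb / (i <= j)%N.
    by move=> IH; case: (leqP i j) => [|/ltnW] le e; [|apply/esym]; apply: IH.
  move=> e; apply/eqP; rewrite eqn_leq leij leqNgt; apply/negP=> ltij.
  have : iter (j - i) psi g != g by rewrite g_fix // subn_gt0 ltij; lia.
  case/eqP; apply: (iter_inj i); rewrite -iterD subnKC //.
pose ev (f : {ffun 'I_b -> F}) := \sum_(i < b) f i * g ^+ i.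
have [f [h [Kf Kh nfh efh]]] : exists f h, [/\ f \in ffun_on (mem K), h \in
  ffun_on (mem K), f != h & ev f = ev h].
  have : ~ {in ffun_on (mem K) &, injective ev}.
    move/card_in_image=> e; have := max_card (mem (image ev (ffun_on (mem K)))).
    rewrite e card_ffun_on card_ord cardF leqNgt ltn_exp2r //.
    by rewrite ltpK.
  move=> ninj; have [|/forallPn n] := boolP [forall f, [forall h, [&& f \in
    ffun_on (mem K), h \in ffun_on (mem K) & ev f == ev h] ==> (f == h)]].
    move/forallP=> inj; case: ninj => f h Kf Kh /eqP e; apply/eqP.
    by move/forallP/(_ h): (inj f); rewrite Kf Kh e.
  case: n => f /forallPn[h]; rewrite negb_imply => /andP[/and3P[Kf Kh /eqP e]
    nfh].
  by exists f, h.
pose P := \poly_(i < b) (if insub i is Some k then f k - h k else 0).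
have coefP (i : 'I_b) : P`_i = f i - h i by rewrite coef_poly ltn_ord valK.
have P0 : P != 0.
  apply: contra nfh => /eqP P0; apply/eqP/ffunP=> i; apply/eqP.
  by rewrite -subr_eq0 -coefP P0 coef0.
have evP a : P.[a] = \sum_(i < b) (f i - h i) * a ^+ i.
  rewrite horner_poly; apply: eq_bigr => i _; by rewrite valK.
have Kfh i : psi (f i - h i) = f i - h i.
  have psiN c : psi (- c) = - psi c.
    by apply/eqP; rewrite -subr_eq0 opprK -psiD addNr endo0.
  have := ffun_onP Kf i; have := ffun_onP Kh i; rewrite !inE => /eqP eh /eqP ef.
  by rewrite psiD psiN eh ef.
have Pg : P.[g] = 0.
  rewrite evP; under eq_bigr do rewrite mulrBl.
  by rewrite sumrB -/(ev f) -/(ev h) efh subrr.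
have psiP a : P.[psi a] = psi P.[a].
  rewrite !evP (big_morph psi psiD endo0); apply: eq_bigr => i _.
  by rewrite psiM Kfh endoX.
have := max_poly_roots P0 _ uniq_g; rewrite size_map size_iota ltnNge size_poly.
suff -> : all (root P) [seq iter i psi g | i <- iota 0 b] by move/(_ isT).
apply/allP=> _ /mapP[i _ ->]; rewrite /root; elim: i => [|i IHi];
  first by rewrite Pg.
by rewrite iterS psiP endo_eq0.
Qed.

End FixedField.

(** * Additive maps that are semilinear over the squares *)

Section Semilinear.

Variables (b : nat) (phi : F -> F).
Hypotheses (phiD : {morph phi : a c / a + c}) (phi_inj : injective phi).
Hypothesis (phi_sqr : forall k, exists m, forall a, phi (k ^+ 2 * a) = m * phi
  a).

Definition lin_part (a : F) := phi a / phi 1.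
Local Notation psi := lin_part.

Lemma semilin0 : phi 0 = 0.
Proof. by apply: (addrI (phi 0)); rewrite -phiD !addr0. Qed.

Lemma semilin1_neq0 : phi 1 != 0.
Proof. by rewrite -semilin0 (inj_eq phi_inj) oner_eq0. Qed.

Lemma semilinE a : phi a = phi 1 * psi a.
Proof. by rewrite mulrC divfK // semilin1_neq0. Qed.

Lemma lin_part1 : psi 1 = 1. Proof. by rewrite /psi divff ?semilin1_neq0. Qed.

Lemma lin_partD : {morph psi : a c / a + c}.
Proof. by move=> a c; rewrite /psi phiD mulrDl. Qed.

(** [phi_sqr] gives the case where the first factor is a square, and additivity the rest. So [phi]
    is a field automorphism followed by multiplication by [phi 1]. *)
Lemma lin_partM : {morph psi : a c / a * c}.
Proof.
have sq k a : psi (k ^+ 2 * a) = psi (k ^+ 2) * psi a.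
  have [m hm] := phi_sqr k; rewrite /psi -{2}(mulr1 (k ^+ 2)) !hm.
  by rewrite (mulfK semilin1_neq0) mulrA.
have psiN c : psi (- c) = - psi c.
  apply/eqP; rewrite -subr_eq0 opprK -lin_partD addNr /psi semilin0 mul0r //.
move=> a c; have [k [l ->]] := diff_of_squares a.
by rewrite mulrBl !lin_partD !psiN !sq mulrBl.
Qed.

Lemma iter_semilin j a : iter j phi a = iter j phi 1 * iter j psi a.
Proof.
elim: j => [|j IHj] /=; first by rewrite mul1r.
by rewrite IHj semilinE lin_partM mulrA -semilinE.
Qed.

Lemma iter_semilin1X j i : (forall a, iter j psi a = a) -> iter (j * i) phi 1 =
  (iter j phi 1) ^+ i.
Proof.
move=> idj; elim: i => [|i IHi]; first by rewrite muln0 expr0.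
by rewrite mulnS iterD iter_semilin IHi idj exprS.
Qed.

(* The N-th power of phi 1 is a sign, hence fixed by psi, and its b-th power
   is 1. *)
Lemma semilin1X N : odd b -> (forall a, iter b phi a = a) ->
  (forall a : F, a != 0 -> a ^+ (2 * N) = 1) -> phi 1 ^+ N = 1.
Proof.
move=> ob idb sgn; set eps := phi 1 ^+ N.
have eps2 : eps ^+ 2 = 1 by rewrite -exprM mulnC sgn ?semilin1_neq0.
have endoX a i : psi (a ^+ i) = psi a ^+ i.
  by elim: i => [|i IHi]; rewrite ?lin_part1 // !exprS lin_partM IHi.
have psi_eps : psi eps = eps.
  move/eqP: eps2; rewrite -subr_eq0 subr_sqr_1 mulf_eq0 subr_eq0 addr_eq0.
  case/orP=> /eqP->; first exact: lin_part1.
  apply/eqP; rewrite -subr_eq0 opprK -{2}lin_part1 -lin_partD addNr.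
  by rewrite /psi semilin0 mul0r.
have iterN j : (iter j phi 1) ^+ N = eps ^+ j.
  elim: j => [|j IHj]; first by rewrite expr1n.
  rewrite iterS semilinE exprMn -endoX IHj endoX psi_eps -exprS //.
have := iterN b; rewrite idb expr1n -[b in eps ^+ b]odd_double_half ob.
by rewrite add1n exprS -mul2n exprM eps2 expr1n mulr1.
Qed.

(** Division by one nonzero fixed point of [phi] carries all of them into the fixed field of [psi];
    if there is none, only 0 is fixed. *)
Lemma card_fixed_semilinear p : (#|[set a | psi a == a]| <= p)%N ->
  (#|[set a | phi a == a]| <= p)%N.
Proof.
move=> leK; have [/existsP[a0 /andP[na /eqP fa]]|/existsPn n] := boolP [exists
  a, (a != 0) && (phi a == a)].
  apply: leq_trans leK; rewrite -(card_imset _ (mulIf (invr_neq0 na))).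
  apply/subset_leq_card/subsetP=> _ /imsetP[a /[!inE]/eqP e ->].
  apply/eqP/(mulIf na); rewrite divfK // -{2}fa semilinE mulrCA -lin_partM
    divfK //.
  by rewrite -semilinE.
apply: leq_trans leK; apply: (@leq_trans 1%N); last first.
  by rewrite card_gt0; apply/set0Pn; exists 1; rewrite inE lin_part1.
rewrite -(cards1 (0 : F)); apply/subset_leq_card/subsetP=> a;
  rewrite !inE => fa.
by have := n a; rewrite fa andbT negbK.
Qed.

End Semilinear.

End SemilinearMaps.

(** * Tori acting by field multiplications *)

(* c identifies V / W with the additive group of F in such a way that T acts
   faithfully by multiplication by the nonzero squares of F. *)
Record coordinate (F : finFieldType) (gT : finGroupType) (T V W : {group gT})
    (c kappa : gT -> F) : Prop := Coordinate {
  coordM : {in V &, forall u v, c (u * v) = (c u + c v)%R};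
  coord_eq0 : {in V, forall u, (c u == 0%R) = (u \in W)};
  coord_onto : forall a, exists2 u, u \in V & c u = a;
  coordJ : {in V & T, forall u t, c (u ^ t) = (kappa t * c u)%R};
  mult_square : {in T, forall t, exists2 k, k != 0%R & kappa t = (k ^+ 2)%R};
  mult_onto : forall k, k != 0%R -> exists2 t, t \in T & kappa t = (k ^+ 2)%R;
  mult_inj : {in T &, injective kappa}
}.

Section Coordinate.

Variables (F : finFieldType) (gT : finGroupType) (T V W : {group gT}).
Variables (c kappa : gT -> F).
Hypotheses (cV : coordinate T V W c kappa) (nVT : T \subset 'N(V)).

Lemma coord1 : c 1 = 0%R.
Proof.
by apply: (addrI (c 1)); rewrite -(coordM cV) ?group1 // mulg1 addr0.
Qed.

Lemma coordV u : u \in V -> c u^-1 = (- c u)%R.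
Proof.
move=> Vu; apply/eqP; rewrite -subr_eq0 opprK -(coordM cV) ?groupV //.
by rewrite mulVg coord1.
Qed.

Lemma coord_eq u v : u \in V -> v \in V -> (c u == c v) = (u * v^-1 \in W).
Proof.
move=> Vu Vv; rewrite -(coord_eq0 cV) ?groupM ?groupV //.
by rewrite (coordM cV) ?groupV // coordV // subr_eq0.
Qed.

Lemma multM : {in T &, forall s t, kappa (s * t) = (kappa s * kappa t)%R}.
Proof.
move=> s t Ts Tt; have [u Vu cu] := coord_onto cV 1%R.
have Vus : u ^ s \in V by rewrite memJ_norm ?(subsetP nVT).
have := coordJ cV Vu (groupM Ts Tt); rewrite cu mulr1 => <-.
by rewrite conjgM !(coordJ cV) // cu mulr1 mulrC.
Qed.

Lemma mult1 : kappa 1 = 1%R.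
Proof.
have [u Vu cu] := coord_onto cV 1%R.
by have := coordJ cV Vu (group1 T); rewrite conjg1 cu mulr1.
Qed.

Lemma mult_neq0 t : t \in T -> kappa t != 0%R.
Proof. by case/(mult_square cV) => k k0 ->; rewrite expf_neq0. Qed.

Lemma multX t i : t \in T -> kappa (t ^+ i) = (kappa t ^+ i)%R.
Proof.
move=> Tt; elim: i => [|i IHi]; first exact: mult1.
by rewrite expgS exprS multM ?groupX // IHi.
Qed.

Lemma abelian_mult : abelian T.
Proof.
apply/centsP=> s Ts t Tt; apply: (mult_inj cV); rewrite ?groupM //.
by rewrite !multM // mulrC.
Qed.

Lemma mult_card t : t \in T -> (kappa t ^+ #|T| = 1)%R.
Proof. by move=> Tt; rewrite -multX // expg_cardG // mult1. Qed.

Lemma expr_2cardT (a : F) : a != 0%R -> (a ^+ (2 * #|T|) = 1)%R.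
Proof.
by move=> a0; have [t Tt e] := mult_onto cV a0; rewrite exprM -e mult_card.
Qed.

(** [kappa] embeds [T] in the solutions of this equation, of which there are at most [#|T|]. *)
Lemma mult_root (a : F) : (a ^+ #|T| = 1)%R -> exists2 t, t \in T & kappa t = a.
Proof.
move=> ea; pose rs := [seq kappa t | t <- enum T].
have urs : uniq rs.
  by rewrite map_inj_in_uniq ?enum_uniq // => s t; rewrite !mem_enum;
    apply: (mult_inj cV).
have [/mapP[t]|na] := boolP (a \in rs); first by rewrite mem_enum => Tt ->;
  exists t.
have alla : all (root_of_unity #|T|) (a :: rs).
  apply/allP=> e; rewrite inE => /orP[/eqP->|/mapP[t Tt ->]];
    apply/unity_rootP => //.
  by apply: mult_card; rewrite -mem_enum.
have := max_unity_roots (cardG_gt0 T) alla; rewrite /= na urs => /(_ isT).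
by rewrite size_map -cardE ltnn.
Qed.

Lemma cent_T_coord u t : u \in V -> t \in T -> t != 1 -> u ^ t = u -> u \in W.
Proof.
move=> Vu Tt nt e; rewrite -(coord_eq0 cV) //.
have /eqP := coordJ cV Vu Tt; rewrite e -subr_eq0 -{1}(mul1r (c u)) -mulrBl
  mulf_eq0.
case/orP=> //; rewrite subr_eq0 -mult1 => /eqP/(mult_inj cV) e1.
by case/eqP: nt; rewrite e1 ?group1.
Qed.

Section Automorphism.

Variable x : gT.
Hypotheses (nVx : x \in 'N(V)) (nWx : x \in 'N(W)) (nTx : x \in 'N(T)).

(** The action of [x] on [V / W], read on [F]. The choice of [u] is immaterial because [x]
    normalises [W]; by [coord_onto] the default 0 is never reached. *)
Definition coord_map (a : F) : F :=
  if [pick u in V | c u == a] is Some u then c (u ^ x) else 0%R.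
Local Notation phi := coord_map.

Lemma coord_mapE u : u \in V -> c (u ^ x) = phi (c u).
Proof.
move=> Vu; rewrite /phi; case: pickP => [v /andP[Vv /eqP e]|/(_ u)];
  last by rewrite Vu eqxx.
apply/eqP; rewrite coord_eq ?memJ_norm // -conjVg -conjMg memJ_norm //.
by rewrite -coord_eq // e.
Qed.

Lemma coord_mapD : {morph phi : a d / (a + d)%R}.
Proof.
move=> a d; have [u Vu <-] := coord_onto cV a;
  have [v Vv <-] := coord_onto cV d.
by rewrite -(coordM cV) // -!coord_mapE ?groupM // conjMg (coordM cV)
  ?memJ_norm.
Qed.

Lemma coord_map_inj : injective phi.
Proof.
move=> a d; have [u Vu <-] := coord_onto cV a;
  have [v Vv <-] := coord_onto cV d.
rewrite -!coord_mapE // => /eqP; rewrite coord_eq ?memJ_norm //.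
by rewrite -conjVg -conjMg memJ_norm // -coord_eq // => /eqP.
Qed.

Lemma coord_mapJ t a : t \in T -> phi (kappa t * a)%R = (kappa (t ^ x) * phi
  a)%R.
Proof.
move=> Tt; have [u Vu <-] := coord_onto cV a.
have Vut : u ^ t \in V by rewrite memJ_norm ?(subsetP nVT).
rewrite -(coordJ cV) // -!coord_mapE // conjJg (coordJ cV) ?memJ_norm //.
Qed.

Lemma coord_map_sqr k : exists m, forall a, phi (k ^+ 2 * a)%R = (m * phi a)%R.
Proof.
have [->|k0] := eqVneq k 0%R.
  exists 0%R => a; rewrite expr0n !mul0r.
  by rewrite -coord1 -coord_mapE ?conj1g ?coord1.
by have [t Tt <-] := mult_onto cV k0; exists (kappa (t ^ x)) => a;
  apply: coord_mapJ.
Qed.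

(** One field automorphism describes [x] on [V / W], up to a scalar, and on [T]; this is how
    information passes between the two. *)
Lemma multJ t : t \in T -> kappa (t ^ x) = lin_part phi (kappa t).
Proof.
move=> Tt; rewrite /lin_part -(mulr1 (kappa t)) coord_mapJ // mulfK //.
exact: semilin1_neq0 coord_mapD coord_map_inj.
Qed.

Lemma iter_coord_map j u : u \in V -> c (u ^ (x ^+ j)) = iter j phi (c u).
Proof.
move=> Vu; elim: j => [|j IHj] /=; first by rewrite conjg1.
have Vuj : u ^ (x ^+ j) \in V by rewrite memJ_norm ?groupX.
by rewrite expgSr conjgM coord_mapE // IHj.
Qed.

Lemma iter_multJ j t : t \in T -> kappa (t ^ (x ^+ j)) = iter j (lin_part phi)
  (kappa t).
Proof.
move=> Tt; elim: j => [|j IHj] /=; first by rewrite conjg1.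
have Ttj : t ^ (x ^+ j) \in T by rewrite memJ_norm ?groupX.
by rewrite expgSr conjgM multJ // IHj.
Qed.

Lemma iter_coord_map_order a : iter #[x] phi a = a.
Proof.
by have [u Vu <-] := coord_onto cV a; rewrite -iter_coord_map // expg_order
  conjg1.
Qed.

Lemma cent_lin_part_id j : x ^+ j \in 'C(T) -> forall a, iter j (lin_part phi)
  a = a.
Proof.
move=> cTj; have psiD := lin_partD coord_mapD.
have fix_sqr k : iter j (lin_part phi) (k ^+ 2)%R = (k ^+ 2)%R.
  have [->|k0] := eqVneq k 0%R.
    rewrite expr0n /=; elim: (j) => //= i ->.
    by rewrite /lin_part (semilin0 coord_mapD) mul0r.
  have [t Tt <-] := mult_onto cV k0; rewrite -iter_multJ //.
  by rewrite (cent_conj cTj).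
have iterB : {morph iter j (lin_part phi) : a d / (a - d)%R}.
  elim: (j) => [//|i IHi] a d; rewrite !iterS IHi; apply/eqP.
  by rewrite -subr_eq opprK -psiD subrK.
by move=> a; have [k [l ->]] := diff_of_squares a; rewrite iterB !fix_sqr.
Qed.

Hypotheses (ox : odd #[x]) (coTx : coprime #|T| #[x]).

(* x^j then acts on V / W as a scalar whose order divides both #[x] and
   2 * #|T|. *)
Lemma lin_part_id j : (forall a, iter j (lin_part phi) a = a) ->
  x ^+ j \in 'C(T) /\ {in V, forall u, [~ u, x ^+ j] \in W}.
Proof.
move=> idj; split.
  apply/centP=> t Tt; apply/commute_sym; rewrite /commute conjgC; congr (_ * _).
  by apply: (mult_inj cV); rewrite ?memJ_norm ?groupX // iter_multJ.
pose l := iter j phi 1%R.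
have sc := iter_semilin coord_mapD coord_map_inj coord_map_sqr.
have l0 : l != 0%R.
  rewrite /l; elim: (j) => [|i IHi]; first by rewrite oner_eq0.
  by rewrite iterS -(semilin0 coord_mapD) (inj_eq coord_map_inj).
have lb : (l ^+ #[x] = 1)%R.
  rewrite -(iter_semilin1X coord_mapD coord_map_inj coord_map_sqr) // mulnC.
  by elim: (j) => [|i IHi]; rewrite ?muln0 // mulnS iterD IHi
    iter_coord_map_order.
have l1 : l = 1%R.
  have co : coprime #[x] (2 * #|T|) by rewrite coprimeMr coprimen2 ox
    coprime_sym.
  have [u v e _] := egcdnP (2 * #|T|) (order_gt0 x).
  have : (l ^+ (u * #[x]) = l ^+ (v * (2 * #|T|) + 1))%R by rewrite e (eqP co).
  by rewrite mulnC exprM lb expr1n mulnC exprD exprM expr_2cardT // expr1n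
    mul1r expr1.
move=> u Vu; have Vuj : u ^ (x ^+ j) \in V by rewrite memJ_norm ?groupX.
rewrite commgEl -(coord_eq0 cV) ?(groupM (groupVr Vu) Vuj) // (coordM cV)
  ?groupV // coordV //.
by rewrite iter_coord_map // sc -/l l1 idj mul1r addNr.
Qed.

Variables (p b : nat).
Hypotheses (p_gt0 : (0 < p)%N) (b_gt0 : (0 < b)%N) (cardF : #|F| = (p ^ b)%N).
Hypotheses (x_order : forall j, (0 < j < b)%N -> exists a, iter j (lin_part
  phi) a != a).

Let leK : (#|[set a | lin_part phi a == a]| <= p)%N.
Proof.
apply: (@card_fixed_field _ _ b) => //.
- exact: lin_partD coord_mapD.
- exact: lin_partM coord_mapD coord_map_inj coord_map_sqr.
- exact: lin_part1 coord_mapD coord_map_inj.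
Qed.

(** [kappa] maps the centraliser to nonzero elements of the fixed field, so its order is less than
    [p], hence at most 2, and it is odd. *)
Lemma cent_T_triv : odd #|T| -> (p <= 3)%N -> 'C_T[x] = 1.
Proof.
move=> oT p3; apply/eqP; rewrite trivg_card1.
have : (#|'C_T[x]| < p)%N.
  apply: leq_trans leK; rewrite -(card_in_imset (f := kappa)); last first.
    by apply: sub_in2 (mult_inj cV) => t /setIP[].
  apply: proper_card; apply/properP; split.
    apply/subsetP=> _ /imsetP[t /setIP[Tt ct] ->]; rewrite inE -multJ //.
    by move: ct; rewrite cent1_conjE => /eqP->.
  exists 0%R; first by rewrite inE /lin_part (semilin0 coord_mapD) mul0r.
  by apply/imsetP=> -[t /setIP[Tt _] e]; have := mult_neq0 Tt; rewrite -e eqxx.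
have : odd #|'C_T[x]| by apply: dvdn_odd oT; apply: cardSg; apply: subsetIl.
by case: #|'C_T[x]| => [|[|[|n]]] // _ ltp; have := leq_trans ltp p3.
Qed.

Let leV : (#|[set a | phi a == a]| <= p)%N.
Proof.
by apply: (card_fixed_semilinear coord_mapD coord_map_inj coord_map_sqr).
Qed.

(** Cosets of ['C_W[x]] in ['C_V[x]] have distinct coordinates, all fixed by [phi], and [leV] bounds
    the number of these. *)
Lemma card_cent_coord : W \subset V -> (#|'C_V[x]| <= p * #|'C_W[x]|)%N.
Proof.
move=> sWV; pose P := 'C_V[x]%G; pose R := 'C_W[x]%G.
have sub_cV : {in P &, {morph c : u v / u * v >-> (u + v)%R}}.
  by move=> u v /setIP[Vu _] /setIP[Vv _]; apply: (coordM cV).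
have sRP : R \subset P by rewrite setSI.
rewrite -(Lagrange sRP) mulnC leq_mul2r; apply/orP; right.
apply: leq_trans leV.
rewrite /indexg -(card_in_imset (f := fun A : {set gT} => c (repr A)));
  last first.
  move=> _ _ /rcosetsP[u Pu ->] /rcosetsP[v Pv ->].
  case: repr_rcosetP => s Rs; case: repr_rcosetP => t Rt /eqP.
  have PV z : z \in P -> z \in V by case/setIP.
  have Ps := subsetP sRP _ Rs; have Pt := subsetP sRP _ Rt.
  have Psu := groupM Ps Pu; have Ptv := groupM Pt Pv.
  rewrite (coord_eq (PV _ Psu) (PV _ Ptv)) => Wq.
  have : s * u * (t * v)^-1 \in R by rewrite in_setI Wq;
    case/setIP: (groupM Psu (groupVr Ptv)).
  rewrite invMg !mulgA groupMr ?groupV // -mulgA groupMl // => Ruv.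
  by apply/rcoset_eqP; rewrite mem_rcoset.
apply/subset_leq_card/subsetP=> _ /imsetP[_ /rcosetsP[u Pu ->] ->].
case: repr_rcosetP => s Rs.
have /setIP[Vz cz] : s * u \in P by rewrite groupM // (subsetP sRP).
rewrite inE -coord_mapE //; apply/eqP; congr (c _).
by apply/eqP; rewrite -cent1_conjE.
Qed.

End Automorphism.

(* phi 1 is a square, so some x * t with t in T centralises the element of
   coordinate 1; and x * t is conjugate to x. *)
Lemma cent_coord_nontriv x : W :=: 1 -> x \in 'N(V) -> x \in 'N(T) ->
  odd #[x] -> 'C_T[x] = 1 -> 'C_V[x] != 1.
Proof.
move=> W1 nVx nTx ox cTx; have nWx : x \in 'N(W) by rewrite W1 norm1 inE.
pose phi := coord_map x.
have pD := coord_mapD nVx nWx; have pI := coord_map_inj nVx nWx.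
have pS := coord_map_sqr nVx nWx nTx.
have [|t Tt et] := @mult_root (phi 1)^-1%R.
  rewrite exprVn (semilin1X pD pI pS ox) ?invr1 //;
    first exact: iter_coord_map_order nVx nWx.
  exact: expr_2cardT.
have [u Vu cu] := coord_onto cV 1%R.
have [s Ts es] : exists2 s, s \in T & x * t = x ^ s.
  by apply: coset_conj_of_cent1 => //; rewrite mem_lcoset mulKg.
have nVs : s \in 'N(V) := subsetP nVT s Ts.
apply/trivgPn; exists (u ^ s^-1); last first.
  apply/eqP=> u1; have := coord1; rewrite -(conj1g s) -u1 conjgKV cu.
  by move/eqP; rewrite oner_eq0.
rewrite inE memJ_norm ?groupV // Vu cent1_conjE; apply/eqP/(conjg_inj s).
rewrite conjJg conjgKV -es; apply/eqP.
rewrite eq_mulgV1 -in_set1 -[[set 1]]/(1 : {set gT}) -W1.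
have Vux : u ^ x \in V by rewrite memJ_norm.
have Vuxt : (u ^ x) ^ t \in V by rewrite memJ_norm ?(subsetP nVT).
rewrite conjgM -(coord_eq Vuxt Vu) (coordJ cV) // coord_mapE // cu et mulVf //.
exact: semilin1_neq0 pD pI.
Qed.

End Coordinate.

(* A split BN-pair of rank one with Borel subgroup U * T; U is an extension of
   at most two copies of the additive group of F (Z = U for PSL 2 F). *)
Record split_rank1 (p : nat) (F : finFieldType) (gT : finGroupType)
    (G U T Z : {group gT}) (w : gT) : Prop := SplitRank1 {
  sr_UG : U \subset G;
  sr_TG : T \subset G;
  sr_w : w \in G;
  sr_pU : p.-group U;
  sr_nUT : T \subset 'N(U);
  sr_Z : Z :=: [set u in U | u ^+ p == 1];
  sr_cZU : U \subset 'C(Z);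
  sr_nTw : w \in 'N(T);
  sr_bruhat : G \subset (U * T) :|: (U * T) :* w * U;
  sr_UBw : U :&: (U * T) :^ w = 1;
  sr_coordZ : exists c kappa, @coordinate F gT T Z 1%G c kappa;
  sr_coordU : U :=: Z \/ exists c kappa, @coordinate F gT T U Z c kappa
}.

(** [T] corresponds to the image of squaring on the units of [F], and the other factor counts the
    kernel. *)
Lemma card_squares (F : finFieldType) (gT : finGroupType) (T V W : {group gT})
    (c kappa : gT -> F) : coordinate T V W c kappa ->
  (#|T| * #|[set a : F | (a ^+ 2 == 1)%R]| = #|F|.-1)%N.
Proof.
move=> cV; pose A := [group of [set: {unit F}]].
have sqM : {in A &, {morph (fun u : {unit F} => u ^+ 2) : u v / u * v}}.
  by move=> u v _ _ /=; apply: expgMn; apply/val_inj; rewrite /= [LHS]mulrC.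
pose f := Morphism sqM.
have <- : #|A| = #|F|.-1 by rewrite /= card_finField_unit.
have -> : #|T| = #|f @* A|.
  rewrite morphimEdom -(card_in_imset (mult_inj cV)) -(card_imset _ val_inj).
  apply: eq_card => a; apply/imsetP/imsetP.
    case=> t Tt ->; have [k k0 ->] := mult_square cV Tt.
    have uk : k \is a GRing.unit by rewrite unitfE.
    exists (FinRing.unit F uk ^+ 2); last by rewrite FinRing.val_unitX.
    by apply/imsetP; exists (FinRing.unit F uk); rewrite ?inE.
  case=> _ /imsetP[u _ ->] ->; rewrite /= FinRing.val_unitX.
  have u0 : val u != 0%R by rewrite -unitfE (valP u).
  by have [t Tt kt] := mult_onto cV u0; exists t; rewrite // kt.
have -> : #|[set a : F | (a ^+ 2 == 1)%R]| = #|'ker f|.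
  rewrite -[RHS](card_imset _ val_inj); apply: eq_card => a; rewrite inE.
  apply/idP/imsetP=> [/eqP a2|[u ku ->]].
    have ua : a \is a GRing.unit.
      by rewrite unitfE; apply/eqP=> a0; move/eqP: a2;
        rewrite a0 expr0n eq_sym oner_eq0.
    exists (FinRing.unit F ua) => //; rewrite !inE /=; apply/eqP/val_inj.
    by rewrite FinRing.val_unitX.
  by move: ku; rewrite !inE /= => /eqP/(congr1 val);
    rewrite FinRing.val_unitX => ->.
by rewrite card_morphim setIid mulnC Lagrange // subsetIl.
Qed.

(** * From a split BN-pair to the numerical hypotheses on [x] *)

Section Reduction.

Variables (p b : nat) (F : finFieldType) (gT : finGroupType).
Variables (G U T Z : {group gT}) (w : gT).
Hypotheses (SR : split_rank1 p F G U T Z w).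
Hypotheses (p_pr : prime p) (p_le3 : p <= 3) (ob : odd b) (b_gt1 : 1 < b).
Hypotheses (cardF : #|F| = (p ^ b)%N).

Let sUG := sr_UG SR.
Let sTG := sr_TG SR.
Let nUT := sr_nUT SR.
Let b_gt0 : 0 < b. Proof. exact: ltnW. Qed.

Lemma sub_ZU : Z \subset U.
Proof. by rewrite (sr_Z SR); apply/subsetP=> u /setIdP[]. Qed.

(** The equation [u ^+ p = 1] makes [Z] invariant under all that normalises [U]. *)
Lemma norm_Z y : y \in 'N(U) -> y \in 'N(Z).
Proof.
move=> nUy; rewrite inE; apply/subsetP=> u; rewrite mem_conjg (sr_Z SR) !inE.
case/andP; rewrite memJ_norm ?groupV // => -> /=.
by rewrite -conjXg => /eqP e; apply/eqP/(conjg_inj y^-1); rewrite e conj1g.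
Qed.

Let nZT : T \subset 'N(Z).
Proof. by apply/subsetP=> t Tt; apply: norm_Z; apply: (subsetP nUT). Qed.

Lemma card_Z : #|Z| = #|F|.
Proof.
have [c [kappa cZ]] := sr_coordZ SR.
rewrite -(card_in_imset (f := c)) => [|u v Zu Zv /eqP].
  apply: eq_card => a; rewrite inE; apply/imsetP.
  by have [u Zu <-] := coord_onto cZ a; exists u.
by rewrite (coord_eq cZ) // => /set1gP/eqP; rewrite -eq_mulgV1 => /eqP.
Qed.

Lemma quo_abelian : abelian (U / Z).
Proof.
have nUZ : U \subset 'N(Z) by rewrite (subset_trans (sr_cZU SR)) ?cent_sub.
have [->|[c [kappa cU]]] := sr_coordU SR; first by rewrite trivg_quotient
  abelian1.
rewrite /abelian quotient_cents2 // gen_subG.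
apply/subsetP=> _ /imset2P[u v Uu Uv ->].
have Uc : [~ u, v] \in U by rewrite groupR.
rewrite -(coord_eq0 cU) // commgEl /conjg (coordM cU) ?groupM ?groupV //.
by rewrite !(coordM cU, coordV cU) ?groupM ?groupV // (addrC (c u)) addKr addNr.
Qed.

Lemma cent_U_triv : {in T, forall t, t != 1 -> 'C_U[t] = 1}.
Proof.
move=> t Tt nt; apply/trivgP/subsetP=> u /setIP[Uu];
  rewrite cent1_conjE => /eqP ut.
have Zu : u \in Z.
  have [<-//|[c [kappa cU]]] := sr_coordU SR.
  exact: (cent_T_coord cU Uu Tt nt ut).
have [c [kappa cZ]] := sr_coordZ SR.
exact: (cent_T_coord cZ Zu Tt nt ut).
Qed.

Let card_sqrt1 : #|[set a : F | (a ^+ 2 == 1)%R]| <= 2.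
Proof.
rewrite cardE; apply: max_unity_roots => //; last exact: enum_uniq.
by apply/allP=> a; rewrite mem_enum inE => /eqP e; apply/unity_rootP.
Qed.

(** [#|T|] divides [p ^ b - 1], which is odd for [p = 2]. For [p = 3] it is half of that number, and
    [3 ^ b] is 3 modulo 4 as [b] is odd. *)
Lemma T_order : odd #|T| /\ coprime p #|T|.
Proof.
have [c [kappa cZ]] := sr_coordZ SR; have := card_squares cZ; rewrite cardF.
move=> oT; have pb_gt0 : 0 < p ^ b by rewrite expn_gt0 prime_gt0.
split; last first.
  have := coprimenP pb_gt0; rewrite -oT coprime_pexpl // coprimeMr.
  by case/andP.
have [p2|p3] : p = 2 \/ p = 3 by case: (p) p_pr p_le3 => [|[|[|[|]]]] //;
  [left | right].
  have : odd (p ^ b).-1 by rewrite -subn1 oddB // p2 oddX; case: (b) b_gt0.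
  by rewrite -oT oddM => /andP[].
have m2 : #|[set a : F | (a ^+ 2 == 1)%R]| = 2.
  apply/eqP; rewrite eqn_leq card_sqrt1 /=.
  have n11 : (1 != -1 :> F)%R.
    have ch3 : 3 \in [pchar F]%R by apply: (card_finPcharP _ (n := b));
      rewrite ?cardF ?p3.
    apply/eqP=> e; have := pcharf0 ch3; rewrite (_ : 3%:R = 1 + (1 + 1))%R;
      last by ring.
    by rewrite {3}e subrr addr0 => /eqP; rewrite oner_eq0.
  apply: (@leq_trans #|[set 1%R; (-1)%R : F]|); first by rewrite cards2 n11.
  apply/subset_leq_card/subsetP=> a; rewrite !inE => /orP[]/eqP->;
    first by rewrite expr1n.
  by rewrite sqrrN expr1n.
move: oT; rewrite m2 p3 -[b]odd_double_half ob add1n expnS -mul2n expnM.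
have : ((3 ^ 2) ^ b./2 = 1 %[mod 4])%N by rewrite -modnXm exp1n.
by move: ((3 ^ 2) ^ _)%N => n; lia.
Qed.

Lemma ntT : T :!=: 1.
Proof.
have [c [kappa cZ]] := sr_coordZ SR; have := card_squares cZ; rewrite cardF.
move=> oT; apply/eqP=> T1; move: oT; rewrite T1 cards1 mul1n => oT.
have := card_sqrt1; rewrite oT; have : p ^ 3 <= p ^ b.
  by rewrite leq_exp2l ?prime_gt1 //; move: ob b_gt1; case: (b) => [|[|[|]]].
have : 2 ^ 3 <= p ^ 3 by rewrite leq_exp2r ?prime_gt1.
by lia.
Qed.

Lemma ntU : U :!=: 1.
Proof.
rewrite -cardG_gt1 (leq_trans _ (subset_leq_card sub_ZU)) // card_Z cardF.
by rewrite -(expn0 p) ltn_exp2l ?prime_gt1.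
Qed.

Section Normalised.

Variable x : gT.
Hypotheses (nGx : x \in 'N(G)) (ox : #[x] = b) (coGx : coprime #|G| b).
Hypotheses (faith : forall j, x ^+ j \in 'C(G) -> x ^+ j = 1).
Hypotheses (nUx : x \in 'N(U)) (nTx : x \in 'N(T)).

Let nZx := norm_Z nUx.
Let oddx : odd #[x]. Proof. by rewrite ox. Qed.
Let coTx : coprime #|T| #[x].
Proof. by rewrite ox (coprime_dvdl _ coGx) ?cardSg. Qed.

(** By [lin_part_id] the power acts trivially on [Z] and [U / Z], by coprimality then on [U], and
    [cent_UT_G] extends this to [G]. *)
Lemma cent_T_faithful j : x ^+ j \in 'C(T) -> x ^+ j = 1.
Proof.
move=> cTj; apply: faith; set y := x ^+ j in cTj *.
have nGy : y \in 'N(G) by apply: groupX.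
have comm_in (V W : {group gT}) c kappa : @coordinate F gT T V W c kappa ->
    T \subset 'N(V) -> x \in 'N(V) -> x \in 'N(W) -> {in V, forall u, [~ u, y]
      \in W}.
  move=> cV nVT nVx nWx.
  have := cent_lin_part_id cV nVT nVx nWx nTx cTj.
  by case/(lin_part_id cV nVT nVx nWx nTx oddx coTx).
have cZy : y \in 'C(Z).
  have [c [kappa cZ]] := sr_coordZ SR; apply/centP=> u Zu.
  have n1 : x \in 'N(1%G) by rewrite norm1 inE.
  by have := comm_in _ _ _ _ cZ nZT nZx n1 u Zu => /set1gP/eqP/commgP/esym.
have cUy : y \in 'C(U).
  have [->//|[c [kappa cU]]] := sr_coordU SR.
  have nUy : y \in 'N(U) by apply: groupX.
  apply/centP=> u Uu; apply/esym/commgP/eqP.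
  have Zc : [~ u, y] \in Z by exact: comm_in cU nUT nUx nZx u Uu.
  (* Powers of [y] multiply [u] by powers of [[~ u, y]], so the order of this element of [Z] divides
     [#[x]], which is prime to [#|Z|]. *)
  have ui i : u ^ (y ^+ i) = u * [~ u, y] ^+ i.
    elim: i => [|i IHi]; first by rewrite conjg1 mulg1.
    rewrite expgSr conjgM IHi conjMg conjXg expgS mulgA; congr (_ * _).
      by rewrite commgEl mulKVg.
    by congr (_ ^+ _); apply: cent_conj cZy Zc.
  have := ui b; rewrite -expgM mulnC expgM -ox expg_order expg1n conjg1 => e.
  have e1 : [~ u, y] ^+ #[x] = 1 by apply: (mulgI u); rewrite mulg1 -e.
  have coZ : coprime #[x] #|Z|.
    rewrite coprime_sym ox (coprime_dvdl _ coGx) // cardSg //.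
    exact: subset_trans sub_ZU sUG.
  apply/eqP; rewrite -order_eq1 -dvdn1 -(eqP coZ) dvdn_gcd order_dvdn e1 eqxx.
  exact: order_dvdG.
exact: (cent_UT_G sUG sTG (sr_w SR) nUT (sr_nTw SR) (sr_bruhat SR) (sr_UBw SR)
  cent_U_triv ntU ntT).
Qed.

Lemma lin_part_order V W c kappa : @coordinate F gT T V W c kappa ->
    T \subset 'N(V) -> x \in 'N(V) -> x \in 'N(W) ->
  forall j, 0 < j < b -> exists a, iter j (lin_part (coord_map V c x)) a != a.
Proof.
move=> cV nVT nVx nWx j /andP[j0 jb]; apply/existsP/contraT;
  rewrite negb_exists.
move/forallP=> id_j; have idj a : iter j (lin_part (coord_map V c x)) a = a.
  by apply/eqP; have := id_j a; rewrite negbK.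
have [cTj _] := lin_part_id cV nVT nVx nWx nTx oddx coTx idj.
have /eqP := cent_T_faithful cTj; rewrite -order_dvdn ox => /(dvdn_leq j0).
by rewrite leqNgt jb.
Qed.

Let p_gt0 : 0 < p. Proof. exact: prime_gt0. Qed.
Let norm11 : x \in 'N(1%G). Proof. by rewrite norm1 inE. Qed.

Lemma cent_Tx : 'C_T[x] = 1.
Proof.
have [c [kappa cZ]] := sr_coordZ SR; have [oT _] := T_order.
exact: (cent_T_triv cZ nZT nZx norm11 nTx p_gt0 b_gt0 cardF (lin_part_order cZ
  nZT nZx norm11)).
Qed.

Lemma card_cent_Z : #|'C_Z[x]| = p.
Proof.
have [c [kappa cZ]] := sr_coordZ SR.
have := card_cent_coord cZ nZT nZx norm11 nTx p_gt0 b_gt0 cardF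
  (lin_part_order cZ nZT nZx norm11) (sub1G Z).
rewrite setI1g cards1 muln1 => leP; apply/eqP; rewrite eqn_leq leP /=.
have pP : p.-group 'C_Z[x].
  by apply: pgroupS (sr_pU SR); rewrite subIset // sub_ZU.
have [|_ /dvdn_leq-> //] := pgroup_pdiv pP.
exact: (cent_coord_nontriv cZ nZT (erefl _) nZx nTx oddx cent_Tx).
Qed.

Lemma card_cent_U : #|'C_U[x]| %| p * p.
Proof.
have [->|[c [kappa cU]]] := sr_coordU SR; first by rewrite card_cent_Z
  dvdn_mulr.
have := card_cent_coord cU nUT nUx nZx nTx p_gt0 b_gt0 cardF
  (lin_part_order cU nUT nUx nZx) sub_ZU.
rewrite card_cent_Z mulnn.
have pP : p.-group 'C_U[x] by apply: pgroupS (sr_pU SR); apply: subsetIl.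
have [n ->] := p_natP pP.
by rewrite leq_exp2l ?prime_gt1 //; apply: dvdn_exp2l.
Qed.

Lemma normalised_coset_sqr y : y \in x ^+ 2 *: G ->
  exists2 g, g \in G & exists2 h, h \in G & y = x ^ g * x ^ h.
Proof.
have [_ p'T] := T_order.
have ltZ : p < #|Z|.
  by have := ltn_exp2l 1 b (prime_gt1 p_pr); rewrite card_Z cardF expn1 b_gt1.
have coGx' : coprime #|G| #[x] by rewrite ox.
exact: (coset_sqr p_pr sUG sTG (sr_w SR) (sr_pU SR) p'T nUT sub_ZU (sr_cZU SR)
  nZT
  (sr_nTw SR) (sr_bruhat SR) (sr_UBw SR) cent_U_triv quo_abelian ntU ntT
  nGx nUx nTx nZx oddx coGx' cent_Tx card_cent_Z ltZ card_cent_U).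
Qed.

End Normalised.

Lemma B_group : group_set (U * T).
Proof.
exact: (B_group_set sUG sTG nUT (sr_bruhat SR) (sr_UBw SR) ntU).
Qed.
Let B := Group B_group.

Let TU_coprime : coprime #|U| #|T|.
Proof.
have [_ p'T] := T_order; apply: (pnat_coprime (sr_pU SR)).
by rewrite p'natE // -prime_coprime.
Qed.

Lemma card_UT : #|B| = (#|U| * #|T|)%N.
Proof. by rewrite /= TI_cardMg // coprime_TIg. Qed.

(** [U] is a Sylow [p]-subgroup of [G], and [T] a Hall subgroup of the solvable group [U * T].
    Coprime action leaves some subgroup of each kind invariant, and it is conjugate to the given
    one. *)
Lemma exists_normalised x : x \in 'N(G) -> coprime #|G| #[x] ->
  exists2 g, g \in G & x ^ g \in 'N(U) /\ x ^ g \in 'N(T).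
Proof.
move=> nGx coGx; have [oT p'T] := T_order.
have cG := card_G p_pr sUG sTG (sr_w SR) (sr_pU SR) p'T nUT (sr_bruhat SR)
  (sr_UBw SR) ntU.
have iU : #|G : U| = (#|U|.+1 * #|T|)%N by rewrite -divgS // cG mulnCA mulKn.
have sylU : p.-Sylow(G) U.
  rewrite /pHall sUG (sr_pU SR) iU p'natE // Euclid_dvdM // negb_or
    -[#|U|.+1]addn1.
  have [_ pdU _] := pgroup_pdiv (sr_pU SR) ntU.
  rewrite dvdn_addr // dvdn1 -(prime_coprime _ p_pr) p'T andbT.
  by apply: contraTN p_pr => /eqP->.
have solx : solvable <[x]> by rewrite abelian_sol ?cycle_abelian.
have [||P sylP nPx] := @sol_coprime_Sylow_exists _ p <[x]>%G G solx.
- by rewrite cycle_subG.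
- exact: coGx.
have [g Gg defU] := Sylow_trans sylP sylU.
have nUx : x ^ g \in 'N(U) by rewrite defU normJ memJ_conjg -cycle_subG.
have nGxg : x ^ g \in 'N(G) by rewrite groupJ // (subsetP (normG G)).
have defB : B :=: 'N_G(U) by rewrite /= (norm_U sUG sTG nUT (sr_bruhat SR)
  (sr_UBw SR) ntU).
have sBG : B \subset G by rewrite defB subsetIl.
have sUB : U \subset B by rewrite /= mulG_subl.
have sTB : T \subset B by rewrite /= mulG_subr.
have nBxg : <[x ^ g]> \subset 'N(B) by rewrite defB normsI ?norms_norm
  ?cycle_subG.
have solB : solvable B.
  rewrite (series_sol (_ : U <| B)); last by rewrite /normal sUB defB subsetIr.
  rewrite (pgroup_sol (sr_pU SR)) /= quotientMidl quotient_sol // abelian_sol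
    //.
  have [c [kappa cZ]] := sr_coordZ SR; exact: (abelian_mult cZ nZT).
(* Here [fixfree_cent] is a local name for an invariant Hall subgroup of [B], unrelated to the
   earlier set of that name. *)
have [||fixfree_cent hallQ nQx] := @coprime_Hall_exists p^' _ <[x ^ g]>%G B
  nBxg.
- by rewrite -[#|<[_]>|]/(#[_]) orderJ (coprime_dvdl _ coGx) // cardSg.
- exact: solB.
have hallT : p^'.-Hall(B) T.
  have iT : #|B : T| = #|U| by rewrite -divgS // card_UT mulnK ?cardG_gt0.
  rewrite /pHall sTB iT pnatNK [p.-nat _](sr_pU SR) andbT.
  by rewrite /pgroup p'natE // -prime_coprime.
have [h Bh defT] := Hall_trans solB hallT hallQ.
exists (g * h); first by rewrite groupM // (subsetP sBG).
have nUh : h \in 'N(U) by move: Bh; rewrite defB => /setIP[].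
rewrite conjgM; split; first by rewrite groupJ.
by rewrite defT normJ memJ_conjg -cycle_subG.
Qed.

Theorem split_coset_sqr x : x \in 'N(G) -> #[x] = b -> coprime #|G| b ->
    (forall j, x ^+ j \in 'C(G) -> x ^+ j = 1) ->
  forall y, y \in x ^+ 2 *: G ->
  exists2 g, g \in G & exists2 h, h \in G & y = x ^ g * x ^ h.
Proof.
move=> nGx ox coGx faith y Gy.
have coGx' : coprime #|G| #[x] by rewrite ox.
have [g Gg [nUx nTx]] := exists_normalised nGx coGx'.
have nGxg : x ^ g \in 'N(G) by rewrite groupJ // (subsetP (normG G)).
have [|||h Gh [k Gk ->]] := @normalised_coset_sqr (x ^ g) nGxg _ coGx _ nUx nTx
  y.
- by rewrite orderJ.
- move=> j; rewrite -conjXg memJ_norm => [/faith->|]; first by rewrite conj1g.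
  by rewrite (subsetP (norms_cent (normG G))).
- have : (x ^ g) ^+ 2 \in x ^+ 2 *: G.
    by rewrite -conjXg; apply: coset_J; rewrite ?groupX ?lcoset_refl.
  by move/lcoset_eqP ->.
exists (g * h); first exact: groupM.
by exists (g * k); [exact: groupM | rewrite !conjgM].
Qed.

End Reduction.

(** * Transport of the structure along an injective morphism *)

Section Transport.

Variables (F : finFieldType) (aT rT : finGroupType) (G : {group aT}).
Variables (f : {morphism G >-> rT}).
Hypothesis injf : 'injm f.

Lemma coordinate_morphim (T V W : {group aT}) c kappa :
    T \subset G -> V \subset G -> W \subset G -> T \subset 'N(V) ->
    @coordinate F aT T V W c kappa ->
  coordinate (f @* T)%G (f @* V)%G (f @* W)%G (c \o invm injf) (kappa \o invm
    injf).
Proof.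
move=> sTG sVG sWG nVT [cM c0 c_onto cJ k_sq k_onto k_inj].
have im (A : {group aT}) g : A \subset G -> g \in f @* A -> exists2 a, a \in A
  & g = f a /\ a \in G.
  by move=> sAG /morphimP[a Ga Aa ->]; exists a.
have Tinv t : t \in f @* T -> invm injf t \in T.
  by case/(im _ _ sTG)=> a Ta [-> Ga]; rewrite invmE.
split.
- move=> _ _ /(im _ _ sVG)[u Vu [-> Gu]] /(im _ _ sVG)[v Vv [-> Gv]].
  by rewrite /= -morphM // !invmE ?groupM // cM.
- move=> _ /(im _ _ sVG)[u Vu [-> Gu]]; rewrite /= invmE // c0 //.
  by apply/idP/idP=> [Wu|/(im _ _ sWG)[a Wa [e Ga]]];
    [exact: mem_morphim | rewrite (injmP injf _ _ Gu Ga e)].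
- move=> a; have [u Vu <-] := c_onto a; exists (f u);
  last by rewrite /= invmE ?(subsetP sVG).
  by rewrite mem_morphim ?(subsetP sVG).
- move=> _ _ /(im _ _ sVG)[u Vu [-> Gu]] /(im _ _ sTG)[t Tt [-> Gt]].
  by rewrite /= -morphJ // !invmE ?groupJ // cJ.
- by move=> t /Tinv Tt; apply: k_sq.
- move=> k /k_onto[t Tt <-]; exists (f t);
  last by rewrite /= invmE ?(subsetP sTG).
  by rewrite mem_morphim ?(subsetP sTG).
- move=> _ _ /(im _ _ sTG)[s Ts [-> Gs]] /(im _ _ sTG)[t Tt [-> Gt]].
  by rewrite /= !invmE // => /k_inj->.
Qed.

Lemma split_rank1_morphim p (U T Z : {group aT}) w :
    split_rank1 p F G U T Z w ->
  split_rank1 p F (f @* G)%G (f @* U)%G (f @* T)%G (f @* Z)%G (f w).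
Proof.
move=> SR; have sZU := sub_ZU SR; have nZT : T \subset 'N(Z).
  by apply/subsetP=> t Tt; apply: (norm_Z SR); apply: (subsetP (sr_nUT SR)).
case: SR => sUG sTG Gw pU nUT defZ cZU nTw bruhat UBw1 coZ coU.
have sZG := subset_trans sZU sUG.
have sBG : U * T \subset G by rewrite mul_subG.
split.
- exact: morphimS.
- exact: morphimS.
- exact: mem_morphim.
- exact: morphim_pgroup.
- by rewrite /= (subset_trans (morphimS f nUT)) // morphim_norm.
- apply/setP=> z; apply/morphimP/setIdP.
    case=> a Ga Za ->; move: Za; rewrite defZ => /setIdP[Ua /eqP ap].
    by rewrite mem_morphim // -morphX // ap morph1.
  case=> /morphimP[a Ga Ua ->]; rewrite -morphX // => /eqP ap.
  exists a => //; rewrite defZ inE Ua /=; apply/eqP.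
  by apply: (injmP injf); rewrite ?groupX // ap morph1.
- exact: morphim_cents.
- by rewrite (subsetP (morphim_norm f T)) // mem_morphim.
- apply/subsetP=> _ /morphimP[a Ga _ ->]; apply/setUP.
  have imM u t : u \in U -> t \in T -> f (u * t) \in f @* U * f @* T.
    move=> Uu Tt; have [Gu Gt] := (subsetP sUG _ Uu, subsetP sTG _ Tt).
    by rewrite morphM // mem_mulg ?mem_morphim.
  case/setUP: (subsetP bruhat _ Ga) => [/mulsgP[u t Uu Tt ->]|]; first by left;
    apply: imM.
  case/mulsgP=> _ v /rcosetP[_ /mulsgP[u t Uu Tt ->] ->] Uv ->; right.
  have [Gu Gt] := (subsetP sUG _ Uu, subsetP sTG _ Tt);
    have Gv := subsetP sUG _ Uv.
  by rewrite (morphM f (groupM (groupM Gu Gt) Gw) Gv) (morphM f (groupM Gu Gt)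
    Gw) mem_mulg ?mem_morphim // mem_rcoset mulgK imM.
- by rewrite /= -morphimMl // -morphimJ // -injmI ?conj_subG // UBw1 morphim1.
- have [c [kappa cZ]] := coZ; exists (c \o invm injf), (kappa \o invm injf).
  have := coordinate_morphim sTG sZG (sub1G G) nZT cZ.
  by rewrite (_ : (f @* 1%G)%G = 1%G) //; apply: val_inj; apply: morphim1.
case: coU => [eUZ|[c [kappa cU]]]; first by left; rewrite /= eUZ.
right;
exists (c \o invm injf), (kappa \o invm injf).
exact: coordinate_morphim.
Qed.

End Transport.

(** * Passage from [G] to its group of inner automorphisms *)

Section InnerAutomorphisms.

Variables (p b : nat) (F : finFieldType) (gT : finGroupType).
Variables (G U T Z : {group gT}) (w : gT).
Hypotheses (SR : split_rank1 p F G U T Z w).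
Hypotheses (p_pr : prime p) (p_le3 : p <= 3) (b_gt1 : 1 < b).
Hypotheses (cardF : #|F| = (p ^ b)%N).

(** [#|U|] and the number of points [#|U|.+1] both divide [#|G|]. This is what makes [b] odd. *)
Lemma split_rank1_even : 2 %| #|G|.
Proof.
have nU1 := ntU SR p_pr b_gt1 cardF.
have [_ pdU [n oU]] := pgroup_pdiv (sr_pU SR) nU1.
have dU : #|U| %| #|G| by rewrite cardSg ?(sr_UG SR).
have dU1 : #|U|.+1 %| #|G|.
  rewrite -(card_points (sr_UG SR) (sr_TG SR) (sr_w SR) (sr_nUT SR) (sr_bruhat
    SR) (sr_UBw SR) nU1).
  by rewrite card_conjugates dvdn_indexg.
have [e|o] := boolP (odd #|U|).
  by apply: dvdn_trans dU1; rewrite dvdn2 /= negbK.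
by apply: dvdn_trans dU; rewrite dvdn2.
Qed.

Lemma split_rank1_center : 'Z(G) = 1.
Proof.
exact: (center_triv (sr_UG SR) (sr_TG SR) (sr_w SR) (sr_nUT SR) (sr_nTw SR)
  (sr_bruhat SR)
  (sr_UBw SR) (cent_U_triv SR) (ntU SR p_pr b_gt1 cardF)).
Qed.

Lemma injm_conj_aut : G \subset 'N(G) -> 'injm (restrm (normG G) (conj_aut G)).
Proof.
move=> nGG; rewrite ker_restrm ker_conj_aut; apply/subsetP=> g.
by rewrite -[_ :&: _]/('Z(G)) split_rank1_center.
Qed.

Lemma split_rank1_Inn : exists (U' T' Z' : {group {perm gT}}) w',
  split_rank1 p F (Inn_group G) U' T' Z' w'.
Proof.
have := split_rank1_morphim (injm_conj_aut (normG G)) SR.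
set G' := (_ @* G)%G; have -> : G' = Inn_group G.
  by apply: val_inj; rewrite /= /Inn im_restrm.
by move=> SR'; do 4!eexists; apply: SR'.
Qed.

Lemma Aut_conj_autJ x g : x \in Aut G -> g \in G -> (conj_aut G g) ^ x =
  conj_aut G (x g).
Proof.
move=> Ax Gg; have Gxg : x g \in G by rewrite Aut_closed.
apply/permP=> z; rewrite conjgE !permM.
have [Gz|nGz] := boolP (z \in G).
  have Gxz : x^-1 z \in G by rewrite Aut_closed ?groupV.
  rewrite !conj_autE // -[x (_ ^ _)]/(autm Ax (_ ^ _)) morphJ //=;
    congr (_ ^ _).
  exact: permKV.
(* Automorphisms are permutations of the whole type that fix everything outside [G]. *)
have Aout y : y \in Aut G -> y z = z by move=> Ay; apply: out_Aut Ay nGz.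
by rewrite !Aout ?groupV ?Aut_aut.
Qed.

Lemma norm_Inn x : x \in Aut G -> x \in 'N(Inn G).
Proof.
move=> Ax; rewrite inE; apply/subsetP=> _ /imsetP[_ /morphimP[g nGg Gg ->] ->].
by rewrite Aut_conj_autJ // mem_morphim ?(subsetP (normG G)) ?Aut_closed.
Qed.

Lemma cent_Inn x : x \in Aut G -> x \in 'C(Inn G) -> x = 1.
Proof.
move=> Ax cx; apply/permP=> g; rewrite perm1.
have [Gg|nGg] := boolP (g \in G); last exact: out_Aut Ax nGg.
have Gxg : x g \in G by rewrite Aut_closed.
have Ig : conj_aut G g \in Inn G by rewrite mem_morphim ?(subsetP (normG G)).
have e : conj_aut G (x g) = conj_aut G g.
  by rewrite -Aut_conj_autJ //; apply/eqP; rewrite -cent1_conjE;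
    apply/cent1P/esym/(centP cx _ Ig).
exact: (injmP (injm_conj_aut (normG G))) Gxg Gg e.
Qed.

Theorem split_class_sqr x : x \in Aut G -> #[x] = b -> coprime b #|G| ->
  let L := Inn G <*> <[x]> in
  (x ^: L) * (x ^: L) = x ^+ 2 *: Inn G.
Proof.
move=> Ax ox coG /=; set A := Inn_group G.
have ob : odd b.
  rewrite -coprimen2; apply: coprime_dvdr coG; exact: split_rank1_even.
have oA : #|A| = #|G|.
  have := card_injm (injm_conj_aut (normG G)) (subxx G).
  by rewrite im_restrm.
have nAx : x \in 'N(A) by apply: norm_Inn.
have nAX : <[x]> \subset 'N(A) by rewrite cycle_subG.
have sAL : A \subset A <*> <[x]> by apply: joing_subl.
(* [L] is the product of [<[x]>], which fixes [x], and the inner automorphisms. *)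
have classL : x ^: (A <*> <[x]>) = x ^: A.
  apply/eqP; rewrite eqEsubset andbC (imsetS _ sAL) /=;
    apply/subsetP=> _ /imsetP[l Ll ->].
  move: Ll; rewrite joingC norm_joinEl // => /mulsgP[c a /cycleP[i ->] Aa ->].
  have xx : x ^ (x ^+ i) = x by rewrite conjgE (commuteX i (commute_refl x))
    mulKg.
  by rewrite conjgM xx; apply: imset_f.
rewrite -[Inn G]/(gval A) classL; apply/setP=> y; apply/mulsgP/idP.
  case=> _ _ /imsetP[g Ag ->] /imsetP[h Ah ->] ->.
  have xg : x ^ g \in x *: A by rewrite coset_J ?lcoset_refl.
  have xh : x ^ h \in x *: A by rewrite coset_J ?lcoset_refl.
  move: xg xh => /lcosetP[g' Ag' ->] /lcosetP[h' Ah' ->].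
  have -> : x * g' * (x * h') = x ^+ 2 * (g' ^ x * h').
    by rewrite expgS expg1 conjgE !mulgA mulgK.
  by rewrite mem_lcoset mulKg groupM // memJ_norm.
have [U' [T' [Z' [w' SR']]]] := split_rank1_Inn.
move=> Ay; have [||g Ag [h Ah ->]] := split_coset_sqr SR' p_pr p_le3 ob b_gt1
  cardF nAx ox _ _ Ay.
- by rewrite oA coprime_sym.
- by move=> j; apply: cent_Inn; apply: groupX.
by exists (x ^ g) (x ^ h); rewrite ?imset_f.
Qed.

End InnerAutomorphisms.

(** * The groups PSL(2, q) *)

Section PSL2.

Variables (F : finFieldType).

Let gT : finGroupType := {'GL_2[F]}.

Definition sl2_00 (u : gT) : F := GLval u 0%R 0%R.
Definition sl2_01 (u : gT) : F := GLval u 0%R 1%R.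
Definition sl2_10 (u : gT) : F := GLval u 1%R 0%R.
Definition sl2_11 (u : gT) : F := GLval u 1%R 1%R.

Implicit Types u v z s t : gT.

Lemma GL2_eq u v : sl2_00 u = sl2_00 v -> sl2_01 u = sl2_01 v -> sl2_10 u =
  sl2_10 v -> sl2_11 u = sl2_11 v -> u = v.
Proof.
move=> h00 h01 h10 h11; apply/val_inj/matrixP=> i j.
have two (k : 'I_2) : k = 0%R \/ k = 1%R.
  by case: k => [[|[|k]] hk] //; [left | right]; apply: val_inj.
by case: (two i) => ->; case: (two j) => ->.
Qed.

Lemma sl2_mulE u v :
  ((sl2_00 (u * v)%g = (sl2_00 u * sl2_00 v + sl2_01 u * sl2_10 v)%R) *
   (sl2_01 (u * v)%g = (sl2_00 u * sl2_01 v + sl2_01 u * sl2_11 v)%R) *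
   (sl2_10 (u * v)%g = (sl2_10 u * sl2_00 v + sl2_11 u * sl2_10 v)%R) *
   (sl2_11 (u * v)%g = (sl2_10 u * sl2_01 v + sl2_11 u * sl2_11 v)%R))%type.
Proof.
by do 3?split; rewrite /sl2_00 /sl2_01 /sl2_10 /sl2_11 GL_ME !mxE !big_ord_recl
  big_ord0 addr0;
  congr (_ * _ + _ * _)%R; congr (GLval _ _ _); apply: val_inj.
Qed.

Lemma sl2_oneE : ((sl2_00 1 = 1%R) * (sl2_01 1 = 0%R) * (sl2_10 1 = 0%R) *
  (sl2_11 1 = 1%R))%type.
Proof. by do 3?split; rewrite /sl2_00 /sl2_01 /sl2_10 /sl2_11 GL_1E !mxE. Qed.

Lemma det_mx22 (A : 'M[F]_2) : (\det A = A 0 0 * A 1 1 - A 0 1 * A 1 0)%R.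
Proof.
rewrite (expand_det_row _ 0%R) !big_ord_recl big_ord0 /cofactor !det_mx11 !mxE.
rewrite /= addr0 expr0 expr1 !mul1r mulN1r mulrN.
by congr (A _ _ * A _ _ - A _ _ * A _ _)%R; apply: val_inj.
Qed.

Lemma in_SL u : (u \in SL 2 F) = (sl2_00 u * sl2_11 u - sl2_01 u * sl2_10 u ==
  1)%R.
Proof. by rewrite inE (det_mx22 (GLval u)). Qed.

Lemma exists_SL a b c d : (a * d - b * c = 1)%R ->
  exists2 u : gT, u \in SL 2 F & [/\ sl2_00 u = a, sl2_01 u = b, sl2_10 u = c &
    sl2_11 u = d].
Proof.
move=> det1; pose A : 'M[F]_2 := (\matrix_(i, j) (if i == 0 then if j == 0 then
  a else b
  else if j == 0 then c else d))%R.
have detA : (\det A = 1)%R by rewrite det_mx22 !mxE.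
have uA : A \is a GRing.unit.
  by have : A \in unitmx by rewrite unitmxE detA unitr1.
have e : GLval (FinRing.unit _ uA : gT) = A by [].
exists (FinRing.unit _ uA : gT); first by rewrite inE e detA.
by split; rewrite /sl2_00 /sl2_01 /sl2_10 /sl2_11 e !mxE.
Qed.

Lemma SL_mul u v : u \in SL 2 F -> v \in SL 2 F -> u * v \in SL 2 F.
Proof. exact: groupM. Qed.

Lemma SL_inv u : u \in SL 2 F -> u^-1 \in SL 2 F.
Proof. by rewrite groupV. Qed.

Lemma SL_conj u v : u \in SL 2 F -> v \in SL 2 F -> u ^ v \in SL 2 F.
Proof. by move=> Su Sv; rewrite conjgE !SL_mul ?SL_inv. Qed.

Lemma SL_det u : u \in SL 2 F -> (sl2_00 u * sl2_11 u - sl2_01 u * sl2_10 u =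
  1)%R.
Proof. by rewrite in_SL => /eqP. Qed.

Lemma sl2_invE u : u \in SL 2 F ->
  ((sl2_00 u^-1 = sl2_11 u) * (sl2_01 u^-1 = - sl2_01 u)%R * (sl2_10 u^-1 = -
    sl2_10 u)%R * (sl2_11 u^-1 = sl2_00 u))%type.
Proof.
move=> Su; have d := SL_det Su.
have [v Sv [v00 v01 v10 v11]] : exists2 v, v \in SL 2 F &
    [/\ sl2_00 v = sl2_11 u, sl2_01 v = - sl2_01 u, sl2_10 v = - sl2_10 u &
      sl2_11 v = sl2_00 u]%R.
  by apply: exists_SL; rewrite -d; ring.
have -> : u^-1 = v.
  apply: (mulgI u); rewrite mulgV; apply/esym/GL2_eq;
    rewrite sl2_mulE sl2_oneE ?v00 ?v01 ?v10 ?v11 -?d; ring.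
by rewrite !(v00, v01, v10, v11).
Qed.

Let Z := 'Z(SL 2 F).

Lemma in_centerP u : u \in SL 2 F ->
  reflect [/\ sl2_01 u = 0, sl2_10 u = 0 & sl2_00 u = sl2_11 u]%R (u \in Z).
Proof.
move=> Su; apply: (iffP idP) => [/centerP[_ cu]|[u01 u10 u00]].
  have [s Ss [s00 s01 s10 s11]] := @exists_SL 1%R 0%R 1%R 1%R ltac:(ring).
  have [v Sv [v00 v01 v10 v11]] := @exists_SL 0%R 1%R (-1)%R 0%R ltac:(ring).
  have := congr1 sl2_00 (cu s Ss); have := congr1 sl2_10 (cu s Ss);
    have := congr1 sl2_00 (cu v Sv).
  rewrite !sl2_mulE !(s00, s01, s10, s11, v00, v01, v10, v11) => h1 h2 h3.
  have u01 : sl2_01 u = 0%R by apply: (addrI (sl2_00 u)); move: h3;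
    rewrite !(mulr1, mul1r, mul0r, addr0).
  have u10 : sl2_10 u = 0%R by move: h1; rewrite u01 !(mulr0, mul0r, mul1r,
    add0r) => <-.
  by split=> //; move: h2; rewrite u10 !(mulr0, mul0r, mul1r, add0r, addr0,
    mulr1) => ->.
apply/centerP; split=> // v Sv.
by apply: GL2_eq; rewrite !sl2_mulE ?u01 ?u10 ?u00; ring.
Qed.

Lemma norm_center u : u \in SL 2 F -> u \in 'N(Z).
Proof. by move/(subsetP (normal_norm (center_normal (SL_group 2 F)))). Qed.

Lemma mem_quoZ (A : {set gT}) u : u \in SL 2 F -> u \in A -> coset Z u \in A /
  Z.
Proof. by move=> Su Au; apply: mem_morphim; rewrite ?norm_center. Qed.

Lemma coset_center_eq u v : u \in SL 2 F -> v \in SL 2 F -> coset Z u = coset Z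
  v ->
  exists2 z : gT, z \in Z & u = z * v.
Proof.
move=> Su Sv /(rcoset_kercosetP (norm_center Su) (norm_center Sv)).
by case/rcosetP=> z; exists z.
Qed.

Lemma sl2_diag_neq0 u : u \in SL 2 F -> sl2_01 u = 0%R -> sl2_00 u != 0%R /\
  sl2_11 u != 0%R.
Proof.
move=> /SL_det d u01; move: d; rewrite u01 mul0r subr0 => d; split.
  by apply/eqP=> e; move/eqP: d; rewrite e mul0r eq_sym oner_eq0.
by apply/eqP=> e; move/eqP: d; rewrite e mulr0 eq_sym oner_eq0.
Qed.

Lemma center_SL z : z \in Z -> z \in SL 2 F. Proof. by case/setIP. Qed.

(* These quotients do not change when the representative is multiplied by a
   scalar matrix. *)
Definition psl_c (A : coset_of Z) : F := (sl2_10 (repr A) / sl2_00 (repr A))%R.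
Definition psl_k (A : coset_of Z) : F := (sl2_00 (repr A) / sl2_11 (repr A))%R.

Lemma repr_coset_center u : u \in SL 2 F ->
  exists2 z : gT, z \in Z & repr (coset Z u) = z * u.
Proof.
move=> Su; have nu := norm_center Su.
have := mem_repr_coset (coset Z u); rewrite val_coset // => /rcosetP[z Zz ->].
by exists z.
Qed.

Lemma psl_cE u : u \in SL 2 F -> psl_c (coset Z u) = (sl2_10 u / sl2_00 u)%R.
Proof.
move=> Su; rewrite /psl_c; have [z Zz ->] := repr_coset_center Su.
have Sz := center_SL Zz; have /(in_centerP Sz)[z01 z10 z00] := Zz.
have [_ z11] := sl2_diag_neq0 Sz z01.
by rewrite !sl2_mulE z01 z10 z00 !mul0r add0r addr0 -mulf_div divff ?mul1r.
Qed.

Lemma psl_kE u : u \in SL 2 F -> sl2_01 u = 0%R -> psl_k (coset Z u) = (sl2_00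
  u / sl2_11 u)%R.
Proof.
move=> Su u01; rewrite /psl_k; have [z Zz ->] := repr_coset_center Su.
have Sz := center_SL Zz; have /(in_centerP Sz)[z01 z10 z00] := Zz.
have [_ z11] := sl2_diag_neq0 Sz z01.
by rewrite !sl2_mulE z01 z10 z00 u01 !mul0r add0r addr0 -mulf_div divff ?mul1r.
Qed.

Definition psl_U := [set u : gT in SL 2 F | [&& sl2_00 u == 1%R, sl2_01 u ==
  0%R & sl2_11 u == 1%R]].
Definition psl_T := [set u : gT in SL 2 F | (sl2_01 u == 0%R) && (sl2_10 u ==
  0%R)].

Lemma psl_UP u : reflect (u \in SL 2 F /\ [/\ sl2_00 u = 1, sl2_01 u = 0 &
  sl2_11 u = 1]%R) (u \in psl_U).
Proof.
apply: (iffP setIdP) => -[Su]; first by case/and3P=> /eqP-> /eqP-> /eqP->.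
by case=> -> -> ->; rewrite !eqxx.
Qed.

Lemma psl_TP u : reflect (u \in SL 2 F /\ [/\ sl2_01 u = 0 & sl2_10 u = 0]%R)
  (u \in psl_T).
Proof.
apply: (iffP setIdP) => -[Su]; first by case/andP=> /eqP-> /eqP->.
by case=> -> ->; rewrite !eqxx.
Qed.

Lemma psl_U_group_set : group_set psl_U.
Proof.
apply/group_setP; split; first by apply/psl_UP; rewrite group1 !sl2_oneE.
move=> u v /psl_UP[Su [u00 u01 u11]] /psl_UP[Sv [v00 v01 v11]].
apply/psl_UP; rewrite SL_mul // !sl2_mulE !(u00, u01, u11, v00, v01, v11).
by split=> //; split; ring.
Qed.
Canonical psl_U_group := Group psl_U_group_set.

Lemma psl_T_group_set : group_set psl_T.
Proof.
apply/group_setP; split; first by apply/psl_TP; rewrite group1 !sl2_oneE.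
move=> u v /psl_TP[Su [u01 u10]] /psl_TP[Sv [v01 v10]].
apply/psl_TP; rewrite SL_mul // !sl2_mulE !(u01, u10, v01, v10).
by split=> //; split; ring.
Qed.
Canonical psl_T_group := Group psl_T_group_set.

Lemma psl_U_X u n : u \in psl_U -> u ^+ n \in psl_U.
Proof. exact: groupX. Qed.

Lemma psl_U_sub : psl_U \subset SL 2 F. Proof. by apply/subsetP=> u /psl_UP[].
  Qed.
Lemma psl_T_sub : psl_T \subset SL 2 F. Proof. by apply/subsetP=> u /psl_TP[].
  Qed.

Lemma psl_T_det t : t \in psl_T -> (sl2_00 t * sl2_11 t = 1)%R.
Proof. by case/psl_TP=> St [t01 _]; have := SL_det St;
  rewrite t01 mul0r subr0. Qed.

Lemma psl_low u : u \in SL 2 F -> sl2_01 u = 0%R -> u \in psl_U * psl_T.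
Proof.
move=> Su u01; have d := SL_det Su; rewrite u01 mul0r subr0 in d.
have [n00 n11] := sl2_diag_neq0 Su u01.
have [t St [t00 t01 t10 t11]] := @exists_SL (sl2_00 u) 0%R 0%R (sl2_11 u)
  ltac:(by rewrite d mul0r subr0).
have Tt : t \in psl_T by apply/psl_TP.
rewrite -(mulgKV t u) mem_mulg //; apply/psl_UP; split;
  first by rewrite SL_mul ?SL_inv.
by rewrite !sl2_mulE !(sl2_invE St) t00 t01 t10 t11 u01 d; split; ring: d.
Qed.

Lemma psl_low_sub u : u \in psl_U * psl_T -> u \in SL 2 F /\ sl2_01 u = 0%R.
Proof.
case/mulsgP=> v t /psl_UP[Sv [v00 v01 v11]] /psl_TP[St [t01 t10]] ->.
by rewrite SL_mul // !sl2_mulE v01 t01; split=> //; ring.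
Qed.

(** Conjugation by the diagonal matrix of [k] and [k^-1] multiplies the lower left entry by
    [k ^+ 2]. Two diagonal matrices with the same multiplier differ by a scalar, which gives
    [mult_inj] modulo the centre. *)
Lemma psl_coordinate :
  coordinate (psl_T_group / Z)%G (psl_U_group / Z)%G 1%G psl_c psl_k.
Proof.
have im (A : {set gT}) x : x \in A / Z -> exists2 u, u \in A & x = coset Z u.
  by case/morphimP=> u _ Au ->; exists u.
have cU u : u \in psl_U -> psl_c (coset Z u) = sl2_10 u.
  by case/psl_UP=> Su [u00 _ _]; rewrite psl_cE // u00 divr1.
have kT t : t \in psl_T -> psl_k (coset Z t) = (sl2_00 t ^+ 2)%R.
  move=> Tt; have d := psl_T_det Tt; case/psl_TP: Tt => St [t01 _].
  have [_ n11] := sl2_diag_neq0 St t01.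
  by rewrite psl_kE //; apply: (mulIf n11);
    rewrite divfK // expr2 -mulrA d mulr1.
split.
- move=> _ _ /im[u Uu ->] /im[v Uv ->].
  have [Su [u00 u01 u11]] := psl_UP u Uu; have [Sv [v00 v01 v11]] := psl_UP v
    Uv.
  rewrite -morphM ?norm_center // !cU ?(@groupM _ psl_U_group) //.
  by rewrite sl2_mulE v00 u11 mulr1 mul1r.
- move=> _ /im[u Uu ->]; have [Su [u00 u01 u11]] := psl_UP u Uu.
  rewrite cU //; apply/eqP/set1gP=> [u10|u1].
    by rewrite (_ : u = 1) ?morph1 //; apply: GL2_eq; rewrite sl2_oneE.
  have := coset_idr (norm_center Su) u1; by case/(in_centerP Su).
- move=> a; have [u Su [u00 u01 u10 u11]] := @exists_SL 1%R 0%R a 1%R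
  ltac:(ring).
  have Uu : u \in psl_U by apply/psl_UP.
  by exists (coset Z u); rewrite ?cU // mem_quotient.
- move=> _ _ /im[u Uu ->] /im[t Tt ->].
  have [Su [u00 u01 u11]] := psl_UP u Uu; have [St [t01 t10]] := psl_TP t Tt.
  have d := psl_T_det Tt; have Sut := SL_conj Su St.
  rewrite -morphJ ?norm_center // kT // cU // psl_cE //.
  rewrite conjgE !sl2_mulE !(sl2_invE St) t01 t10 u00 u01 u11.
  rewrite !(mulr0, mul0r, oppr0, addr0, add0r, mul1r, mulr1).
  have -> : (sl2_11 t * sl2_00 t = 1)%R by rewrite mulrC.
  by rewrite divr1; ring.
- move=> _ /im[t Tt ->]; exists (sl2_00 t); last exact: kT.
  by have [St [t01 _]] := psl_TP t Tt; case: (sl2_diag_neq0 St t01).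
- move=> k k0; have [t St [t00 t01 t10 t11]] := @exists_SL k 0%R 0%R k^-1%R
  ltac:(by rewrite mulfV // mul0r subr0).
  have Tt : t \in psl_T by apply/psl_TP.
  by exists (coset Z t); rewrite ?kT ?t00 // mem_quotient.
move=> _ _ /im[s Ts ->] /im[t Tt ->]; rewrite !kT // => e.
have ds := psl_T_det Ts; have dt := psl_T_det Tt.
have [[Ss [s01 s10]] [St [t01 t10]]] := (psl_TP s Ts, psl_TP t Tt).
have Sst := SL_mul Ss (SL_inv St).
apply/(rcoset_kercosetP (norm_center Ss) (norm_center St)).
rewrite mem_rcoset; apply/(in_centerP Sst);
  rewrite !sl2_mulE !(sl2_invE St) s01 s10 t01 t10.
split; try ring.
have [[n1 n2] [n3 n4]] := (sl2_diag_neq0 Ss s01, sl2_diag_neq0 St t01).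
rewrite !mul0r addr0 add0r.
have -> : sl2_11 t = ((sl2_00 t)^-1)%R by apply: (mulfI n3); rewrite dt mulfV.
have -> : sl2_11 s = ((sl2_00 s)^-1)%R by apply: (mulfI n1); rewrite ds mulfV.
apply: (mulIf n3); rewrite divfK // mulrAC -mulrA -expr2 -e expr2 mulKf //.
Qed.

Lemma PSL2_split_rank1 p b : prime p -> #|F| = (p ^ b)%N ->
  exists (U T W : {group coset_of Z}) w, split_rank1 p F (PSL_group 2 F) U T W
    w.
Proof.
move=> p_pr cardF; have chF : (p \in [pchar F])%R by apply: (card_finPcharP
  cardF).
have [w Sw [w00 w01 w10 w11]] := @exists_SL 0%R 1%R (-1)%R 0%R ltac:(ring).
have nSU : psl_U \subset 'N(Z) by apply/subsetP=> u /psl_UP[/norm_center].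
have nST : psl_T \subset 'N(Z) by apply/subsetP=> u /psl_TP[/norm_center].
have nw := norm_center Sw.
have im (A : {set gT}) x : x \in A / Z -> exists2 u, u \in A & x = coset Z u.
  by case/morphimP=> u _ Au ->; exists u.
have abU : abelian psl_U.
  apply/centsP=> u /psl_UP[Su [u00 u01 u11]] v /psl_UP[Sv [v00 v01 v11]].
  by apply: GL2_eq; rewrite !sl2_mulE !(u00, u01, u11, v00, v01, v11); ring.
have e10X u n : u \in psl_U -> sl2_10 (u ^+ n) = (sl2_10 u *+ n)%R.
  move=> Uu; elim: n => [|n IHn]; first by rewrite sl2_oneE.
  have [_ [u00 u01 u11]] := psl_UP u Uu.
  have [_ [n00 _ _]] := psl_UP _ (psl_U_X n Uu).
  by rewrite expgS sl2_mulE IHn u11 n00 mulr1 mul1r mulrS.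
have Up u : u \in psl_U -> u ^+ p = 1.
  move=> Uu; have [_ [n00 n01 n11]] := psl_UP _ (psl_U_X p Uu).
  by apply: GL2_eq; rewrite sl2_oneE // e10X // -mulr_natr (pcharf0 chF) mulr0.
have nUT : psl_T \subset 'N(psl_U).
  apply/subsetP=> t Tt; rewrite inE; apply/subsetP=> _ /imsetP[u /psl_UP[Su
    [u00 u01 u11]] ->].
  have [St [t01 t10]] := psl_TP t Tt; have d := psl_T_det Tt.
  apply/psl_UP; rewrite SL_conj // conjgE !sl2_mulE !(sl2_invE St) t01 t10 u00
    u01 u11.
  by rewrite -{1}d -{7}d; split=> //; split; ring: d.
exists (psl_U_group / Z)%G, (psl_T_group / Z)%G, (psl_U_group / Z)%G, (coset Z
  w).
split.
- exact: quotientS psl_U_sub.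
- exact: quotientS psl_T_sub.
- exact: mem_quotient.
- apply: quotient_pgroup; apply/pgroupP=> q q_pr /Cauchy[] // u Uu oq.
  by rewrite inE /= -(dvdn_prime2 q_pr p_pr) -oq order_dvdn Up.
- exact: quotient_norms.
- apply/setP=> x; rewrite [RHS]inE; apply/idP/andP=> [Ux|[]//]; split=> //.
  by case/im: Ux => u Uu ->; rewrite -morphX ?(subsetP nSU) // Up // morph1.
- exact: quotient_abelian.
- rewrite inE; apply/subsetP=> _ /imsetP[_ /im[t Tt ->] ->].
  have [St [t01 t10]] := psl_TP t Tt.
  rewrite -morphJ ?norm_center //; apply: mem_quotient; apply/psl_TP.
  by rewrite SL_conj // conjgE !sl2_mulE !(sl2_invE Sw) !(w00, w01, w10, w11)
    t01 t10; split=> //; split; ring.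
- apply/subsetP=> _ /im[u Su ->]; rewrite /= -!quotientMl // in_setU.
  have [u01|n01] := eqVneq (sl2_01 u) 0%R.
    by apply/orP; left; apply: mem_quoZ => //; apply: psl_low.
  apply/orP; right.
  (* [v] makes the upper left entry of [u * v^-1] vanish; [w^-1] moves this zero to the upper right
     corner. *)
  have [v Sv [v00 v01 v10 v11]] := @exists_SL 1%R 0%R (sl2_00 u / sl2_01 u)%R
    1%R ltac:(ring).
  have Uv : v \in psl_U by apply/psl_UP.
  have [c [Sc Lc ->]] : exists c, [/\ c \in SL 2 F, c \in psl_U * psl_T & u = c
    * w * v].
    exists (u * v^-1 * w^-1); have Sc : u * v^-1 * w^-1 \in SL 2 F by rewrite
      !SL_mul ?SL_inv.
    split=> //; last by rewrite !mulgKV.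
    apply: psl_low => //; rewrite !sl2_mulE !(sl2_invE Sw) !(sl2_invE Sv).
    by rewrite !(w00, w01, w10, w11, v00, v01, v10, v11); field.
  rewrite !morphM ?norm_center ?SL_mul // mem_mulg ?mem_quoZ //.
  by rewrite mem_rcoset mulgK; apply: mem_quoZ.
- apply/eqP; rewrite eqEsubset; apply/andP; split; last first.
    by rewrite sub1set in_setI group1 mem_conjg conj1g -(mulg1 1) mem_mulg
      ?group1.
  apply/subsetP=> x /setIP[/im[u Uu ->]].
  rewrite /= -quotientMl // mem_conjg => /im[c /psl_low_sub[Sc c01]] e.
  have [Su [u00 u01 u11]] := psl_UP u Uu.
  (* Conjugation by [w] makes [c] upper triangular, so up to a scalar [u] is both upper and lower
     triangular. *)
  have [||z Zz eu] := @coset_center_eq u (c ^ w) Su.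
  - exact: SL_conj.
  - by rewrite morphJ ?norm_center //= -e conjgKV.
  have [z01 z10 z00] := in_centerP (center_SL Zz) Zz.
  have u10 : sl2_10 u = 0%R.
    by rewrite eu conjgE !sl2_mulE !(sl2_invE Sw) !(w00, w01, w10, w11, z01,
      z10, c01); ring.
  by rewrite (_ : u = 1) ?morph1 ?group1 //; apply: GL2_eq; rewrite sl2_oneE.
- by exists psl_c, psl_k; apply: psl_coordinate.
by left.
Qed.

End PSL2.

(** * The Suzuki groups *)

Section Suzuki.

Variables (F : finFieldType) (b : nat).
Hypotheses (cardF : #|F| = (2 ^ b)%N) (ob : odd b).

Let gT : finGroupType := {'GL_4[F]}.
Local Notation t := (@sz_theta F).

Section Theta.

Local Open Scope ring_scope.

Lemma sz_pchar : 2 \in [pchar F]. Proof. exact: card_finPcharP cardF _. Qed.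

Lemma sz_addrr (a : F) : a + a = 0. Proof. exact: (addrr_pchar2 sz_pchar). Qed.

Lemma sz_oppr (a : F) : - a = a. Proof. exact: (oppr_pchar2 sz_pchar). Qed.

Lemma sz_thetaD : {morph t : a c / a + c}.
Proof.
move=> a c; rewrite /sz_theta exprDn_pchar //.
by rewrite pnatX pnatE // sz_pchar.
Qed.

Lemma sz_thetaM : {morph t : a c / a * c}.
Proof. by move=> a c; rewrite /sz_theta exprMn. Qed.

Lemma sz_theta1 : t 1 = 1. Proof. by rewrite /sz_theta expr1n. Qed.

Lemma sz_theta0 : t 0 = 0. Proof. by rewrite /sz_theta expr0n expn_eq0. Qed.

Lemma sz_theta_eq0 a : (t a == 0) = (a == 0).
Proof. by rewrite /sz_theta expf_eq0 expn_gt0. Qed.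

Lemma sz_thetaV a : t a^-1 = (t a)^-1. Proof. by rewrite /sz_theta exprVn. Qed.

Lemma sz_thetaX a n : t (a ^+ n) = t a ^+ n.
Proof. by rewrite /sz_theta -!exprM mulnC. Qed.

Lemma sz_thetaKE a : t (t a) = a ^+ 2. Proof. exact: sz_thetaK cardF ob. Qed.

(* Polynomial identities in characteristic 2 are deduced by ring from integral
   ones, in which the even defect z + z is explicit. *)
Lemma sz_eqD (z x y : F) : y = x + (z + z) -> x = y.
Proof. by move->; rewrite sz_addrr addr0. Qed.

End Theta.

(* Junk value 1 on singular matrices. *)
Definition sz_elt (A : 'M[F]_4) : gT := insubd (1 : gT) A.

Lemma sz_eltK A : A \in unitmx -> GLval (sz_elt A) = A.
Proof. by move=> uA; apply: insubdK. Qed.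

Definition sS (a c : F) := sz_elt (szS a c).
Definition sM (k : F) := sz_elt (szM k).
Definition sT := sz_elt (szT F).

Lemma sSE a c : GLval (sS a c) = szS a c. Proof. exact: sz_eltK (szS_unit _ _).
  Qed.
Lemma sME k : k != 0%R -> GLval (sM k) = szM k.
Proof. by move=> k0; apply: sz_eltK (szM_unit _). Qed.
Lemma sTE : GLval sT = szT F. Proof. exact: sz_eltK (szT_unit _). Qed.

Lemma sz_inj (u v : gT) : GLval u = GLval v -> u = v. Proof. exact: val_inj.
  Qed.

Lemma sS_mul a c a' c' : sS a c * sS a' c' = sS (a + a')%R (c + c' + t a *
  a')%R.
Proof.
apply: sz_inj; rewrite [LHS]GL_ME !sSE.
apply/matrixP=> -[[|[|[|[|//]]]] ?] [[|[|[|[|//]]]] ?];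
  rewrite !mxE !big_ord_recl !big_ord0 !mxE /= ?(sz_thetaD, sz_thetaM,
    sz_thetaKE); try by ring.
  by apply: (@sz_eqD (a * a' * t a + a' ^+ 2 * t a + a ^+ 2 * t a' + a * a' * t
    a')%R); ring.
by apply: (@sz_eqD (a' * t a)%R); ring.
Qed.

Lemma sM_mul k l : k != 0%R -> l != 0%R -> sM k * sM l = sM (k * l)%R.
Proof.
move=> k0 l0; apply: sz_inj; rewrite [LHS]GL_ME !sME ?mulf_neq0 //.
have [tk tl] : (t k != 0 /\ t l != 0)%R by rewrite !sz_theta_eq0.
apply/matrixP=> -[[|[|[|[|//]]]] ?] [[|[|[|[|//]]]] ?];
  rewrite !mxE !big_ord_recl !big_ord0 !mxE /= ?(sz_thetaM, sz_thetaKE);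
    by field; rewrite ?k0 ?l0 ?tk ?tl.
Qed.

Lemma sS0 : sS 0%R 0%R = 1.
Proof.
apply: sz_inj; rewrite sSE GL_1E.
apply/matrixP=> -[[|[|[|[|//]]]] ?] [[|[|[|[|//]]]] ?];
  rewrite !mxE /= ?sz_theta0; ring.
Qed.

Lemma sM1 : sM 1%R = 1.
Proof.
apply: sz_inj; rewrite sME ?oner_eq0 // GL_1E.
by apply/matrixP=> -[[|[|[|[|//]]]] ?] [[|[|[|[|//]]]] ?];
  rewrite !mxE /= ?sz_theta1 ?invr1 ?mulr1 ?invr1.
Qed.

Lemma sT_mul : sT * sT = 1.
Proof.
apply: sz_inj; rewrite [LHS]GL_ME !sTE GL_1E.
by apply/matrixP=> -[[|[|[|[|//]]]] ?] [[|[|[|[|//]]]] ?];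
  rewrite !mxE !big_ord_recl !big_ord0 !mxE /=; ring.
Qed.

Lemma sS_sM a c k : k != 0%R -> sS a c * sM k = sM k * sS (t k * a)%R (k ^+ 2 *
  t k * c)%R.
Proof.
move=> k0; have tk : (t k != 0)%R by rewrite sz_theta_eq0.
apply: sz_inj; rewrite [LHS]GL_ME [RHS]GL_ME !sSE sME //.
apply/matrixP=> -[[|[|[|[|//]]]] ?] [[|[|[|[|//]]]] ?];
  rewrite !mxE !big_ord_recl !big_ord0 !mxE /= ?(sz_thetaM, sz_thetaKE,
    sz_thetaX); by field; rewrite ?k0 ?tk.
Qed.

Lemma sT_sM k : k != 0%R -> sT * sM k = sM k^-1%R * sT.
Proof.
move=> k0; have tk : (t k != 0)%R by rewrite sz_theta_eq0.
apply: sz_inj; rewrite [LHS]GL_ME [RHS]GL_ME sTE !sME ?invr_eq0 //.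
apply/matrixP=> -[[|[|[|[|//]]]] ?] [[|[|[|[|//]]]] ?];
  rewrite !mxE !big_ord_recl !big_ord0 !mxE /= ?sz_thetaV ?invfM ?invrK;
    by field; rewrite ?k0 ?tk.
Qed.

(* Comparing the last columns (resp. rows) of the two sides of sz_bruhat forces
   the parameters: n is the norm form of (a, c), and d = sz_theta n. *)
Section BruhatIdentity.

Local Open Scope ring_scope.

Variables (a c : F).
Let A := t a.
Let C := t c.
Let h := a * A + c.
Let e := a ^+ 2 * A + C.
Let n := a * h + C.
Let d := A * e + c ^+ 2.

Lemma sz_theta_norm : t n = d.
Proof.
rewrite /n /d /e /h /A /C !(sz_thetaD, sz_thetaM, sz_thetaKE); ring.
Qed.

Lemma sz_norm1 : c * h + A * n = d.
Proof. by apply/esym/(@sz_eqD (a * A * c)); rewrite /d /e /n /h; ring. Qed.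

Lemma sz_norm2 : h * e + a * d = c * n.
Proof. by apply/esym/(@sz_eqD (a ^+ 3 * A ^+ 2 + a * A * C));
  rewrite /d /e /n /h; ring. Qed.

Lemma sz_norm4 : c * C + a * d = h * n.
Proof. by apply/(@sz_eqD (a ^+ 2 * A * c)); rewrite /d /e /n /h; ring. Qed.

Lemma sz_norm3 : a * h + n = C.
Proof. by apply/esym/(@sz_eqD (a * h)); rewrite /n; ring. Qed.

Lemma sz_theta_h : t h = e.
Proof. by rewrite /h /A sz_thetaD sz_thetaM sz_thetaKE /e /C /A; ring. Qed.

Hypothesis n0 : n != 0.

Let d0 : d != 0. Proof. by rewrite -sz_theta_norm sz_theta_eq0. Qed.

(** The first factor is the matrix of [sT * sS a c * sT]. The second is chosen to clear the entries
    above the antidiagonal; reversing the columns, that is multiplying by [szT F], then leaves a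
    lower triangular matrix. *)
Lemma sz_bruhat_mx :
  (mx4 [:: [:: 1; a; h; n]; [:: 0; 1; A; c]; [:: 0; 0; 1; a]; [:: 0; 0; 0; 1]]
    *m szS (h / n) (a / n) =
  mx4 [:: [:: 0; 0; 0; n]; [:: 0; 0; d / n; c]; [:: 0; n / d; C / n; a];
    [:: n^-1; c / d; h / n; 1]])%R.
Proof.
have [r1 r2 r3] : [/\ c * h + A * n = d, h * e + a * d = c * n & a * h + n = C].
  by split; [apply: sz_norm1 | apply: sz_norm2 | apply: sz_norm3].
have [r4 r5 r6] : [/\ h = a * A + c, d = A * e + c ^+ 2 & n = e + a * c].
  by split=> //; rewrite /n /e /h; ring.
have thn : t (h / n) = e / d by rewrite sz_thetaM sz_thetaV sz_theta_h
  sz_theta_norm.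
have tan : t (a / n) = A / d by rewrite sz_thetaM sz_thetaV sz_theta_norm.
have addn x : x + x = 0 := sz_addrr x.
move: r1 r2 r3 r4 r5 r6 (d0) (n0) thn tan.
(* Only [r1] to [r6] and the two values of theta matter from here on, so the forms become free
   variables for [field]. *)
move: (n) (d) (h) (e) (A) (C) => n' d' h' e' A' C' r1 r2 r3 r4 r5 r6 d0' n0'
  thn tan.
have w1 : h' / n' * (e' / d') + a / n' = c / d'.
  transitivity ((h' * e' + a * d') / (n' * d')); first by field;
    rewrite n0' d0'.
  by rewrite r2; field; rewrite n0' d0'.
have w2 : (h' / n') ^+ 2 * (e' / d') + h' / n' * (a / n') + A' / d' = n'^-1.
  transitivity ((h' * (h' * e' + a * d') + A' * n' ^+ 2) / (n' ^+ 2 * d'));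
    first by field; rewrite n0' d0'.
  rewrite r2 (_ : h' * (c * n') + A' * n' ^+ 2 = n' * (c * h' + A' * n'));
    last by ring.
  by rewrite r1; field; rewrite n0' d0'.
apply/matrixP=> -[[|[|[|[|//]]]] ?] [[|[|[|[|//]]]] ?];
  rewrite !mxE !big_ord_recl !big_ord0 !mxE /= ?thn ?tan ?w1 ?w2; try by field;
    rewrite ?n0' ?d0'.
- by rewrite -[RHS](addn (1 + a * h' / n')); field.
- transitivity ((h' * e' + a * d' + c * n') / d'); first by field.
  by rewrite r2 addn mul0r.
- by rewrite -[RHS](addn h'); field.
- transitivity ((h' + (a * A' + c)) / n'); first by field.
  by rewrite -r4 addn mul0r.
- transitivity ((d' + (A' * e' + c ^+ 2)) / d'); first by field.
  by rewrite -r5 addn mul0r.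
- by rewrite -r1; field.
- by rewrite -[RHS](addn (a / n')); field.
- by rewrite r6; field.
- by rewrite -r3; field.
Qed.

Lemma sz_bruhat_low :
  szS (c / n) (a / n) *m szM (d / n) =
  mx4 [:: [:: n; 0; 0; 0]; [:: c; d / n; 0; 0]; [:: a; C / n; n / d; 0]; [:: 1;
    h / n; c / d; n^-1]].
Proof.
have r1 : c * h + A * n = d := sz_norm1; have r2 : c * C + a * d = h * n :=
  sz_norm4.
have tcn : t (c / n) = C / d by rewrite sz_thetaM sz_thetaV sz_theta_norm.
have tan : t (a / n) = A / d by rewrite sz_thetaM sz_thetaV sz_theta_norm.
have tk : t (d / n) = n ^+ 2 / d.
  by rewrite sz_thetaM sz_thetaV -{1}sz_theta_norm sz_thetaKE sz_theta_norm.
move: r1 r2 (d0) (n0) tcn tan tk.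
move: (n) (d) (h) (A) (C) => n' d' h' A' C' r1 r2 d0' n0' tcn tan tk.
apply/matrixP=> -[[|[|[|[|//]]]] ?] [[|[|[|[|//]]]] ?];
  rewrite !mxE !big_ord_recl !big_ord0 !mxE /= ?tcn ?tan ?tk; try by field;
    rewrite ?n0' ?d0'.
  transitivity ((c * (c * C' + a * d') + A' * n' ^+ 2) / (n' * d'));
    first by field; rewrite ?n0' ?d0'.
  rewrite r2 (_ : c * (h' * n') + A' * n' ^+ 2 = n' * (c * h' + A' * n'));
    last by ring.
  by rewrite r1; field; rewrite n0' d0'.
transitivity ((c * C' + a * d') / (n' ^+ 2)); first by field; rewrite ?n0' ?d0'.
by rewrite r2; field.
Qed.

Lemma sz_bruhat : (sT * sS a c * sT * sS (h / n)%R (a / n)%R =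
  sS (c / n)%R (a / n)%R * sM (d / n)%R * sT)%g.
Proof.
have k0 : d / n != 0 by rewrite mulf_neq0 ?invr_eq0.
apply: sz_inj; rewrite [LHS]GL_ME [RHS]GL_ME [GLval (sS _ _ * _)%g]GL_ME sME //
  !sSE.
have -> : GLval (sT * sS a c * sT)%g =
    mx4 [:: [:: 1; a; h; n]; [:: 0; 1; A; c]; [:: 0; 0; 1; a]; [:: 0; 0; 0; 1]].
  have TS : szT F *m szS a c =
      mx4 [:: [:: n; h; a; 1]; [:: c; A; 1; 0]; [:: a; 1; 0; 0]; [:: 1; 0; 0;
        0]].
    by apply/matrixP=> -[[|[|[|[|//]]]] ?] [[|[|[|[|//]]]] ?];
      rewrite !mxE !big_ord_recl !big_ord0 !mxE /= /n /h /A /C; ring.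
  rewrite [LHS]GL_ME [GLval (sT * _)%g]GL_ME sSE !sTE.
  rewrite -[X in X * _]/(szT F *m szS a c) TS.
  by apply/matrixP=> -[[|[|[|[|//]]]] ?] [[|[|[|[|//]]]] ?];
    rewrite !mxE !big_ord_recl !big_ord0 !mxE /=; ring.
rewrite sTE -[X in _ = X * _]/(szS (c / n) (a / n) *m szM (d / n))
  sz_bruhat_low.
rewrite -[LHS]/(_ *m _) sz_bruhat_mx.
by apply/matrixP=> -[[|[|[|[|//]]]] ?] [[|[|[|[|//]]]] ?];
  rewrite !mxE !big_ord_recl !big_ord0 !mxE /=; ring.
Qed.

End BruhatIdentity.

(** If the norm [n] vanishes, so does [d], its image under theta; the relations then read
    [c * h = 0] and [a * h = t c], whence [c = 0] and [a = 0]. *)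
Lemma sz_norm_neq0 a c : (a != 0%R) || (c != 0%R) -> (a * (a * t a + c) + t c
  != 0)%R.
Proof.
move=> nac; apply/eqP=> n0; have := sz_theta_norm a c; have := sz_norm1 a c;
  have := sz_norm3 a c.
rewrite n0 sz_theta0 mulr0 !addr0 => r3 r1 r0; rewrite -r0 in r1.
have c0 : c = 0%R.
  move/eqP: r1; rewrite mulf_eq0 => /orP[/eqP//|/eqP h0].
  by apply/eqP; rewrite -sz_theta_eq0 -r3 h0 mulr0.
move: r3 nac; rewrite c0 sz_theta0 addr0 eqxx orbF => /eqP.
by rewrite !mulf_eq0 sz_theta_eq0 !orbb => ->.
Qed.

(** * Subgroups and coordinates of the Suzuki group *)

Definition sz_U : {set gT} := [set sS x.1 x.2 | x : F * F].
Definition sz_Z : {set gT} := [set sS 0%R c | c : F].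
Definition sz_T : {set gT} := [set sM k | k : F & k != 0%R].

Lemma sz_UP u : reflect (exists a c, u = sS a c) (u \in sz_U).
Proof.
apply: (iffP imsetP) => [[[a c] _ ->]|[a [c ->]]]; first by exists a, c.
by exists (a, c).
Qed.

Lemma sz_TP u : reflect (exists2 k, k != 0%R & u = sM k) (u \in sz_T).
Proof.
by apply: (iffP imsetP) => -[k k0 ->]; exists k; move: k0; rewrite ?inE.
Qed.

Lemma sz_U_group_set : group_set sz_U.
Proof.
apply/group_setP; split=> [|_ _ /sz_UP[a [c ->]] /sz_UP[a' [c' ->]]].
  by apply/sz_UP; exists 0%R, 0%R; rewrite sS0.
by apply/sz_UP; rewrite sS_mul; do 2!eexists.
Qed.
Definition sz_U_group := Group sz_U_group_set.

Lemma sz_T_group_set : group_set sz_T.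
Proof.
apply/group_setP; split=> [|_ _ /sz_TP[k k0 ->] /sz_TP[l l0 ->]].
  by apply/sz_TP; exists 1%R; rewrite ?oner_eq0 ?sM1.
by apply/sz_TP; rewrite sM_mul //; exists (k * l)%R; rewrite ?mulf_neq0.
Qed.
Definition sz_T_group := Group sz_T_group_set.

Lemma sz_Z_group_set : group_set sz_Z.
Proof.
apply/group_setP; split=> [|_ _ /imsetP[c _ ->] /imsetP[c' _ ->]].
  by apply/imsetP; exists 0%R; rewrite ?sS0.
by apply/imsetP; exists (c + c')%R; rewrite // sS_mul sz_theta0 mul0r !addr0.
Qed.
Definition sz_Z_group := Group sz_Z_group_set.

Definition sz_ca (u : gT) : F := GLval u 1%R 0%R.
Definition sz_cc (u : gT) : F := GLval u (inord 2) 0%R.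
Definition sz_km (u : gT) : F := GLval u 1%R 1%R.

Lemma sz_caE a c : sz_ca (sS a c) = a.
Proof. by rewrite /sz_ca sSE mxE. Qed.

Lemma sz_ccE a c : sz_cc (sS a c) = c.
Proof. by rewrite /sz_cc sSE mxE inordK. Qed.

Lemma sz_kmE k : k != 0%R -> sz_km (sM k) = k.
Proof. by move=> k0; rewrite /sz_km sME // mxE. Qed.

Lemma sS_J a c k : k != 0%R -> sS a c ^ sM k = sS (t k * a)%R (k ^+ 2 * t k *
  c)%R.
Proof. by move=> k0; rewrite conjgE sS_sM // mulKg. Qed.

Lemma sz_square (a : F) : a != 0%R -> exists2 k : F, k != 0%R & a = (k ^+ 2)%R.
Proof.
move=> a0; have [k [l e]] := diff_of_squares a.
have ekl : a = ((k + l) ^+ 2)%R.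
  by rewrite e; apply: (@sz_eqD (k * l + l ^+ 2)%R); ring.
by exists (k + l)%R => //; apply: contraNneq a0 => kl0; rewrite ekl kl0 expr0n.
Qed.

Lemma sz_coordinate_Z : coordinate sz_T_group sz_Z_group 1%G sz_cc
  (fun u => (sz_km u ^+ 2 * t (sz_km u))%R).
Proof.
split.
- move=> _ _ /imsetP[c _ ->] /imsetP[c' _ ->].
  by rewrite sS_mul sz_theta0 mul0r addr0 !sz_ccE addr0.
- move=> _ /imsetP[c _ ->]; rewrite sz_ccE; apply/eqP/set1gP=> [->|];
  first exact: sS0.
  by rewrite -sS0 => /(congr1 sz_cc); rewrite !sz_ccE.
- by move=> c; exists (sS 0%R c); [apply: imset_f | apply: sz_ccE].
- move=> _ _ /imsetP[c _ ->] /sz_TP[k k0 ->].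
  by rewrite sS_J // !sz_ccE sz_kmE.
- move=> _ /sz_TP[k k0 ->]; apply: sz_square.
  by rewrite sz_kmE // mulf_neq0 ?expf_neq0 ?sz_theta_eq0.
- move=> k k0; have tk0 : (t k != 0)%R by rewrite sz_theta_eq0.
  (* This is the solution [l] of [l ^+ 2 * t l = k ^+ 2], because [t (t k) = k ^+ 2]. *)
  have l0 : (k ^+ 2 / t k != 0)%R by rewrite mulf_neq0 ?invr_eq0 ?expf_neq0.
  exists (sM (k ^+ 2 / t k)%R); first by apply/sz_TP; exists (k ^+ 2 / t k)%R.
  rewrite sz_kmE // sz_thetaM sz_thetaV sz_thetaX sz_thetaKE.
  by field; rewrite ?k0 ?tk0.
move=> _ _ /sz_TP[k k0 ->] /sz_TP[l l0 ->]; rewrite !sz_kmE // => e.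
have sqr_inj (a d : F) : (a ^+ 2 = d ^+ 2 -> a = d)%R.
  move/eqP; rewrite -subr_eq0 subr_sqr mulf_eq0 -[(- d)%R]sz_oppr opprK orbb.
  by rewrite addr_eq0 sz_oppr => /eqP.
(* Theta turns [k ^+ 2 * t k] into the square of [k * t k]. Once these products agree, dividing [e]
   by them isolates [k]. *)
have e2 : (k * t k = l * t l)%R.
  apply: sqr_inj; have := congr1 t e; rewrite !(sz_thetaM, sz_thetaX,
    sz_thetaKE) => e3.
  by rewrite !exprMn mulrC e3 mulrC.
congr sM; apply: (mulIf (_ : l * t l != 0)%R);
  first by rewrite mulf_neq0 ?sz_theta_eq0.
by rewrite -{1}e2 !mulrA -!expr2 e.
Qed.

Lemma sz_coordinate_U : coordinate sz_T_group sz_U_group sz_Z_group sz_ca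
  (fun u => t (sz_km u)).
Proof.
split.
- by move=> _ _ /sz_UP[a [c ->]] /sz_UP[a' [c' ->]]; rewrite sS_mul !sz_caE.
- move=> _ /sz_UP[a [c ->]]; rewrite sz_caE; apply/eqP/imsetP=> [->|[c' _]].
    by exists c.
  by move/(congr1 sz_ca); rewrite !sz_caE.
- by move=> a; exists (sS a 0%R); [apply/sz_UP; exists a, 0%R | apply: sz_caE].
- by move=> _ _ /sz_UP[a [c ->]] /sz_TP[k k0 ->];
  rewrite sS_J // !sz_caE sz_kmE.
- by move=> _ /sz_TP[k k0 ->]; apply: sz_square; rewrite sz_kmE // sz_theta_eq0.
- move=> k k0; have l0 : (t k != 0)%R by rewrite sz_theta_eq0.
  exists (sM (t k)); first by apply/sz_TP; exists (t k).
  by rewrite sz_kmE // sz_thetaKE.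
move=> _ _ /sz_TP[k k0 ->] /sz_TP[l l0 ->]; rewrite !sz_kmE // => e; congr sM.
apply/eqP; rewrite -subr_eq0 -sz_theta_eq0 sz_oppr sz_thetaD e sz_addrr //.
Qed.

Lemma sz_UTP x : reflect (exists a c k, k != 0%R /\ x = sS a c * sM k) (x \in
  sz_U * sz_T).
Proof.
apply: (iffP mulsgP) => [[_ _ /sz_UP[a [c ->]] /sz_TP[k k0 ->] ->]|[a [c [k [k0
  ->]]]]].
  by exists a, c, k.
by exists (sS a c) (sM k) => //; [apply/sz_UP; exists a, c | apply/sz_TP;
  exists k].
Qed.

Lemma sS_inv a c : (sS a c)^-1 = sS a (c + t a * a)%R.
Proof.
apply: (mulgI (sS a c)); rewrite mulgV sS_mul -sS0; congr sS;
  first by rewrite sz_addrr.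
by rewrite addrA sz_addrr add0r sz_addrr.
Qed.

Lemma sz_T_norm : sz_T \subset 'N(sz_U).
Proof.
apply/subsetP=> _ /sz_TP[k k0 ->]; rewrite inE;
  apply/subsetP=> _ /imsetP[_ /sz_UP[a [c ->]] ->].
by rewrite sS_J //; apply/sz_UP; do 2!eexists.
Qed.

Let B := (sz_U_group <*> sz_T_group)%G.

Let BE : B :=: sz_U * sz_T.
Proof. by apply: norm_joinEr; apply: sz_T_norm. Qed.

Let sS_B a c : sS a c \in B.
Proof. by rewrite BE; apply/sz_UTP; exists a, c, 1%R;
  rewrite oner_eq0 sM1 mulg1. Qed.

Let sM_B k : k != 0%R -> sM k \in B.
Proof. by move=> k0; rewrite BE; apply/sz_UTP; exists 0%R, 0%R, k;
  rewrite sS0 mul1g. Qed.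

Lemma sT_inv : sT^-1 = sT. Proof. by apply: (mulgI sT);
  rewrite mulgV sT_mul. Qed.

Let big_cell x : x \in B :* sT * sz_U -> exists b a c, b \in B /\ x = b * sT *
  sS a c.
Proof.
by case/mulsgP=> _ _ /rcosetP[b' Bb ->] /sz_UP[a [c ->]] ->; exists b', a, c.
Qed.

Let big_cell_mem b' a c : b' \in B -> b' * sT * sS a c \in B :* sT * sz_U.
Proof.
move=> Bb; apply: mem_mulg; first by rewrite mem_rcoset mulgK.
by apply/sz_UP; exists a, c.
Qed.

(** Induction on words: the union of the two cells is stable under right multiplication by each
    generator. Only the big cell times [sT] needs [sz_bruhat]. *)
Lemma sz_gen_bruhat : Sz F \subset (sz_U * sz_T) :|: (sz_U * sz_T) :* sT * sz_U.
Proof.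
rewrite -BE; apply/subsetP=> x /gen_prodgP[m [y Ay ->]].
elim: m y Ay => [|m IHm] y Ay; first by rewrite big_ord0 in_setU group1.
rewrite big_ord_recr /=; have {IHm} := IHm _ (fun i => Ay (widen_ord (leqnSn m)
  i)).
move: (\prod_(i < m) _) (y ord_max) (Ay ord_max) => {Ay y x} x y Ay Xx.
have {Ay} Ay : [\/ exists a c, y = sS a c, exists2 k, k != 0%R & y = sM k | y =
  sT].
  move: Ay; rewrite inE => /or3P[/existsP[a /existsP[c /eqP e]]|/existsP[k
    /andP[k0 /eqP e]]|/eqP e].
  - by apply: Or31; exists a, c; apply: sz_inj; rewrite sSE.
  - by apply: Or32; exists k => //; apply: sz_inj; rewrite sME.
  - by apply: Or33; apply: sz_inj; rewrite sTE.
case/setUP: Xx => [Bx|/big_cell[b' [a' [c' [Bb ->]]]]]; apply/setUP.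
  case: Ay => [[a [c ->]]|[k k0 ->]|->].
  - by left; rewrite groupM.
  - by left; rewrite groupM ?sM_B.
  - by right; have := big_cell_mem 0%R 0%R Bx; rewrite sS0 mulg1.
case: Ay => [[a [c ->]]|[k k0 ->]|->].
- by right; rewrite -mulgA sS_mul; apply: big_cell_mem.
- right; rewrite -!mulgA sS_sM // (mulgA sT) sT_sM // !mulgA.
  by apply: big_cell_mem; rewrite groupM ?sM_B ?invr_eq0.
have [e|nac] := boolP ((a' == 0%R) && (c' == 0%R)).
  by left; move/andP: e => [/eqP-> /eqP->];
    rewrite sS0 mulg1 -mulgA sT_mul mulg1.
right; rewrite negb_and in nac; have n0 := sz_norm_neq0 nac.
have /(canRL (mulgK _)) := sz_bruhat n0.
rewrite -!mulgA => ->; rewrite sS_inv !mulgA; apply: big_cell_mem.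
rewrite !groupM ?sM_B // mulf_neq0 ?invr_eq0 // -sz_theta_norm sz_theta_eq0 //.
Qed.

Lemma Sz_split_rank1 : exists (U T Z : {group gT}) w, split_rank1 2 F (Sz_group
  F) U T Z w.
Proof.
exists sz_U_group, sz_T_group, sz_Z_group, sT; split.
- apply/subsetP=> _ /sz_UP[a [c ->]]; apply: mem_gen; rewrite inE.
  by apply/or3P/Or31/existsP; exists a; apply/existsP; exists c; rewrite sSE.
- apply/subsetP=> _ /sz_TP[k k0 ->]; apply: mem_gen; rewrite inE.
  by apply/or3P/Or32/existsP; exists k; rewrite k0 sME /=.
- by apply: mem_gen; rewrite inE sTE eqxx !orbT.
- apply/pgroupP=> q q_pr /Cauchy[] // u /sz_UP[a [c ->]] oq.
  have sqr0 a' c' : (sS a' c') ^+ 2 = sS 0%R (t a' * a')%R.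
    by rewrite expgS expg1 sS_mul !sz_addrr add0r.
  have : q %| 2 ^ 2.
    by rewrite -oq order_dvdn (expgM _ 2 2) !sqr0 sz_theta0 mul0r sS0.
  by rewrite Euclid_dvdX // andbT inE /= dvdn_prime2.
- exact: sz_T_norm.
- apply/setP=> u; rewrite inE; apply/imsetP/andP=> [[c _ ->]|[/sz_UP[a [c
  ->]]]].
    split; first by apply/sz_UP; exists 0%R, c.
    by rewrite expgS expg1 sS_mul sz_theta0 mul0r addr0 !sz_addrr sS0.
  rewrite expgS expg1 sS_mul !sz_addrr add0r -sS0 => /eqP/(congr1 sz_cc).
  rewrite !sz_ccE => /eqP; rewrite mulf_eq0 sz_theta_eq0 orbb => /eqP->.
  by exists c.
- apply/centsP=> _ /sz_UP[a [c ->]] _ /imsetP[c' _ ->];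
  rewrite /commute !sS_mul.
  by rewrite sz_theta0; congr sS; ring.
- rewrite inE; apply/subsetP=> _ /imsetP[_ /sz_TP[k k0 ->] ->].
  rewrite conjgE sT_inv mulgA sT_sM // -mulgA sT_mul mulg1.
  by apply/sz_TP; exists k^-1%R; rewrite ?invr_eq0.
- exact: sz_gen_bruhat.
- apply/eqP; rewrite eqEsubset; apply/andP; split; last first.
    by rewrite sub1set in_setI group1 mem_conjg conj1g -BE group1.
  apply/subsetP=> u /setIP[/sz_UP[a [c ->]]]; rewrite mem_conjg /=.
  case/sz_UTP=> a' [c' [k [k0 e]]].
  have {}e : sT * sS a c = sS a' c' * sM k * sT.
    by rewrite -e conjgE invgK !mulgA mulgKV.
  have /matrixP em : (szT F *m szS a c = szS a' c' *m szM k *m szT F)%R.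
    have := congr1 (fun v : gT => GLval v) e.
    by rewrite [LHS]GL_ME [RHS]GL_ME [GLval (sS _ _ * _)]GL_ME !sSE sTE sME.
  (* The right-hand side is a lower triangular matrix with its columns reversed, so rows 1 and 2 of
     its first column vanish; on the left these entries are [c] and [a]. *)
  pose i1 : 'I_4 := Ordinal (isT : (1 < 4)%N);
    pose i2 : 'I_4 := Ordinal (isT : (2 < 4)%N).
  have := em i1 0%R; have := em i2 0%R.
  rewrite !mxE !big_ord_recl !big_ord0 !mxE !big_ord_recl !big_ord0 !mxE /=.
  rewrite !(mulr0, mul0r, addr0, add0r, mul1r, mulr1) => -> ->.
  by rewrite sS0 group1.
- by exists sz_cc, (fun u => (sz_km u ^+ 2 * t (sz_km u))%R);
  apply: sz_coordinate_Z.
by right; exists sz_ca, (fun u => t (sz_km u)); apply: sz_coordinate_U.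
Qed.

End Suzuki.

(** * Invariance under isomorphism and the three families *)

Lemma isog_class_sqr (p b : nat) (F : finFieldType) (aT gT : finGroupType)
    (M U T Z : {group aT}) (w : aT) (G : {group gT}) (x : {perm gT}) :
    split_rank1 p F M U T Z w -> prime p -> p <= 3 -> 1 < b -> #|F| = (p ^ b)%N
      ->
    G \isog M -> x \in Aut G -> #[x] = b -> coprime b #|G| ->
  let L := Inn G <*> <[x]> in
  (x ^: L) * (x ^: L) = x ^+ 2 *: Inn G.
Proof.
move=> SR p_pr p3 b1 cF; rewrite isog_sym => /isogP[f injf fM] Ax ox co.
have := split_rank1_morphim injf SR; rewrite (_ : (f @* M)%G = G);
  last exact: val_inj.
by move=> SR'; exact: (split_class_sqr SR' p_pr p3 b1 cF Ax ox co).
Qed.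

Theorem proposition3p5 (b : nat) (gT : finGroupType) (G : {group gT})
    (x : {perm gT}) :
  (1 < b)%N ->
  (exists F : finFieldType, #|F| = (2 ^ b)%N /\ G \isog PSL 2 F) \/
  (exists F : finFieldType, #|F| = (3 ^ b)%N /\ G \isog PSL 2 F) \/
  (exists F : finFieldType, [/\ odd b, #|F| = (2 ^ b)%N & G \isog Sz F]) ->
  x \in Aut G ->
  #[x] = b ->
  coprime b #|G| ->
  let L := Inn G <*> <[x]> in
  (x ^: L) * (x ^: L) = x ^+ 2 *: Inn G.
Proof.
move=> b1 [[F [cF isoG]]|[[F [cF isoG]]|[F [ob cF isoG]]]] Ax ox co.
- have [U [T [Z [w SR]]]] := PSL2_split_rank1 (isT : prime 2) cF.
  exact: isog_class_sqr SR _ _ b1 cF isoG Ax ox co.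
- have [U [T [Z [w SR]]]] := PSL2_split_rank1 (isT : prime 3) cF.
  exact: isog_class_sqr SR _ _ b1 cF isoG Ax ox co.
have [U [T [Z [w SR]]]] := Sz_split_rank1 cF ob.
exact: isog_class_sqr SR _ _ b1 cF isoG Ax ox co.
Qed.
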